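(* Let $\alpha\in(0,1)$, $\beta\in(0,1)$, $0<L_0<L$, $\gamma\in(0,1)$, and let $f_0\in H(\beta,L_0)$ be a probability density on $\mathcal X\subset\mathbb R$. Let $B\subset\mathcal X$ be a nonempty compact set, partitioned into $N$ intervals of length $2h$ as described in the context, with bandwidth $$h\asymp|B|^{-\frac1{2\beta+1}}(n\alpha^2)^{-\frac1{2\beta+1}}.$$ Then the sequentially interactive $\alpha$-locally differentially private mechanism and the test $\Phi$ described in the context, with $t_1=\frac{2\sqrt5}{n\alpha^2\sqrt\gamma}$ and $t_2=\sqrt{\frac{20}{n\alpha^2\gamma}}$, attain the following bound on the separation rate: $$\mathcal E_{n,\alpha}(f_0,\gamma)\le C(L,L_0,\gamma)\left\{|B|^{\frac{\beta+1}{2\beta+1}}(n\alpha^2)^{-\frac{\beta}{2\beta+1}}+\int_{\overline B}f_0+\frac1{\sqrt{n\alpha^2}}\right\},$$ where $C(L,L_0,\gamma)>0$ depends only on $L,L_0,\gamma$ (and on the constants implicit in $h\asymp\cdots$). That is, when $\rho$ equals the right-hand side, the sum of the type I error probability of $\Phi$ under $f_0$ and of its type II error probability, the latter taken in supremum over $H_1(\rho)$, is at most $\gamma$.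
   Context: **Model.** $\mathcal X\subset\mathbb R$; $X_1,X_2,\dots$ are i.i.d. with probability density $f:\mathcal X\to\mathbb R_+$. $H(\beta,L)=\{f:\mathcal X\to\mathbb R_+: |f(x)-f(y)|\le L|x-y|^\beta\ \forall x,y\in\mathcal X\}$. One tests $H_0: f\equiv f_0$ against $H_1(\rho)$: $f$ is a probability density in $H(\beta,L)$ with $\|f-f_0\|_1\ge\rho$. For $B\subset\mathcal X$, $\overline B=\mathcal X\setminus B$; $|B|$ is Lebesgue measure. $a\asymp b$ means each is bounded by a positive constant times the other. **Privacy.** A sequentially interactive mechanism is a sequence of Markov kernels $Q_i$ with $Z_i\sim Q_i(\cdot\mid X_i=x_i,Z_1=z_1,\dots,Z_{i-1}=z_{i-1})$. It is $\alpha$-locally differentially private (LDP) if $Q_i(A\mid X_i=x,z_1,\dots,z_{i-1})\le e^\alpha Q_i(A\mid X_i=x',z_1,\dots,z_{i-1})$ for all $i$, measurable $A$, $x,x'\in\mathcal X$ and $z_1,\dots,z_{i-1}$. $\mathcal Q_\alpha$ is the set of these mechanisms, $\Phi_Q$ the set of $\{0,1\}$-valued tests based on the privatized sample, and $\mathbb P_{Q_f^n}$ the law of the privatized sample when the $X_i$ have density $f$. Define $$\mathcal R_{n,\alpha}(f_0,\rho)=\inf_{Q\in\mathcal Q_\alpha}\inf_{\phi\in\Phi_Q}\sup_{f\in H_1(\rho)}\{\mathbb P_{Q_{f_0}^n}(\phi=1)+\mathbb P_{Q_f^n}(\phi=0)\},\qquad \mathcal E_{n,\alpha}(f_0,\gamma)=\inf\{\rho>0:\mathcal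 R_{n,\alpha}(f_0,\rho)\le\gamma\}.$$ In this statement the total sample size is written $3n$: the observations are $X_1,\dots,X_{3n}$, and $\mathcal E_{n,\alpha}$ refers to this sample. **Partition.** $B=\bigcup_{j=1}^N B_j$ with the $B_j$ intervals of length $2h$, $N\ge1$, so $|B|=2Nh$; common endpoints of adjacent cells are disregarded (each point lies in at most one cell). $p_0(j)=\int_{B_j}f_0$. **Mechanism and test.** Set $c_\alpha=\frac{e^\alpha+1}{e^\alpha-1}$, $\tau=(n\alpha^2)^{-1/2}$, $[x]_{-\tau}^\tau=\max\{-\tau,\min(x,\tau)\}$. - For $1\le i\le n$, $1\le j\le N$: $Z_{ij}=I(X_i\in B_j)+\frac2\alpha W_{ij}$ with $W_{ij}$ i.i.d. Laplace(1) (density $\frac12e^{-|w|}$), independent of the data; $Z_i=(Z_{ij})_j$ and $\widehat p_j=\frac1n\sum_{i=1}^nZ_{ij}$. - For $n+1\le i\le2n$: given $Z_1,\dots,Z_n$ and $X_i$ (and independently over $i$), $Z_i\in\{-c_\alpha\tau,c_\alpha\tau\}$ with $\mathbb P(Z_i=\pm c_\alpha\tau\mid X_i\in B_j)=\frac12\Big(1\pm\frac{[\widehat p_j-p_0(j)]_{-\tau}^\tau}{c_\alpha\tau}\Big)$ and $\mathbb P(Z_i=\pm c_\alpha\tau\mid X_i\in\overline B)=\frac12$. Put $D_B=\frac1n\sum_{i=n+1}^{2n}Z_i-\sum_{j=1}^Np_0(j)[\widehat p_j-p_0(j)]_{-\tau}^\tau$. - For $2n+1\le i\le3n$: $Z_i=\pm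 c_\alpha$ with (conditional on $X_i$) probabilities $\frac12\big(1\pm\frac{I(X_i\notin B)}{c_\alpha}\big)$. Put $T_B=\frac1n\sum_{i=2n+1}^{3n}Z_i-\int_{\overline B}f_0$. $\Phi=1$ if $D_B\ge t_1$ or $T_B\ge t_2$, and $\Phi=0$ otherwise. *)

(* Defs.v *)
From HB Require Import structures.
From mathcomp Require Import all_boot all_order all_algebra.
From mathcomp Require Import interval_inference.
From mathcomp Require Import all_classical all_reals all_analysis.
From mathcomp Require Import measurable_realfun.

Set Implicit Arguments.
Unset Strict Implicit.
Unset Printing Implicit Defensive.

Import Order.TTheory GRing.Theory Num.Theory.
Import numFieldNormedType.Exports.

Local Open Scope classical_set_scope.
Local Open Scope ring_scope.

Section densities.
Context {R : realType}.
Implicit Types (X : set R) (f : R -> R).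

(* Functions on [X] are total functions [R -> R] of which only the values on
   [X] matter. *)
Definition nneg_on X f := forall x, X x -> 0 <= f x.

Definition holder X (beta L : R) f :=
  nneg_on X f /\
  forall x y, X x -> X y -> `|f x - f y| <= L * `|x - y| `^ beta.

Definition density X f :=
  [/\ measurable_fun X f, nneg_on X f &
      (\int[lebesgue_measure]_(x in X) (f x)%:E = 1)%E].

Definition L1_dist X f g : \bar R :=
  (\int[lebesgue_measure]_(x in X) `|f x - g x|%:E)%E.

(* H_1(rho) *)
Definition alternative X (beta L : R) (f0 : R -> R) (rho : R) : set (R -> R) :=
  [set f | [/\ density X f, holder X beta L f &
               (rho%:E <= L1_dist X f f0)%E]].

End densities.

Section histories.
Context (d : nat -> measure_display) (Z : forall i, measurableType (d i)).

Fixpoint hist_disp k : measure_display :=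
  if k is k'.+1 then measure_prod_display (hist_disp k', d k')
  else default_measure_display.

(* The space of (Z_0, ..., Z_(k-1)); observations are numbered from 0. *)
Fixpoint hist k : measurableType (hist_disp k) :=
  match k return measurableType (hist_disp k) with
  | 0 => unit
  | k'.+1 => (hist k' * Z k')%type
  end.

Context {R : realType}.

(* [coord g k h i] is g_i (Z_i) for i < k, where h = (Z_0, ..., Z_(k-1)). *)
Fixpoint coord (g : forall i, Z i -> R) k : hist k -> nat -> R :=
  match k return hist k -> nat -> R with
  | 0 => fun _ _ => 0
  | k'.+1 => fun h i => if i == k' then g k' h.2 else coord g h.1 i
  end.

Lemma measurable_coord g (mg : forall i, measurable_fun setT (g i)) k i :
  measurable_fun setT (fun h : hist k => coord g h i).
Proof.
elim: k => [|k IH] /=; first exact: measurable_cst.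
case: eqP => [_|_].
- exact: (measurableT_comp (mg k) measurable_snd).
- exact: (measurableT_comp IH measurable_fst).
Qed.

End histories.

Section mechanisms.
Context {R : realType}.

Record mechanism := Mechanism {
  out_disp : nat -> measure_display ;
  out : forall i, measurableType (out_disp i) ;
  ker : forall i, R.-pker (R * hist out i)%type ~> out i }.

Implicit Types (Q : mechanism) (X : set R) (f : R -> R) (m : nat).

(* Only the first [m] kernels matter for a sample of size [m]; the kernels
   are only constrained at data points of [X]. *)
Definition ldp X m (alpha : R) Q : Prop :=
  forall i, (i < m)%N -> forall A, measurable A ->
  forall x x' (h : hist (out Q) i), X x -> X x' ->
  (ker Q i (x, h) A <= (expR alpha)%:E * ker Q i (x', h) A)%E.

(* The law of (Z_0, ..., Z_(m-1)) when the X_i are i.i.d. with density [f] on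
   [X]: X_k is drawn from [f] independently of the past h = (Z_0, ..., Z_(k-1))
   and Z_k from [ker Q k (X_k, h)]. *)
Fixpoint law X Q f m : set (hist (out Q) m) -> \bar R :=
  match m return set (hist (out Q) m) -> \bar R with
  | 0 => fun A => \d_tt A
  | k.+1 => fun A =>
      (\int[law X f (m := k)]_h
         \int[lebesgue_measure]_(x in X)
            ((f x)%:E * ker Q k (x, h) (xsection A h)))%E
  end.

Definition tests Q m : set (hist (out Q) m -> bool) :=
  [set phi | measurable_fun setT phi].

(* Supremum of nonnegative quantities, 0 over an empty family. *)
Definition nneg_sup (A : set (\bar R)) : \bar R := ereal_sup (0%E |` A).

Definition type1 X Q m (phi : hist (out Q) m -> bool) f0 : \bar R :=
  law X f0 [set h | phi h = true].

Definition type2 X Q m (phi : hist (out Q) m -> bool) f : \bar R :=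
  law X f [set h | phi h = false].

Section risk.
Variables (X : set R) (beta L alpha : R) (m : nat) (f0 : R -> R).

Definition private_risk (rho : R) : \bar R :=
  ereal_inf [set r | exists2 Q, ldp X m alpha Q &
    r = ereal_inf [set
          nneg_sup [set (type1 X phi f0 + type2 X phi f)%E
                   | f in alternative X beta L f0 rho]
          | phi in @tests Q m]].

Definition separation_rate (gamma : R) : \bar R :=
  ereal_inf [set rho%:E | rho in
    [set rho : R | 0 < rho /\ (private_risk rho <= gamma%:E)%E]].

End risk.

End mechanisms.

Arguments mechanism : clear implicits.

Section laplace.
Context {R : realType}.
Local Notation mu := lebesgue_measure.

Definition laplace_pdf (w : R) : R := 2^-1 * expR (- `|w|).

Lemma laplace_pdf_ge0 w : 0 <= laplace_pdf w.
Proof. by rewrite mulr_ge0// expR_ge0. Qed.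

Lemma continuous_laplace_pdf : continuous laplace_pdf.
Proof.
move=> x; apply: cvgMr; apply: continuous_comp; last exact: continuous_expR.
by apply: cvgN; exact: norm_continuous.
Qed.

Lemma measurable_laplace_pdf : measurable_fun [set: R] laplace_pdf.
Proof. exact: continuous_measurable_fun continuous_laplace_pdf. Qed.

Lemma integral_laplace_pdf : (\int[mu]_x (laplace_pdf x)%:E = 1)%E.
Proof.
rewrite ge0_symfun_integralT; last 3 first.
- exact: laplace_pdf_ge0.
- exact: continuous_laplace_pdf.
- by move=> x /=; rewrite /laplace_pdf normrN.
rewrite -set_itvcy.
rewrite -(integral_exponential_pdf (@ltr01 R)).
transitivity (\int[mu]_(x in `[0%R, +oo[) (2 * laplace_pdf x)%:E)%E; last first.
  rewrite integral_mkcond; apply: eq_integral => x _.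
  rewrite /exponential_pdf !patchE; case: ifPn => //.
  rewrite inE/= in_itv/= andbT => x0.
  by rewrite /laplace_pdf mulrA divff// !mul1r mulN1r ger0_norm.
under [RHS]eq_integral do rewrite EFinM.
rewrite ge0_integralZl//.
- by apply: measurable_funTS; apply/measurable_EFinP; exact: measurable_laplace_pdf.
- by move=> x _; rewrite lee_fin laplace_pdf_ge0.
Qed.

Definition laplace_prob (V : set R) : \bar R :=
  (\int[mu]_(x in V) (laplace_pdf x)%:E)%E.

Let laplace0 : laplace_prob set0 = 0%E.
Proof. by rewrite /laplace_prob integral_set0. Qed.

Let laplace_ge0 A : (0 <= laplace_prob A)%E.
Proof. by apply: integral_ge0 => x _; rewrite lee_fin laplace_pdf_ge0. Qed.

Let laplace_sigma_additive : semi_sigma_additive laplace_prob.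
Proof.
move=> F mF tF mUF; rewrite /laplace_prob; apply: cvg_toP.
  apply: ereal_nondecreasing_is_cvgn => m n mn.
  apply: lee_sum_nneg_natr => // k _ _; apply: integral_ge0 => /= x Fkx.
  by rewrite lee_fin laplace_pdf_ge0.
rewrite ge0_integral_bigcup//=.
- by apply/measurable_funTS/measurableT_comp => //; exact: measurable_laplace_pdf.
- by move=> x _; rewrite lee_fin laplace_pdf_ge0.
Qed.

HB.instance Definition _ := isMeasure.Build _ _ _
  laplace_prob laplace0 laplace_ge0 laplace_sigma_additive.

Let laplace_setT : laplace_prob [set: _] = 1%E.
Proof. exact: integral_laplace_pdf. Qed.

HB.instance Definition _ :=
  @Measure_isProbability.Build _ _ R laplace_prob laplace_setT.

End laplace.

Section iid.
Context d (T : measurableType d) {R : realType} (P : probability T R).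

Definition tcons N (u : T * N.-tuple T) : N.+1.-tuple T := [tuple of u.1 :: u.2].

Lemma measurable_tcons N : measurable_fun setT (@tcons N).
Proof. exact: measurable_cons. Qed.

HB.instance Definition _ N := @isMeasurableFun.Build _ _ _ _ (@tcons N)
  (@measurable_tcons N).

(* The law of a tuple of [N] i.i.d. variables of law [P]. *)
Fixpoint iid_prob N : probability (N.-tuple T) R :=
  match N return probability (N.-tuple T) R with
  | 0 => \d_[tuple]
  | N'.+1 => distribution (P \x iid_prob N')%E (@tcons N')
  end.

End iid.

Section ksample.
Context d d' d'' (T : measurableType d) (W : measurableType d')
  (Y : measurableType d'') {R : realType}.
Variables (P : R.-pker T ~> W) (F : T * W -> Y) (mF : measurable_fun setT F).

(* The law of F (t, w) when w has law P t. *)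
Definition ksample : T -> {measure set Y -> \bar R} :=
  (P \; kdirac mF)%E.

Let measurable_ksample U : measurable U -> measurable_fun setT (ksample ^~ U).
Proof. exact: (measurable_kernel (P \; kdirac mF)%E). Qed.

HB.instance Definition _ := isKernel.Build _ _ _ _ _ ksample measurable_ksample.

Let ksample_setT t : ksample t setT = 1%E.
Proof.
rewrite /ksample /mkcomp /= /kcomp.
under eq_integral do rewrite prob_kernel.
by rewrite integral_cst// mul1e prob_kernel.
Qed.

HB.instance Definition _ :=
  Kernel_isProbability.Build _ _ _ _ _ ksample ksample_setT.

End ksample.

Section two_point.
Context d (T : measurableType d) {R : realType}.
Variables (a : R) (q : T -> R) (mq : measurable_fun setT q).

Let sign_a (u : T * bool) : R := if u.2 then a else - a.

Let measurable_sign_a : measurable_fun setT sign_a.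
Proof.
apply: (@measurableT_comp _ _ _ _ _ _ (fun b : bool => if b then a else - a)) => //.
Qed.

(* Value [a] with probability [q t] and [- a] with probability [1 - q t]. *)
Definition two_point : R.-pker T ~> R :=
  ksample (kprobability (measurableT_comp measurable_bernoulli_prob mq))
    measurable_sign_a.

End two_point.

Section three_stages.
Context {R : realType}.
Variables (X : set R) (f0 : R -> R) (alpha : R) (n N : nat).
Variable J : 'I_N -> interval R.

Definition cell j : set R := [set` J j].
Definition cells : set R := \bigcup_j cell j.

(* [J] cuts [B] into pairwise disjoint intervals of length 2h; each common
   endpoint of adjacent cells is attributed to one of them. *)
Definition is_partition (B : set R) (h : R) : Prop :=
  [/\ B = cells, trivIset setT cell &
      forall j, lebesgue_measure (cell j) = (2 * h)%:E].

Lemma measurable_cell j : measurable (cell j).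
Proof. exact: measurable_itv. Qed.

Lemma measurable_cells : measurable cells.
Proof.
by apply: fin_bigcup_measurable => // j _; exact: measurable_cell.
Qed.

Definition p0 j : R := \int[lebesgue_measure]_(x in cell j) f0 x.
Definition c_alpha : R := (expR alpha + 1) / (expR alpha - 1).
Definition tau : R := (Num.sqrt (n%:R * alpha ^+ 2))^-1.
Definition clip (x : R) : R := Num.max (- tau) (Num.min x tau).

Lemma measurable_clip : measurable_fun setT clip.
Proof.
by apply: measurable_maxr => //; exact: measurable_minr.
Qed.

(* The first [n] outputs are vectors indexed by the cells, the others are
   reals. *)
Definition stage_disp (vec : bool) : measure_display :=
  if vec then measure_tuple_display default_measure_display
  else default_measure_display.

Definition stage_out (vec : bool) : measurableType (stage_disp vec) :=
  match vec return measurableType (stage_disp vec) with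
  | true => N.-tuple R
  | false => R
  end.

Definition vec_coord (j : 'I_N) vec : stage_out vec -> R :=
  match vec return stage_out vec -> R with
  | true => fun z => tnth z j
  | false => fun=> 0
  end.

Definition real_coord vec : stage_out vec -> R :=
  match vec return stage_out vec -> R with true => fun=> 0 | false => id end.

Lemma measurable_vec_coord j vec : measurable_fun setT (@vec_coord j vec).
Proof. by case: vec; [exact: measurable_tnth|exact: measurable_cst]. Qed.

Lemma measurable_real_coord vec : measurable_fun setT (@real_coord vec).
Proof. by case: vec; [exact: measurable_cst|exact: measurable_id]. Qed.

Local Notation outs := (fun i : nat => stage_out (i < n)%N).

(* Z_ij for i < n, and Z_i for n <= i < 3n *)
Definition Zvec k (h : hist outs k) (i : nat) (j : 'I_N) : R :=
  coord (fun i => @vec_coord j (i < n)%N) h i.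
Definition Zreal k (h : hist outs k) (i : nat) : R :=
  coord (fun i => @real_coord (i < n)%N) h i.

Definition phat k (h : hist outs k) j : R :=
  n%:R^-1 * \sum_(0 <= i < n) Zvec h i j.

Lemma measurable_phat k j : measurable_fun setT (fun h : hist outs k => phat h j).
Proof.
apply: measurable_funM => //; apply: measurable_sum => i.
by apply: measurable_coord => l; exact: measurable_vec_coord.
Qed.

Section kernels.
Variable k : nat.
Local Notation past := (R * hist outs k)%type.

Let noisy (u : past * N.-tuple R) : N.-tuple R :=
  [tuple \1_(cell j) u.1.1 + 2 / alpha * tnth u.2 j | j < N].

Let measurable_noisy : measurable_fun setT noisy.
Proof.
apply/measurable_fun_tnthP => j.
apply: (eq_measurable_fun
  (fun u : past * N.-tuple R => \1_(cell j) u.1.1 + 2 / alpha * tnth u.2 j)).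
  by move=> u _; rewrite /= tnth_mktuple.
apply: measurable_funD.
- apply: (@measurableT_comp _ _ _ _ _ _ (\1_(cell j) : R -> R)).
    by apply: measurable_indic; exact: measurable_cell.
  exact: (measurableT_comp measurable_fst measurable_fst).
- apply: measurable_funM => //.
  exact: (measurableT_comp (measurable_tnth j) measurable_snd).
Qed.

Definition stage1 : R.-pker past ~> stage_out true :=
  ksample (kprobability
    (measurable_cst (iid_prob laplace_prob N : pprobability _ R)))
    measurable_noisy.

(* At most one term of the sum over [j] is nonzero when the cells are
   disjoint, and none when x is outside their union. *)
Let q2 (u : past) : R :=
  2^-1 * (1 + (\sum_(j < N) \1_(cell j) u.1 * clip (phat u.2 j - p0 j))
              / (c_alpha * tau)).

Let measurable_q2 : measurable_fun setT q2.
Proof.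
apply: measurable_funM => //; apply: measurable_funD => //.
apply: measurable_funM => //; apply: measurable_sum => j.
apply: measurable_funM.
- apply: (@measurableT_comp _ _ _ _ _ _ (\1_(cell j) : R -> R)) => //.
  by apply: measurable_indic; exact: measurable_cell.
- apply: (measurableT_comp measurable_clip); apply: measurable_funB => //.
  exact: (measurableT_comp (@measurable_phat k j) measurable_snd).
Qed.

Definition stage2 : R.-pker past ~> stage_out false :=
  two_point (c_alpha * tau) measurable_q2.

Let q3 (u : past) : R := 2^-1 * (1 + \1_(~` cells) u.1 / c_alpha).

Let measurable_q3 : measurable_fun setT q3.
Proof.
apply: measurable_funM => //; apply: measurable_funD => //.
apply: measurable_funM => //.
apply: (@measurableT_comp _ _ _ _ _ _ (\1_(~` cells) : R -> R)) => //.
by apply: measurable_indic; apply: measurableC; exact: measurable_cells.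
Qed.

Definition stage3 : R.-pker past ~> stage_out false :=
  two_point c_alpha measurable_q3.

End kernels.

Definition mechanism3 : mechanism R :=
  @Mechanism R (fun i => stage_disp (i < n)%N) outs
    (fun i => match (i < n)%N as vec
                return R.-pker (R * hist outs i)%type ~> stage_out vec with
              | true => stage1 i
              | false => if (i < 2 * n)%N then stage2 i else stage3 i
              end).

Section test.
Variable h : hist (out mechanism3) (3 * n).

Definition D_B : R :=
  n%:R^-1 * \sum_(n <= i < 2 * n) Zreal h i
  - \sum_(j < N) p0 j * clip (phat h j - p0 j).

Definition T_B : R :=
  n%:R^-1 * \sum_(2 * n <= i < 3 * n) Zreal h i
  - \int[lebesgue_measure]_(x in X `\` cells) f0 x.

Definition Phi (t1 t2 : R) : bool := (t1 <= D_B) || (t2 <= T_B).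

End test.

End three_stages.

Arguments Phi {R} X f0 alpha n {N} J h t1 t2.
Arguments mechanism3 {R} f0 alpha n {N} J.

(* Main.v *)
Require Import Defs.
From HB Require Import structures.
From mathcomp Require Import all_boot all_order all_algebra.
From mathcomp Require Import all_classical all_reals all_analysis.
From mathcomp Require Import measurable_realfun ring lra.

(** Everything is a second moment computation along the history of outputs.
    Let delta_j = p_j - p0_j be the discrepancies of the cell probabilities under
    the true density f, and M_D = sum_j delta_j clip (phat_j - p0_j), which is the
    conditional mean of D_B given the first stage ([mean_D]). The mean of T_B is
    the excess mass of f outside the cells ([mean_T]).

    Privacy. Moving one observation changes the indicator vector by at most 2 in
    l1 norm, which Laplace noise of scale 2 / alpha hides; the two-point answers
    of the other stages have likelihood ratio at most exp alpha
    ([mechanism3_ldp]).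

    Chebyshev. Centred at M_D and at its mean, D_B and T_B have second moments at
    most 5 / (n alpha^2)^2 and 5 / (n alpha^2), because c_alpha^2 <= 5 / alpha^2;
    each thus deviates by its threshold with probability at most gamma / 4
    ([D_B_second_moment], [T_B_second_moment]). Under f0 both centres vanish, so
    the type I error is at most gamma / 2 ([type1_le]). Under f the test errs with
    probability at most gamma / 4 if the mean of T_B exceeds 2 t2
    ([type2_le_T]), and at most gamma / 2 if M_D exceeds 2 t1 outside an event of
    probability gamma / 4 ([type2_le_D]).

    Lower deviation of M_D. The delicate step is that M_D is at least of order
    tau^2 with probability 1 - gamma / 4 once the signal strength
    sum_j |delta_j| min (|delta_j|, tau) exceeds a constant multiple of tau^2
    ([mean_D_large]). After n steps phat_j is the frequency of cell j plus a
    normalised sum of n Laplace variables, independent between cells and of the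
    frequencies ([integral_first_stage_sum]). Cells with |delta_j| much larger than
    tau are clipped to the correct sign unless the noise is as large as the signal.
    On the other cells the frequency noise is removed by Young's inequality and a
    union of second moments (the variances p_j / n sum to at most 1 / n), and the
    Laplace noise is averaged: the mean of delta_j clip (delta_j + noise) is at
    least a constant times |delta_j| min (|delta_j|, tau), because the noise is
    symmetric and falls within tau / 2 of 0 with probability bounded below
    ([clip_mean]), and the variances of these independent bounded terms add up
    ([signal_survives]). The lower bound on that probability, uniform in n, is an
    elementary small-ball estimate for sums of symmetric variables
    ([sum_law_near0]).

    Rate. If neither centre is large, then the L1 distance between f and f0 is
    small: it is at most sum_j |delta_j|, plus |B| times the oscillation
    (L + L0) (2h)^beta on a cell, plus the masses of f and f0 outside B
    ([L1_dist_le]). By the inequality between arithmetic and geometric means a weak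
    signal gives sum_j |delta_j| of order tau + sqrt N tau ([l1_le_signal]), and
    the bandwidth makes both sqrt N tau and |B| h^beta of the order of
    |B|^((beta + 1) / (2 beta + 1)) (n alpha^2)^(- beta / (2 beta + 1))
    ([cells_rate], [bias_rate]). Hence a density at distance rho is detected. *)

Set Implicit Arguments.
Unset Strict Implicit.
Unset Printing Implicit Defensive.

Import Order.TTheory GRing.Theory Num.Theory.
Import numFieldNormedType.Exports.

Local Open Scope classical_set_scope.
Local Open Scope ring_scope.

(** * Densities and translations of Lebesgue measure *)

Section integration.
Local Open Scope ereal_scope.

Section with_density.
Context d (T : measurableType d) (R : realType).
Variables (mu m : {measure set T -> \bar R}) (D : set T) (g : T -> R).
Hypotheses (mD : measurable D) (mg : measurable_fun D g)
  (g0 : forall x, D x -> (0 <= g x)%R)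
  (mE : forall A, measurable A -> m A = \int[mu]_(x in D `&` A) (g x)%:E).

Import HBNNSimple.

Let integral_density_indic A : measurable A ->
  \int[m]_x (\1_A x)%:E = \int[mu]_(x in D) ((g x)%:E * (\1_A x)%:E).
Proof.
move=> mA; rewrite integral_indic// setIT mE// integral_mkcondr.
by apply: eq_integral => x _; rewrite epatch_indic.
Qed.

Let integral_density_nnsfun (h : {nnsfun T >-> R}) :
  \int[m]_x (h x)%:E = \int[mu]_(x in D) ((g x)%:E * (h x)%:E).
Proof.
under eq_integral do rewrite fimfunE -fsumEFin//.
rewrite ge0_integral_fsum//; last 2 first.
- by move=> r; exact/measurable_EFinP/measurableT_comp.
- by move=> r z _; rewrite EFinM nnfun_muleindic_ge0.
under [RHS]eq_integral.
  move=> x xD; rewrite fimfunE -fsumEFin// ge0_mule_fsumr; last first.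
    by move=> r; rewrite EFinM nnfun_muleindic_ge0.
  over.
rewrite ge0_integral_fsum//; last 2 first.
- move=> r; apply: emeasurable_funM; first exact/measurable_EFinP.
  by apply/measurable_EFinP/measurable_funTS; exact: measurableT_comp.
- by move=> r z Dz; apply: mule_ge0; [rewrite lee_fin g0|rewrite EFinM nnfun_muleindic_ge0].
apply: eq_fsbigr => r _.
under eq_integral do rewrite EFinM.
have [r0|r0] := leP 0%R r; last first.
  by rewrite !integral0_eq// => x _; rewrite preimage_nnfun0// indic0/= ?mulr0 ?mule0.
rewrite ge0_integralZl//; last by apply/measurable_EFinP; exact: measurable_indic.
rewrite integral_density_indic// -ge0_integralZl//; last 2 first.
- apply: emeasurable_funM; first exact/measurable_EFinP.
  by apply/measurable_funTS/measurable_EFinP; exact: measurable_indic.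
- by move=> x Dx; rewrite mule_ge0// ?lee_fin ?g0 ?lee_fin.
by apply: eq_integral => x _; rewrite EFinM muleCA.
Qed.

(** The values on simple functions determine the integral, by monotone
    convergence on both sides. *)
Lemma ge0_integral_density (h : T -> \bar R) :
  measurable_fun setT h -> (forall x, 0 <= h x) ->
  \int[m]_x h x = \int[mu]_(x in D) ((g x)%:E * h x).
Proof.
move=> mh h0; pose h_ := nnsfun_approx measurableT mh.
transitivity (\int[m]_x (lim ((h_ n x)%:E @[n --> \oo]))).
  by apply/eq_integral => z _; apply/esym/cvg_lim => //=; exact: cvg_nnsfun_approx.
rewrite monotone_convergence//; last 3 first.
- by move=> n; exact/measurable_EFinP.
- by move=> n z _; rewrite lee_fin.
- by move=> z _ a b ab; rewrite lee_fin; exact/lefP/nd_nnsfun_approx.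
transitivity (\int[mu]_(x in D) (lim (((g x)%:E * (h_ n x)%:E) @[n --> \oo]))); last first.
  apply: eq_integral => x _; apply/cvg_lim => //.
  by apply: cvgeZl => //; exact: cvg_nnsfun_approx.
rewrite monotone_convergence//; last 3 first.
- move=> n; apply: emeasurable_funM; first exact/measurable_EFinP.
  by apply/measurable_EFinP/measurable_funTS.
- by move=> n x Dx; rewrite mule_ge0// ?lee_fin ?g0 ?lee_fin.
- move=> x Dx a b ab; rewrite lee_wpmul2l ?lee_fin ?g0//.
  exact/lefP/nd_nnsfun_approx.
by congr (limn _); apply/funext => n; exact: integral_density_nnsfun.
Qed.

End with_density.

Section translation.
Context {R : realType}.
Local Notation mu := (@lebesgue_measure R).

Definition shiftr (c x : R) : R := (x + c)%R.

Let measurable_shiftr c :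
  measurable_fun [set: measurableTypeR R] (shiftr c : _ -> measurableTypeR R).
Proof. exact: measurable_funD. Qed.

HB.instance Definition _ c := @isMeasurableFun.Build _ _
  (measurableTypeR R) (measurableTypeR R) (shiftr c) (measurable_shiftr c).

(** A translation preserves the length of half-open intervals, and these
    determine the measure. *)
Lemma lebesgue_measure_shift (c : R) (A : set R) : measurable A ->
  pushforward mu (shiftr c : measurableTypeR R -> measurableTypeR R) A = mu A.
Proof.
move=> mA; apply/esym/lebesgue_measure_unique => //= _ [[a b]] _ <-.
rewrite /pushforward/=.
rewrite (_ : _ @^-1` _ = `](a - c)%R, (b - c)%R]%classic); last first.
  by apply/seteqP; split => x /=; rewrite !in_itv/= ltrBlDr lerBrDr.
rewrite !lebesgue_measure_itv/= !lte_fin ltrD2r.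
by case: ifPn => // _; rewrite -!EFinB; congr EFin; ring.
Qed.

Lemma ge0_integral_shift (f : R -> \bar R) (c : R) :
  measurable_fun setT f -> (forall x, 0 <= f x) ->
  \int[mu]_x f (x + c)%R = \int[mu]_x f x.
Proof.
move=> mf f0.
rewrite -[LHS](@ge0_integral_pushforward _ _ (measurableTypeR R)
  (measurableTypeR R) R (shiftr c) (measurable_shiftr c) mu setT f)//.
by apply: eq_measure_integral => A mA _; exact: lebesgue_measure_shift.
Qed.

Lemma ge0_integral_opp (f : R -> \bar R) :
  measurable_fun setT f -> (forall x, 0 <= f x) ->
  \int[mu]_x f (- x)%R = \int[mu]_x f x.
Proof.
move=> mf f0.
rewrite -[LHS](@ge0_integral_pushforward _ _ (measurableTypeR R) (measurableTypeR R)
  R -%R (@oppr_measurable R setT) mu setT f)//.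
by apply: eq_measure_integral => A mA _; exact: lebesgue_measureN.
Qed.

End translation.
End integration.

(** * Second moments, random walks and i.i.d. tuples *)

Section probability_tools.
Local Open Scope ereal_scope.
Context {R : realType}.

Section moments.
Context d (T : measurableType d) (P : probability T R).

(** Markov's inequality with a test function of one's choice: a sum of weights
    in [g] bounds the probability of a union of bad events in one stroke. *)
Lemma prob_le_integral (A : set T) (g : T -> \bar R) :
  measurable A -> measurable_fun setT g -> (forall x, 0 <= g x) ->
  (forall x, A x -> 1 <= g x) -> P A <= \int[P]_x g x.
Proof.
move=> mA mg g0 g1; rewrite -[A]setIT -integral_indic//.
apply: ge0_le_integral => //.
- by apply/measurable_EFinP; exact: measurable_indic.
- move=> x _; rewrite indicE; case: (boolP (x \in A)) => [xA|_].
    by apply: g1; rewrite inE in xA.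
  exact: g0.
Qed.

Lemma integral_cst_prob (c : \bar R) : \int[P]_x c = c.
Proof.
rewrite (integral_cst P measurableT c).
by rewrite [X in _ * X](_ : _ = 1) ?mule1//; exact: (probability_setT P).
Qed.

(** From |u| <= 1 + u^2 and the finiteness of the measure. *)
Lemma square_integrable_integrable (u : T -> R) : measurable_fun setT u ->
  \int[P]_x (u x ^+ 2)%:E < +oo -> P.-integrable setT (EFin \o u).
Proof.
move=> mu u2; apply/integrableP; split; first exact/measurable_EFinP.
have mu2 : measurable_fun setT (fun x => (u x ^+ 2)%:E).
  by apply/measurable_EFinP; exact: measurable_funX.
apply: (@le_lt_trans _ _ (\int[P]_x (1 + (u x ^+ 2)%:E))).
  apply: ge0_le_integral => //.
  - by apply/measurable_EFinP; exact: measurableT_comp.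
  - by apply: emeasurable_funD.
  - move=> x _ /=; rewrite lee_fin -real_normK ?num_real//.
    have := normr_ge0 (u x); set a := `|u x|%R => a0.
    have := sqr_ge0 (a - 1)%R; rewrite !expr2; nra.
rewrite ge0_integralD//; last by move=> x _; rewrite lee_fin sqr_ge0.
rewrite lte_add_pinfty// integral_cst// mul1e.
by rewrite (le_lt_trans (probability_le1 _ _))// ltry.
Qed.

Lemma bounded_integrable_prob (u : T -> R) (b : R) : measurable_fun setT u ->
  (forall x, (`|u x| <= b)%R) -> P.-integrable setT (EFin \o u).
Proof.
move=> mu ub; apply: measurable_bounded_integrable => //.
  by rewrite (le_lt_trans (probability_le1 _ _))// ltry.
exists b; split; first by rewrite num_real.
by move=> c bc x _; exact: le_trans (ub x) (ltW bc).
Qed.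

(** Adding a centred increment to a constant increases the second moment by
    the variance of the increment, hence by at most its second moment. *)
Lemma second_moment_centered (u : T -> R) (v M : R) : measurable_fun setT u ->
  \int[P]_x (u x ^+ 2)%:E <= v%:E ->
  \int[P]_x ((M + (u x - \int[P]_y u y)) ^+ 2)%:E <= (M ^+ 2 + v)%:E.
Proof.
move=> mu uv; set m := (\int[P]_y u y)%R.
have iu : P.-integrable setT (EFin \o u).
  by apply: square_integrable_integrable => //; rewrite (le_lt_trans uv)// ltry.
have mu2 : measurable_fun setT (fun x => u x ^+ 2)%R by exact: measurable_funX.
have iu2 : P.-integrable setT (EFin \o (fun x => u x ^+ 2)%R).
  apply/integrableP; split; first exact/measurable_EFinP.
  under eq_integral do rewrite /= ger0_norm ?sqr_ge0//.
  by rewrite (le_lt_trans uv)// ltry.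
have ic c : P.-integrable setT (fun=> c%:E).
  exact: finite_measure_integrable_cst.
pose c0 := ((M - m) ^+ 2)%R; pose c1 := (2 * (M - m))%R.
rewrite [leLHS](_ : _ =
    \int[P]_x (c0%:E + (c1%:E * (u x)%:E + (u x ^+ 2)%:E))); last first.
  apply: eq_integral => x _.
  by rewrite /= -EFinM -!EFinD /c0 /c1; congr EFin; ring.
rewrite integralD//; last first.
  by apply: integrableD => //; exact: integrableZl.
rewrite integralD//; last exact: integrableZl.
rewrite integralZl// integral_cst_prob.
have mE : \int[P]_x (u x)%:E = m%:E.
  by rewrite /m /Rintegral fineK//; exact: integrable_fin_num.
rewrite mE addeA -EFinM -EFinD.
apply: (@le_trans _ _ ((c0 + c1 * m)%:E + v%:E)); first by rewrite leeD2l.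
rewrite -EFinD lee_fin lerD2r /c0 /c1.
have := sqr_ge0 m; rewrite !expr2; nra.
Qed.

End moments.

Lemma measurable_fun_integral_snd d1 d2 (T1 : measurableType d1)
    (T2 : measurableType d2) (P : probability T2 R) (h : T1 -> T2 -> \bar R) :
  measurable_fun setT (fun u : T1 * T2 => h u.1 u.2) ->
  (forall x y, 0 <= h x y) ->
  measurable_fun setT (fun x => \int[P]_y h x y).
Proof.
move=> mh h0; apply: (measurable_fun_fubini_tonelli_F (m2 := P)
  (fun u : T1 * T2 => h u.1 u.2)) => //.
Qed.

Section walk.
Context d (T : measurableType d).
Variables (op : {mfun (T * T)%type >-> T}) (e : T).
Variable P : probability T R.

(** Sums of reals and sums of vectors are both walks, for [op] an addition. *)
Fixpoint walk n : probability T R :=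
  if n is n'.+1 then
    distribution (walk n' \x P) op
  else \d_e.

Implicit Type g : T -> \bar R.

Lemma integral_walk0 g : measurable_fun setT g -> \int[walk 0]_x g x = g e.
Proof. by move=> mg; rewrite integral_dirac// diracT mul1e. Qed.

Lemma integral_walkS n g : measurable_fun setT g -> (forall x, 0 <= g x) ->
  \int[walk n.+1]_x g x = \int[walk n]_x \int[P]_y g (op (x, y)).
Proof.
move=> mg g0 /=.
rewrite ge0_integral_distribution//.
rewrite (fubini_tonelli1 (g \o op)) => [//||u]; last exact: g0.
exact: measurableT_comp.
Qed.

(** The walk from [e] run for a + b steps is the sum of two independent walks:
    this uses only that [op] is associative with right unit [e]. *)
Lemma integral_walkD a b g :
  (forall x y z, op (op (x, y), z) = op (x, op (y, z))) ->
  (forall x, op (x, e) = x) ->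
  measurable_fun setT g -> (forall x, 0 <= g x) ->
  \int[walk (a + b)]_x g x = \int[walk a]_x \int[walk b]_y g (op (x, y)).
Proof.
move=> opA ope; have mop : measurable_fun setT op by [].
elim: b g => [|b IH] g mg g0.
  rewrite addn0; apply: eq_integral => x _; rewrite integral_walk0 ?ope//.
  apply: (measurableT_comp mg).
  exact: (measurableT_comp mop (pair1_measurable x)).
rewrite addnS integral_walkS//.
have mg' : measurable_fun setT (fun s => \int[P]_w g (op (s, w))).
  apply: (@measurable_fun_integral_snd _ _ _ _ P (fun s w => g (op (s, w)))) => //.
  rewrite (_ : (fun u => _) = g \o op); last by apply/funext => -[].
  exact: measurableT_comp.
rewrite IH//; last by move=> x; exact: integral_ge0.
apply: eq_integral => x _; rewrite integral_walkS//.
  by apply: eq_integral => y _; apply: eq_integral => w _; rewrite opA.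
apply: (measurableT_comp mg).
exact: (measurableT_comp mop (pair1_measurable x)).
Qed.

(** An additive functional of the walk, centred, is a martingale: its second
    moment grows by at most [v] at each step. *)
Lemma walk_second_moment (p : T -> R) (v : R) n : measurable_fun setT p ->
  p e = 0%R -> (forall x y, p (op (x, y)) = p x + p y)%R ->
  \int[P]_x (p x ^+ 2)%:E <= v%:E ->
  \int[walk n]_s ((p s - n%:R * \int[P]_y p y) ^+ 2)%:E <= (n%:R * v)%:E.
Proof.
move=> mp pe pD pv; set m := (\int[P]_y p y)%R.
have mq k : measurable_fun setT (fun s : T => ((p s - k%:R * m) ^+ 2)%:E).
  by apply/measurable_EFinP; apply: measurable_funX; exact: measurable_funB.
elim: n => [|n IH].
  by rewrite integral_walk0// pe !mul0r subr0 expr0n.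
rewrite integral_walkS//; last by move=> x; rewrite lee_fin sqr_ge0.
have v0 : (0 <= v)%R.
  by rewrite -lee_fin (le_trans _ pv)// integral_ge0// => x _; rewrite lee_fin sqr_ge0.
apply: (@le_trans _ _ (\int[walk n]_s (((p s - n%:R * m) ^+ 2)%:E + v%:E))).
  apply: ge0_le_integral => //.
  - by move=> x _; apply: integral_ge0 => y _; rewrite lee_fin sqr_ge0.
  - apply: (@measurable_fun_integral_snd _ _ _ _ P
      (fun s w => ((p (op (s, w)) - n.+1%:R * m) ^+ 2)%:E)).
      rewrite (_ : (fun u => _) = (fun s : T => ((p s - n.+1%:R * m) ^+ 2)%:E) \o op).
        exact: measurableT_comp.
      by apply/funext => -[].
    by move=> *; rewrite lee_fin sqr_ge0.
  - by apply: emeasurable_funD.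
  - move=> x _; rewrite -EFinD.
    apply: le_trans (second_moment_centered (p x - n%:R * m) mp pv).
    rewrite le_eqVlt; apply/orP; left; apply/eqP/eq_integral => y _.
    by congr EFin; rewrite pD -/m -natr1; ring.
rewrite ge0_integralD//; last by move=> x _; rewrite lee_fin sqr_ge0.
rewrite integral_cst_prob -natr1 mulrDl mul1r EFinD leeD2r//.
Qed.

End walk.

Section iid.
Context d (T : measurableType d) (P : probability T R).

Lemma integral_iidS N (G : N.+1.-tuple T -> \bar R) :
  measurable_fun setT G -> (forall t, 0 <= G t) ->
  \int[iid_prob P N.+1]_t G t =
  \int[P]_x \int[iid_prob P N]_t G (tcons (x, t)).
Proof.
move=> mG G0 /=; rewrite ge0_integral_distribution//.
rewrite (fubini_tonelli1 (G \o @tcons _ T N)) => [//||u]; last exact: G0.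
by apply: measurableT_comp => //; exact: measurable_tcons.
Qed.

Lemma measurable_tcons_snd N (x : T) :
  measurable_fun setT (fun t : N.-tuple T => tcons (x, t)).
Proof. by apply: (measurableT_comp (@measurable_tcons _ T N)). Qed.

Lemma measurable_integral_tcons N (G : N.+1.-tuple T -> \bar R) :
  measurable_fun setT G -> (forall t, 0 <= G t) ->
  measurable_fun setT (fun x => \int[iid_prob P N]_t G (tcons (x, t))).
Proof.
move=> mG G0.
apply: (@measurable_fun_integral_snd _ _ _ _ (iid_prob P N) (fun x t => G (tcons (x, t)))) => //.
rewrite (_ : (fun u => _) = G \o @tcons _ T N); last by apply/funext => -[].
by apply: measurableT_comp => //; exact: measurable_tcons.
Qed.

Lemma tnth_tcons0 N (x : T) (t : N.-tuple T) : tnth (tcons (x, t)) ord0 = x.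
Proof. by rewrite (tnth_nth x). Qed.

Lemma tnth_tconsS N (x : T) (t : N.-tuple T) j :
  tnth (tcons (x, t)) (lift ord0 j) = tnth t j.
Proof. by rewrite !(tnth_nth x). Qed.

Lemma integral_iid_tnth N (j : 'I_N) (g : T -> \bar R) :
  measurable_fun setT g -> (forall x, 0 <= g x) ->
  \int[iid_prob P N]_t g (tnth t j) = \int[P]_x g x.
Proof.
move=> mg g0; elim: N j => [[]//|N IH] j.
rewrite integral_iidS//; last first.
  by apply: measurableT_comp => //; exact: measurable_tnth.
case: (unliftP ord0 j) => [j'|] ->.
  under eq_integral do under eq_integral do rewrite tnth_tconsS.
  by under eq_integral do rewrite IH; rewrite integral_cst_prob.
under eq_integral do under eq_integral do rewrite tnth_tcons0.
by under eq_integral do rewrite integral_cst_prob.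
Qed.

(** Peeling off one coordinate at a time, each adds at most the second moment of
    its function, by [second_moment_centered]. *)
Lemma iid_second_moment N (u : 'I_N -> T -> R) (v : 'I_N -> R) (M : R) :
  (forall j, measurable_fun setT (u j)) ->
  (forall j, \int[P]_x (u j x ^+ 2)%:E <= (v j)%:E) ->
  \int[iid_prob P N]_t
     ((M + \sum_(j < N) (u j (tnth t j) - \int[P]_x u j x)) ^+ 2)%:E
  <= (M ^+ 2 + \sum_(j < N) v j)%:E.
Proof.
have mS n (w : 'I_n -> T -> R) c : (forall j, measurable_fun setT (w j)) ->
    measurable_fun setT (fun t : n.-tuple T =>
      ((c + \sum_(j < n) (w j (tnth t j) - \int[P]_x w j x)) ^+ 2)%:E).
  move=> mw; apply/measurable_EFinP; apply: measurable_funX.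
  apply: measurable_funD => //; apply: measurable_sum => j.
  apply: measurable_funB => //; apply: measurableT_comp => //.
  exact: measurable_tnth.
elim: N u v M => [|N IH] u v M mu uv.
  under eq_integral do rewrite big_ord0 addr0.
  by rewrite integral_cst_prob big_ord0 addr0.
rewrite integral_iidS//; last 2 first.
- exact: mS.
- by move=> t; rewrite lee_fin sqr_ge0.
pose V := (\sum_(j < N) v (lift ord0 j))%R.
have v0 j : (0 <= v j)%R.
  by rewrite -lee_fin (le_trans _ (uv j))// integral_ge0// => x _; rewrite lee_fin sqr_ge0.
have V0 : (0 <= V)%R by apply: sumr_ge0.
pose m := (\int[P]_x u ord0 x)%R.
have mq : measurable_fun setT (fun x => ((M + (u ord0 x - m)) ^+ 2)%:E).
  apply/measurable_EFinP; apply: measurable_funX; apply: measurable_funD => //.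
  exact: measurable_funB.
apply: (@le_trans _ _ (\int[P]_x (((M + (u ord0 x - m)) ^+ 2)%:E + V%:E))).
  apply: ge0_le_integral => //.
  - by move=> x _; apply: integral_ge0 => t _; rewrite lee_fin sqr_ge0.
  - apply: (@measurable_integral_tcons N (fun t =>
      ((M + \sum_(j < N.+1) (u j (tnth t j) - \int[P]_x u j x)) ^+ 2)%:E)).
      exact: mS.
    by move=> t; rewrite lee_fin sqr_ge0.
  - exact: emeasurable_funD.
  - move=> x _; rewrite -EFinD.
    apply: le_trans (IH (fun j => u (lift ord0 j)) _ (M + (u ord0 x - m))%R _ _) => //.
    rewrite le_eqVlt; apply/orP; left; apply/eqP/eq_integral => t _.
    rewrite big_ord_recl tnth_tcons0 addrA; congr (((_ + _) ^+ 2)%:E).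
    by apply: eq_bigr => j _; rewrite tnth_tconsS.
rewrite ge0_integralD//; last by move=> x _; rewrite lee_fin sqr_ge0.
rewrite integral_cst_prob big_ord_recl addrA EFinD leeD2r//.
exact: second_moment_centered.
Qed.

End iid.
End probability_tools.

(** * Sums of i.i.d. reals and vectors *)

Section sums.
Local Open Scope ereal_scope.
Context {R : realType}.

Definition add2 (u : R * R) : R := (u.1 + u.2)%R.

Let measurable_add2 : measurable_fun setT add2.
Proof. exact: measurable_funD. Qed.

HB.instance Definition _ := @isMeasurableFun.Build _ _ _ _ add2 measurable_add2.

Definition tadd N (u : N.-tuple R * N.-tuple R) : N.-tuple R :=
  [tuple (tnth u.1 j + tnth u.2 j)%R | j < N].

Let measurable_tadd N : measurable_fun setT (@tadd N).
Proof.
apply/measurable_fun_tnthP => j.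
apply: (eq_measurable_fun (fun u : N.-tuple R * N.-tuple R =>
  tnth u.1 j + tnth u.2 j)%R); first by move=> u _; rewrite /= tnth_mktuple.
apply: measurable_funD.
- exact: (measurableT_comp (measurable_tnth j) measurable_fst).
- exact: (measurableT_comp (measurable_tnth j) measurable_snd).
Qed.

HB.instance Definition _ N :=
  @isMeasurableFun.Build _ _ _ _ (@tadd N) (@measurable_tadd N).

Definition tzero N : N.-tuple R := [tuple 0%R | j < N].

Definition sum_law (P : probability R R) n := walk add2 0%R P n.

Definition vector_sum_law N (P : probability (N.-tuple R) R) n :=
  walk (@tadd N) (tzero N) P n.

Lemma tadd_tcons N (x y : R) (s t : N.-tuple R) :
  tadd (tcons (x, s), tcons (y, t)) = tcons ((x + y)%R, tadd (s, t)).
Proof.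
apply: eq_from_tnth => j; rewrite tnth_mktuple /=.
by case: (unliftP ord0 j) => [i|] ->;
  rewrite ?tnth_tconsS ?tnth_tcons0 ?tnth_mktuple.
Qed.

Lemma measurable_taddr N (s : N.-tuple R) : measurable_fun setT (fun t => tadd (s, t)).
Proof. exact: (@measurableT_comp _ _ _ _ _ _ (@tadd N)). Qed.

(** Forming i.i.d. tuples commutes with convolution, by exchanging the order in
    which the coordinates of the two tuples are drawn. *)
Let integral_iid_convolution N (P Q K : probability R R) (G : N.-tuple R -> \bar R) :
  (forall g : R -> \bar R, measurable_fun setT g -> (forall x, 0 <= g x) ->
     \int[K]_x g x = \int[P]_x \int[Q]_y g (x + y)%R) ->
  measurable_fun setT G -> (forall t, 0 <= G t) ->
  \int[iid_prob K N]_t G t =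
  \int[iid_prob P N]_s \int[iid_prob Q N]_t G (tadd (s, t)).
Proof.
move=> KE; elim: N G => [|N IH] G mG G0.
  have GE t : G t = G [tuple] by congr G; apply: eq_from_tnth => -[].
  under eq_integral do rewrite GE.
  under [RHS]eq_integral do under eq_integral do rewrite GE.
  by under [RHS]eq_integral do rewrite integral_cst_prob; rewrite !integral_cst_prob.
have mG' : measurable_fun setT (fun s => \int[iid_prob Q N.+1]_t G (tadd (s, t))).
  apply: (@measurable_fun_integral_snd _ _ _ _ _ (iid_prob Q N.+1) (fun s t => G (tadd (s, t)))) => //.
  rewrite (_ : (fun u => _) = G \o @tadd _); last by apply/funext => -[].
  exact: measurableT_comp.
pose H (u : (R * N.-tuple R) * N.-tuple R) := G (tcons (u.1.1, tadd (u.1.2, u.2))).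
have mH : measurable_fun setT H.
  apply: (measurableT_comp mG); apply: (measurableT_comp (@measurable_tcons _ R N)).
  apply: measurable_fun_pair.
    exact: (measurableT_comp measurable_fst measurable_fst).
  apply: (@measurableT_comp _ _ _ _ _ _ (@tadd N)) => //; apply: measurable_fun_pair => //.
  exact: (measurableT_comp measurable_snd measurable_fst).
pose H1 (u : R * N.-tuple R) := \int[iid_prob Q N]_t H (u, t).
have mH1 : measurable_fun setT H1.
  apply: (@measurable_fun_integral_snd _ _ _ _ _ (iid_prob Q N) (fun u t => H (u, t))).
    by apply: (eq_measurable_fun H) => // -[].
  by move=> *; exact: G0.
have H10 u : 0 <= H1 u by apply: integral_ge0 => t _; exact: G0.
rewrite !integral_iidS//; last by move=> s; apply: integral_ge0.
transitivity (\int[K]_z \int[iid_prob P N]_s H1 (z, s)).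
  apply: eq_integral => z _; rewrite IH//.
  by apply: (measurableT_comp mG); exact: measurable_tcons_snd.
rewrite KE//; last 2 first.
- apply: (@measurable_fun_integral_snd _ _ _ _ _ (iid_prob P N) (fun z s => H1 (z, s))).
    by apply: (eq_measurable_fun H1) => // -[].
  by move=> *; exact: H10.
- by move=> z; apply: integral_ge0.
apply: eq_integral => x _.
have mH2 : measurable_fun setT (fun u : R * N.-tuple R => H1 ((x + u.1)%R, u.2)).
  apply: (measurableT_comp mH1); apply: measurable_fun_pair => //.
  exact: measurable_funD.
rewrite (fubini_tonelli (fun u : R * N.-tuple R => H1 ((x + u.1)%R, u.2)))//.
apply: eq_integral => s _; rewrite integral_iidS//; last first.
  exact: (measurableT_comp mG (measurable_taddr _)).
by apply: eq_integral => y _; apply: eq_integral => t _; rewrite tadd_tcons.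
Qed.

(** By induction on the number of summands, from the commutation of convolution
    with forming tuples. *)
Lemma integral_vector_sum_law_iid N (P : probability R R) n (G : N.-tuple R -> \bar R) :
  measurable_fun setT G -> (forall t, 0 <= G t) ->
  \int[vector_sum_law (iid_prob P N) n]_t G t = \int[iid_prob (sum_law P n) N]_t G t.
Proof.
elim: n G => [|n IH] G mG G0.
  rewrite integral_walk0//; elim: N G mG G0 => [|N IH] G mG G0.
    have GE t : G t = G [tuple] by congr G; apply: eq_from_tnth => -[].
    by under eq_integral do rewrite GE; rewrite integral_cst_prob GE.
  rewrite integral_iidS// integral_walk0//; last exact: measurable_integral_tcons.
  rewrite -IH//; last by apply: (measurableT_comp mG); exact: measurable_tcons_snd.
  congr G; apply: eq_from_tnth => j; rewrite tnth_mktuple /=.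
  by case: (unliftP ord0 j) => [i|] ->;
    rewrite ?tnth_tconsS ?tnth_tcons0 ?tnth_mktuple.
rewrite integral_walkS// IH//; last 2 first.
- apply: (@measurable_fun_integral_snd _ _ _ _ _ (iid_prob P N) (fun s t => G (tadd (s, t)))) => //.
  rewrite (_ : (fun u => _) = G \o @tadd _); last by apply/funext => -[].
  exact: measurableT_comp.
- by move=> s; apply: integral_ge0.
rewrite -(@integral_iid_convolution N (sum_law P n) P (sum_law P n.+1))//.
by move=> g mg g0; rewrite integral_walkS.
Qed.

Lemma integral_sum_lawD (P : probability R R) a b (g : R -> \bar R) :
  measurable_fun setT g -> (forall x, 0 <= g x) ->
  \int[sum_law P (a + b)]_x g x = \int[sum_law P a]_x \int[sum_law P b]_y g (x + y)%R.
Proof.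
apply: integral_walkD => [x y z|x].
  exact: (esym (addrA x y z)).
exact: addr0.
Qed.

Definition symmetric_law (P : probability R R) := forall g : R -> \bar R,
  measurable_fun setT g -> (forall x, 0 <= g x) ->
  \int[P]_x g (- x)%R = \int[P]_x g x.

Lemma sum_law_symmetric (P : probability R R) n :
  symmetric_law P -> symmetric_law (sum_law P n).
Proof.
move=> PN; elim: n => [|n IH] g mg g0.
  rewrite !integral_walk0 ?oppr0//; exact: measurableT_comp.
rewrite !integral_walkS//; last exact: measurableT_comp.
rewrite -[RHS]IH//; last 2 first.
- apply: (@measurable_fun_integral_snd _ _ _ _ _ P (fun s t => g (add2 (s, t)))) => //.
  rewrite (_ : (fun u => _) = g \o add2); last by apply/funext => -[].
  exact: measurableT_comp.
- by move=> s; apply: integral_ge0.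
apply: eq_integral => x _.
rewrite -(PN (fun y => g (add2 ((- x)%R, y))))//.
  by apply: eq_integral => y _; rewrite /add2/= opprD.
apply: (measurableT_comp mg).
exact: (@measurableT_comp _ _ _ _ _ _ add2).
Qed.

End sums.

(** * Small-ball lower bound for sums of symmetric variables *)

Section symmetric.
Local Open Scope ereal_scope.
Context {R : realType}.

Lemma Rintegral_symmetric (P : probability R R) (u : R -> R) :
  symmetric_law P -> measurable_fun setT u ->
  (\int[P]_x u (- x) = \int[P]_x u x)%R.
Proof.
move=> PN mu; rewrite /Rintegral; congr fine.
have mp : measurable_fun setT (EFin \o u)^\+ by exact/measurable_funepos/measurable_EFinP.
have mn : measurable_fun setT (EFin \o u)^\- by exact/measurable_funeneg/measurable_EFinP.
rewrite [LHS]integralE [RHS]integralE; congr (_ - _).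
- rewrite -[RHS]PN//; apply: eq_integral => x _.
  by rewrite !funeposE.
- rewrite -[RHS]PN//; apply: eq_integral => x _.
  by rewrite !funenegE.
Qed.

End symmetric.

Section small_ball.
Local Open Scope ereal_scope.
Context {R : realType}.

Definition near0 (r : R) : set R := [set x : R | (`|x| <= r)%R].

Lemma measurable_near0 r : measurable (near0 r).
Proof.
rewrite (_ : near0 r = `[(- r)%R, r]%classic).
  exact: measurable_itv.
by apply/seteqP; split => x; rewrite /near0 /= in_itv /= ler_norml.
Qed.

Variables (P : probability R R) (w0 : R).
Hypotheses (PN : symmetric_law P)
  (P2 : \int[P]_x (x ^+ 2)%:E <= 16%:E)
  (P0 : w0%:E <= P (near0 8^-1)).

Let mindic (A : set R) : measurable A ->
  measurable_fun setT (fun x => (\1_A x)%:E : \bar R).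
Proof. by move=> mA; apply/measurable_EFinP; exact: measurable_indic. Qed.

Let indic_ge0' (A : set R) x : 0 <= (\1_A x)%:E :> \bar R.
Proof. by rewrite lee_fin. Qed.

Let sum_law_mean0 : (\int[P]_x x = 0)%R.
Proof.
have iP : P.-integrable setT (EFin \o (fun x : R => x)).
  apply: square_integrable_integrable; first exact: measurable_id.
  exact: le_lt_trans P2 (ltry _).
have := Rintegral_symmetric PN (@measurable_id _ R setT).
under eq_Rintegral do rewrite -mulN1r.
rewrite RintegralZl// mulN1r => ?; lra.
Qed.

Lemma sum_law_second_moment m : \int[sum_law P m]_x (x ^+ 2)%:E <= (m%:R * 16)%:E.
Proof.
have := @walk_second_moment _ _ _ add2 0%R P (fun x => x) 16%R m
  (@measurable_id _ _ _) erefl (fun _ _ => erefl) P2.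
apply: le_trans.
rewrite le_eqVlt; apply/orP; left; apply/eqP/eq_integral => x _.
by rewrite sum_law_mean0 mulr0 subr0.
Qed.

(** By Chebyshev's inequality a sum of m variables falls within 4 rho of 0 with
    probability at least 1/2. Were all 64 intervals of length rho / 8 that cover
    this range lighter than 1/256, they would carry at most 1/4 together. *)
Let sum_law_popular_interval m (rho : R) : (0 < rho)%R -> (2 * m%:R <= rho ^+ 2)%R ->
  exists a : R, (256^-1)%:E <= sum_law P m `[a, (a + rho / 8)%R]%classic.
Proof.
move=> rho0 mrho.
pose I (k : nat) : set R := `[(- 4 * rho + k%:R * (rho / 8))%R,
  (- 4 * rho + k%:R * (rho / 8) + rho / 8)%R]%classic.
suff [k] : exists k : nat, (256^-1)%:E <= sum_law P m (I k) by exists (- 4 * rho + k%:R * (rho / 8))%R.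
apply/not_existsP => small.
have mI k : measurable (I k) by exact: measurable_itv.
have : 1 <= \int[sum_law P m]_x (\sum_(k < 64) (\1_(I k) x)%:E + ((4 * rho) ^- 2)%:E * (x ^+ 2)%:E).
  rewrite -(integral_cst_prob (sum_law P m) 1).
  apply: ge0_le_integral => //.
  - apply: emeasurable_funD.
      by apply: emeasurable_sum => k; exact: mindic.
    by apply: measurable_funeM; apply/measurable_EFinP; exact: measurable_funX.
  move=> x _; have [x4|x4] := leP (4 * rho)%R `|x|%R.
    rewrite -[leLHS]add0e leeD//; first by apply: sume_ge0 => k _.
    rewrite -EFinM lee_fin mulrC ler_pdivlMr ?mul1r ?exprn_gt0 ?mulr_gt0//.
    by rewrite -(real_normK (num_real x)) lerXn2r ?nnegrE// mulr_ge0// ltW.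
  rewrite -[leLHS]adde0 leeD//; last by rewrite -EFinM lee_fin mulr_ge0 ?invr_ge0 ?sqr_ge0.
  pose y := ((x + 4 * rho) / (rho / 8))%R.
  have r8 : (0 < rho / 8)%R by rewrite divr_gt0.
  move: x4; rewrite ltr_norml => /andP[x4 x4'].
  have y0 : (0 <= y)%R by rewrite divr_ge0 ?(ltW r8)//; lra.
  have y64 : (y < 64)%R by rewrite /y ltr_pdivrMr//; lra.
  have := truncn_itv y0; set k := Num.truncn y => /andP[ky yk].
  have k64 : (k < 64)%N by rewrite -(ltr_nat R); exact: le_lt_trans y64.
  rewrite (bigD1 (Ordinal k64))//= -[leLHS]adde0 leeD//; last by apply: sume_ge0.
  rewrite indicE mem_set// /I /= in_itv /=.
  move: ky yk; rewrite /y ler_pdivlMr// ltr_pdivrMr// -natr1 mulrDl mul1r => h1 h2.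
  by apply/andP; split; lra.
apply/negP; rewrite -ltNge ge0_integralD//; last 4 first.
- by move=> x _; apply: sume_ge0.
- by apply: emeasurable_sum => k; exact: mindic.
- by move=> x _; rewrite -EFinM lee_fin mulr_ge0 ?invr_ge0 ?sqr_ge0.
- by apply: measurable_funeM; apply/measurable_EFinP; exact: measurable_funX.
rewrite ge0_integral_sum//; last by move=> k; exact: mindic.
rewrite ge0_integralZl//; last 3 first.
- by apply/measurable_EFinP; exact: measurable_funX.
- by move=> x _; rewrite lee_fin sqr_ge0.
- by rewrite lee_fin invr_ge0 sqr_ge0.
apply: (@le_lt_trans _ _ ((4^-1)%:E + (2^-1)%:E)); last first.
  by rewrite -EFinD lte_fin; lra.
apply: leeD.
- apply: (@le_trans _ _ (\sum_(k < 64) (256^-1)%:E)).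
    apply: lee_sum => k _; rewrite integral_indic// setIT ltW//.
    by have /negP := small k; rewrite -ltNge.
  rewrite le_eqVlt; apply/orP; left; apply/eqP.
  by rewrite sumEFin; congr EFin; rewrite sumr_const card_ord -mulr_natr; field.
- apply: (@le_trans _ _ (((4 * rho) ^- 2)%:E * (m%:R * 16)%:E)).
    apply: lee_wpmul2l; last exact: sum_law_second_moment.
    by rewrite lee_fin invr_ge0 sqr_ge0.
  rewrite -EFinM lee_fin mulrC ler_pdivrMr ?exprn_gt0 ?mulr_gt0//.
  by rewrite exprMn; lra.
Qed.

Let prob_indic (Q : probability R R) (A : set R) : measurable A ->
  Q A = \int[Q]_x (\1_A x)%:E.
Proof. by move=> mA; rewrite integral_indic// setIT. Qed.

Let measurable_indic_add (Q : probability R R) (A : set R) : measurable A ->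
  measurable_fun setT (fun x : R => \int[Q]_y (\1_A (x + y)%R)%:E).
Proof.
move=> mA; apply: (@measurable_fun_integral_snd _ _ _ _ _ Q (fun x y : R => (\1_A (x + y)%R)%:E)) => //.
apply: (measurableT_comp (mindic mA)); exact: measurable_funD.
Qed.

Let measurable_addl (x : R) : measurable_fun setT (fun y : R => x + y)%R.
Proof. exact: measurable_funD. Qed.

(** Two independent copies both fall in the popular interval with probability
    the square of its mass; by symmetry, so do one copy and the opposite of
    the other, and then the sum is within the length of that interval. *)
Let sum_law_even_near0 m (rho : R) : (0 < rho)%R -> (2 * m%:R <= rho ^+ 2)%R ->
  ((256^-1) ^+ 2)%:E <= sum_law P (m + m) (near0 (rho / 8)).
Proof.
move=> rho0 mrho; have [a aP] := sum_law_popular_interval rho0 mrho.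
set I := `[a, (a + rho / 8)%R]%classic in aP.
have mI : measurable I by exact: measurable_itv.
have mI' : measurable_fun setT (fun x : R => (\1_I (- x)%R)%:E : \bar R).
  exact: (measurableT_comp (mindic mI) (@oppr_measurable R setT)).
have mN r := measurable_near0 r.
rewrite prob_indic// integral_sum_lawD//; last exact: mindic.
apply: (@le_trans _ _ (\int[sum_law P m]_x ((256^-1)%:E * (\1_I x)%:E))).
  rewrite ge0_integralZl//; last exact: mindic.
  by rewrite expr2 EFinM -prob_indic// lee_wpmul2l// lee_fin.
apply: ge0_le_integral => //.
- by apply: measurable_funeM; exact: mindic.
- exact: measurable_indic_add.
move=> x _; rewrite indicE; have [xI|_] := boolP (x \in I); last first.
  by rewrite mule0; apply: integral_ge0.
rewrite mule1 (le_trans aP)// prob_indic// -(sum_law_symmetric m PN (mindic mI))//.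
apply: ge0_le_integral => //.
  apply: (measurableT_comp (mindic (mN _)) (measurable_addl x)).
move=> y _; rewrite lee_fin !indicE.
have [yI|] := boolP (_ \in I); last by [].
rewrite mem_set// /near0 /=.
move: xI yI; rewrite !inE /I /= !in_itv /= => /andP[? ?] /andP[? ?].
by rewrite ler_norml; apply/andP; split; lra.
Qed.

(** Mass near 0 on the scale of the standard deviation, bounded below uniformly
    in the number of summands: an even number of them splits into two independent
    halves, and the remaining one, if any, is near 0 with probability [w0]. *)
Lemma sum_law_near0 n : (0 < n)%N -> (0 <= w0 <= 1)%R ->
  (w0 * (256^-1) ^+ 2)%:E <= sum_law P n (near0 (Num.sqrt n%:R / 4)).
Proof.
move=> n0 /andP[w00 w01]; have w00' : 0 <= w0%:E by rewrite lee_fin.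
set rho := Num.sqrt n%:R.
have rho2 : (rho ^+ 2 = n%:R)%R by rewrite sqr_sqrtr.
have rho1 : (1 <= rho)%R by rewrite -sqrtr1 ler_sqrt ?ler1n// ltr0n.
have rho0 : (0 < rho)%R by exact: lt_le_trans rho1.
have nE : n = (n./2 + n./2 + odd n)%N by rewrite addnn addnC odd_double_half.
have mrho : (2 * (n./2)%:R <= rho ^+ 2)%R.
  by rewrite rho2 -natrM ler_nat mul2n {2}nE addnn leq_addr.
have mN r := measurable_near0 r.
rewrite prob_indic// nE integral_sum_lawD//; last exact: mindic.
have odd_near0 : w0%:E <= sum_law P (odd n) (near0 (rho / 8)).
  rewrite prob_indic//; case: (odd n).
    rewrite integral_walkS ?integral_walk0//; last 2 first.
    - exact: measurable_indic_add.
    - exact: mindic.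
    apply: (le_trans P0); rewrite prob_indic; last exact: (mN 8^-1%R).
    apply: ge0_le_integral => //.
    - exact: mindic (mN _).
    - exact: (measurableT_comp (mindic (mN _)) (measurable_addl _)).
    move=> x _; rewrite lee_fin !indicE.
    have [xI|] := boolP (x \in near0 8^-1); last by [].
    rewrite mem_set//; suff : (`|0 + x| <= rho / 8)%R by [].
    rewrite add0r; move: xI; rewrite inE /= => /le_trans; apply.
    by lra.
  rewrite integral_walk0//; last exact: mindic.
  by rewrite indicE mem_set ?lee_fin// /near0 /= normr0 divr_ge0// ltW.
have := sum_law_even_near0 rho0 mrho.
rewrite prob_indic// => even_near0.
rewrite EFinM; apply: (@le_trans _ _
  (\int[sum_law P (n./2 + n./2)]_x (w0%:E * (\1_(near0 (rho / 8)) x)%:E))).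
  rewrite ge0_integralZl//; last exact: mindic.
  by rewrite lee_wpmul2l// lee_fin.
apply: ge0_le_integral => //.
- by move=> x _; rewrite mule_ge0// lee_fin.
- by apply: measurable_funeM; exact: mindic.
- exact: measurable_indic_add.
move=> x _; rewrite indicE; have [xI|_] := boolP (x \in _); last first.
  by rewrite mule0; apply: integral_ge0.
rewrite mule1 (le_trans odd_near0)// prob_indic//.
apply: ge0_le_integral => //.
- exact: mindic (mN _).
- exact: (measurableT_comp (mindic (mN _)) (measurable_addl x)).
move=> y _; rewrite lee_fin !indicE.
have [yI|] := boolP (y \in _); last by [].
rewrite mem_set// /near0 /=.
move: xI yI; rewrite !inE /near0 /= !ler_norml => /andP[? ?] /andP[? ?].
by apply/andP; split; lra.
Qed.

End small_ball.

(** * Laplace noise *)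

Section laplace_facts.
Local Open Scope ereal_scope.
Context {R : realType}.
Local Notation mu := (@lebesgue_measure R).
Local Notation Lap := (@laplace_prob R).

Let idR (x : measurableTypeR R) : R := x.

Let measurable_idR : measurable_fun setT idR.
Proof. by move=> _ A mA; rewrite setTI. Qed.

(* Lebesgue measure lives on a copy of R with another display; this is the
   same measure on R itself. *)
Let lebesgue_copy : exists leb : {measure set R -> \bar R},
  forall A (g : R -> \bar R), measurable A -> measurable_fun A g ->
    (forall x, A x -> 0 <= g x) ->
    \int[leb]_(x in A) g x = \int[mu]_(x in A) g x.
Proof.
exists (measure_function_pushforward__canonical__measure_function_Measure
  mu measurable_idR) => A g mA mg g0.
rewrite (@ge0_integral_pushforward _ _ _ _ _ idR measurable_idR mu)//.
by move=> x; rewrite inE; exact: g0.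
Qed.

Lemma ge0_integral_lebesgue_density (m : {measure set R -> \bar R})
    (D : set R) (f : R -> R) (h : R -> \bar R) :
  measurable D -> measurable_fun D f -> (forall x, D x -> (0 <= f x)%R) ->
  (forall A, measurable A -> m A = \int[mu]_(x in D `&` A) (f x)%:E) ->
  measurable_fun setT h -> (forall x, 0 <= h x) ->
  \int[m]_x h x = \int[mu]_(x in D) ((f x)%:E * h x).
Proof.
move=> mD mf f0 mE mh h0.
have [leb lebE] := lebesgue_copy.
rewrite (@ge0_integral_density _ _ R leb m D f)//.
- rewrite lebE//.
    by apply: emeasurable_funM; [exact/measurable_EFinP|exact: measurable_funTS].
  by move=> x Dx; rewrite mule_ge0// lee_fin f0.
move=> A mA; rewrite mE// lebE//.
- exact: measurableI.
- by apply/measurable_EFinP; apply: measurable_funS mf.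
- by move=> x [Dx _]; rewrite lee_fin f0.
Qed.

Lemma integral_laplace (g : R -> \bar R) :
  measurable_fun setT g -> (forall x, 0 <= g x) ->
  \int[Lap]_x g x = \int[mu]_x ((laplace_pdf x)%:E * g x).
Proof.
move=> mg g0; apply: ge0_integral_lebesgue_density => //.
- exact: measurable_laplace_pdf.
- by move=> x _; exact: laplace_pdf_ge0.
- by move=> A mA; rewrite setTI.
Qed.

Lemma laplace_symmetric : symmetric_law Lap.
Proof.
move=> g mg g0; rewrite !integral_laplace//; last first.
  exact: (measurableT_comp mg (@oppr_measurable R setT)).
rewrite -[RHS](@ge0_integral_opp R)//.
- by apply: eq_integral => x _; rewrite /laplace_pdf normrN.
- apply: emeasurable_funM => //; apply/measurable_EFinP.
  exact: measurable_laplace_pdf.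
- by move=> x; rewrite mule_ge0// lee_fin laplace_pdf_ge0.
Qed.

(** 4 exp (- |x| / 2) is 16 times the density of a Laplace law of scale 2. *)
Let integral_expR_half : \int[mu]_x (4 * expR (- (`|x| / 2)))%:E = 16%:E.
Proof.
have chalf : continuous (fun x : R => 4 * expR (- (`|x| / 2)))%R.
  move=> x; apply: cvgMl_tmp; apply: continuous_comp; last exact: continuous_expR.
  by apply: cvgN; apply: cvgMr_tmp; exact: norm_continuous.
rewrite ge0_symfun_integralT; last 3 first.
- by move=> x; rewrite mulr_ge0// expR_ge0.
- exact: chalf.
- by move=> x /=; rewrite normrN.
rewrite -set_itvcy.
transitivity (2%:E * \int[mu]_(x in `[0%R, +oo[) (8%:E * (exponential_pdf 2^-1 x)%:E)).
  congr (_ * _); apply: eq_integral => x.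
  rewrite inE/= in_itv/= andbT => x0.
  rewrite exponential_pdfE//= -EFinM; congr EFin.
  by rewrite ger0_norm// mulrA [(x / 2)%R]mulrC -mulNr; congr (_ * _)%R; field.
rewrite ge0_integralZl//; last 2 first.
- by apply/measurable_EFinP/measurable_funTS; exact: measurable_exponential_pdf.
- by move=> x _; rewrite lee_fin exponential_pdf_ge0.
have -> : \int[mu]_(x in `[0%R, +oo[) (exponential_pdf 2^-1 x)%:E = 1.
  have h : (0 < 2^-1 :> R)%R by [].
  rewrite -(integral_exponential_pdf h) integral_mkcond.
  apply: eq_integral => x _; rewrite patchE; case: ifPn => //.
  rewrite notin_setE /= in_itv/= andbT => /negP; rewrite -ltNge => x0.
  by rewrite lt0_exponential_pdf.
by rewrite mule1 -EFinM; congr EFin; ring.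
Qed.

(** The bound x^2 / 8 <= exp (|x| / 2) absorbs the square in half of the
    exponential decay. *)
Lemma laplace_second_moment : \int[Lap]_x (x ^+ 2)%:E <= 16%:E.
Proof.
have mx2 : measurable_fun setT (fun x : R => (x ^+ 2)%:E).
  by apply/measurable_EFinP; exact: measurable_funX.
rewrite integral_laplace//; last by move=> x; rewrite lee_fin sqr_ge0.
rewrite -integral_expR_half; apply: ge0_le_integral => //.
- by move=> x _; rewrite mule_ge0 ?lee_fin ?laplace_pdf_ge0 ?sqr_ge0.
- apply: emeasurable_funM => //; apply/measurable_EFinP.
  exact: measurable_laplace_pdf.
- apply/measurable_EFinP; apply: measurable_funM => //.
  apply: measurableT_comp => //; apply: measurableT_comp => //.
  by apply: measurable_funM => //; exact: measurableT_comp.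
move=> x _; rewrite -EFinM lee_fin /laplace_pdf.
rewrite (_ : - `|x| = - (`|x| / 2) + - (`|x| / 2))%R; last by field.
rewrite expRD.
have e1 := expR_gt0 (- (`|x| / 2)).
have : (expR (- (`|x| / 2)) * (`|x| ^+ 2 / 8) <= 1)%R.
  rewrite expRN ler_pdivrMl ?expR_gt0// mulr1.
  have h : (0 <= `|x| / 2)%R by rewrite divr_ge0.
  have := expR_ge1Dxn 1 h.
  rewrite (_ : `|x| ^+ 2 / 8 = (`|x| / 2) ^+ 2 / 2`!%:R)%R; last first.
    by rewrite (_ : 2`! = 2)%N//; field.
  by move=> h2; rewrite (le_trans _ h2)// lerDr.
by rewrite real_normK ?num_real//; nra.
Qed.

(** On this interval of length 1/4 the density is at least (1 - 1/8) / 2, hence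
    at least 1/4. *)
Lemma laplace_near0 : (16^-1)%:E <= Lap (near0 8^-1).
Proof.
rewrite /laplace_prob.
apply: (@le_trans _ _ (\int[mu]_(x in near0 8^-1) (4^-1)%:E)).
  rewrite integral_cst; last exact: measurable_near0.
  have mu0 : mu (near0 8^-1) = (4^-1)%:E.
    transitivity (mu `[(- 8^-1)%R, 8^-1%R]%classic).
      by congr (mu _); apply/seteqP; split => x; rewrite /near0 /= in_itv /= ler_norml.
    rewrite lebesgue_measure_itv/= lte_fin gtrN// -EFinB; congr EFin.
    by field.
  rewrite [X in _ * X](_ : _ = (4^-1)%:E); last exact: mu0.
  by rewrite -EFinM lee_fin; lra.
apply: ge0_le_integral => //.
- exact: measurable_near0.
- apply/measurable_EFinP/measurable_funTS; exact: measurable_laplace_pdf.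
move=> x; rewrite /near0 /= => x8; rewrite lee_fin /laplace_pdf.
have := expR_ge1Dx (- `|x|); lra.
Qed.

(** Translating by c changes the log-density by at most |c|. *)
Lemma laplace_translate (g : R -> \bar R) (c : R) :
  measurable_fun setT g -> (forall x, 0 <= g x) ->
  \int[Lap]_x g (x + c)%R <= (expR `|c|)%:E * \int[Lap]_x g x.
Proof.
move=> mg g0.
have ml : measurable_fun setT (fun x : R => (laplace_pdf x)%:E).
  by apply/measurable_EFinP; exact: measurable_laplace_pdf.
have l0 (x : R) : 0 <= (laplace_pdf x)%:E by rewrite lee_fin laplace_pdf_ge0.
have mgc : measurable_fun setT (fun x : R => g (x + c)%R).
  by apply: (measurableT_comp mg); exact: measurable_funD.
rewrite !integral_laplace//.
pose F x := (laplace_pdf (x - c)%R)%:E * g x.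
have mF : measurable_fun setT F.
  apply: emeasurable_funM => //; apply: (measurableT_comp ml).
  exact: measurable_funB.
have F0 x : 0 <= F x by rewrite mule_ge0.
rewrite (_ : \int[mu]_x ((laplace_pdf x)%:E * g (x + c)%R) = \int[mu]_x F (x + c)%R); last first.
  by apply: eq_integral => x _; rewrite /F addrK.
have mlg : measurable_fun setT (fun x => (laplace_pdf x)%:E * g x).
  exact: emeasurable_funM.
have lg0 x : 0 <= (laplace_pdf x)%:E * g x by rewrite mule_ge0.
have e0 : 0 <= (expR `|c|)%:E by rewrite lee_fin expR_ge0.
rewrite ge0_integral_shift// -ge0_integralZl//.
apply: ge0_le_integral => //.
- exact: measurable_funeM.
move=> x _; rewrite /F muleA lee_wpmul2r// -EFinM lee_fin /laplace_pdf mulrCA.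
rewrite ler_wpM2l// -expRD ler_expR.
by have := ler_normD ((x : R) - c)%R c; rewrite subrK => ?; lra.
Qed.

(** Noise of scale b turns a change of the released vector into a change of the
    log-density by at most its l1 norm divided by b, coordinate after
    coordinate. *)
Lemma laplace_vector_translate N (b : R) (v v' : 'I_N -> R)
    (G : N.-tuple R -> \bar R) : (0 < b)%R ->
  measurable_fun setT G -> (forall t, 0 <= G t) ->
  \int[iid_prob Lap N]_t G [tuple (v j + b * tnth t j)%R | j < N] <=
  (expR (\sum_(j < N) `|v j - v' j| / b))%:E *
    \int[iid_prob Lap N]_t G [tuple (v' j + b * tnth t j)%R | j < N].
Proof.
move=> b0.
have mpert n (w : 'I_n -> R) : measurable_fun setT
    (fun t : n.-tuple R => [tuple (w j + b * tnth t j)%R | j < n]).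
  apply/measurable_fun_tnthP => j.
  apply: (eq_measurable_fun (fun t : n.-tuple R => w j + b * tnth t j)%R).
    by move=> u _; rewrite /= tnth_mktuple.
  apply: measurable_funD => //; apply: measurable_funM => //.
  exact: measurable_tnth.
elim: N v v' G => [|N IH] v v' G mG G0.
  rewrite big_ord0 expR0 mul1e le_eqVlt; apply/orP; left; apply/eqP.
  by apply: eq_integral => t _; congr G; apply: eq_from_tnth => -[].
pose w0 := fun j => v (lift ord0 j); pose w0' := fun j => v' (lift ord0 j).
have pertE (w : 'I_N.+1 -> R) x t :
    [tuple (w j + b * tnth (tcons (x, t)) j)%R | j < N.+1] =
    tcons ((w ord0 + b * x)%R, [tuple (w (lift ord0 j) + b * tnth t j)%R | j < N]).
  apply: eq_from_tnth => j; rewrite tnth_mktuple.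
  by case: (unliftP ord0 j) => [i|] ->;
    rewrite ?tnth_tconsS ?tnth_tcons0 ?tnth_mktuple.
pose H (y : R) := \int[iid_prob Lap N]_t G (tcons (y, [tuple (v' (lift ord0 j) + b * tnth t j)%R | j < N])).
have mGt y : measurable_fun setT (fun t => G (tcons (y, t))).
  by apply: (measurableT_comp mG); exact: measurable_tcons_snd.
have mH : measurable_fun setT H.
  apply: (@measurable_fun_integral_snd _ _ _ _ _ (iid_prob Lap N)
    (fun y t => G (tcons (y, [tuple (v' (lift ord0 j) + b * tnth t j)%R | j < N])))) => //.
  apply: (measurableT_comp mG); apply: (measurableT_comp (@measurable_tcons _ R N)).
  apply: measurable_fun_pair => //.
  exact: (measurableT_comp (mpert _ _)).
have H0 y : 0 <= H y by apply: integral_ge0.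
have mGp (w : 'I_N.+1 -> R) : measurable_fun setT (fun t : N.+1.-tuple R => G [tuple (w j + b * tnth t j)%R | j < N.+1]).
  exact: (measurableT_comp mG (mpert _ _)).
rewrite !integral_iidS//.
have maff (a : R) : measurable_fun setT (fun x : R => a + b * x)%R.
  by apply: measurable_funD => //; exact: measurable_funM.
set S := (\sum_(j < N) `|w0 j - w0' j| / b)%R.
apply: (@le_trans _ _ (\int[Lap]_x ((expR S)%:E * H (v ord0 + b * x)%R))).
  apply: ge0_le_integral => //.
  - by move=> x _; apply: integral_ge0.
  - exact: (@measurable_integral_tcons _ _ _ _ _ (fun t => G [tuple (v j + b * tnth t j)%R | j < N.+1])).
  - by apply: measurable_funeM; exact: (measurableT_comp mH (maff _)).
  move=> x _; under eq_integral do rewrite pertE.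
  exact: (IH w0 w0' (fun t => G (tcons ((v ord0 + b * x)%R, t)))).
have mHv : measurable_fun setT (fun x : R => H (v ord0 + b * x)%R).
  exact: (measurableT_comp mH (maff _)).
have e0 : 0 <= (expR S)%:E by rewrite lee_fin expR_ge0.
rewrite ge0_integralZl//.
rewrite big_ord_recl addrC expRD EFinM -muleA lee_wpmul2l ?lee_fin ?expR_ge0//.
rewrite [X in _ <= _ * X](_ : _ = \int[Lap]_x H (v' ord0 + b * x)%R); last first.
  by apply: eq_integral => x _; apply: eq_integral => t _; rewrite pertE.
have := laplace_translate ((v ord0 - v' ord0) / b) (measurableT_comp mH (maff (v' ord0))).
rewrite normrM normfV (gtr0_norm b0) => /(_ (fun x => H0 _)).
apply: le_trans; rewrite le_eqVlt; apply/orP; left; apply/eqP.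
apply: eq_integral => x _ /=; congr H; rewrite mulrDr mulrCA divff ?gt_eqF//; ring.
Qed.

End laplace_facts.

(** * The law of the outputs as a probability measure *)

Section bind.
Local Open Scope ereal_scope.
Context d d' (T : measurableType d) (Y : measurableType d') {R : realType}.
Variables (P : probability T R) (K : R.-pker T ~> Y).

Definition ksnd (u : unit * T) : {measure set Y -> \bar R} := K u.2.

Let measurable_ksnd U : measurable U -> measurable_fun setT (ksnd ^~ U).
Proof.
by move=> mU; exact: (measurableT_comp (measurable_kernel K U mU) measurable_snd).
Qed.

HB.instance Definition _ := isKernel.Build _ _ _ _ _ ksnd measurable_ksnd.

Let ksnd_setT u : ksnd u setT = 1.
Proof. exact: prob_kernel. Qed.

HB.instance Definition _ := Kernel_isProbability.Build _ _ _ _ _ ksnd ksnd_setT.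

Let kcst : R.-pker unit ~> T :=
  kprobability (measurable_cst (P : pprobability T R)).

(** The bind of the Giry monad, as a composition of kernels from a one-point
    space. *)
Definition bind : set Y -> \bar R := (kcst \; ksnd)%E tt.

HB.instance Definition _ := Measure.on bind.

Let bind_setT : bind setT = 1.
Proof.
rewrite /bind /= /kcomp.
under eq_integral do rewrite prob_kernel.
exact: integral_cst_prob.
Qed.

HB.instance Definition _ := @Measure_isProbability.Build _ _ _ bind bind_setT.

Lemma integral_bind (g : Y -> \bar R) :
  measurable_fun setT g -> (forall y, 0 <= g y) ->
  \int[bind]_y g y = \int[P]_t \int[K t]_y g y.
Proof. by move=> mg g0; rewrite [LHS](@integral_kcomp _ _ _ _ _ _ _ kcst ksnd tt). Qed.

End bind.

Lemma integral_ksample d d' d'' (T : measurableType d) (W : measurableType d')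
    (Y : measurableType d'') (R : realType) (P : R.-pker T ~> W)
    (F : T * W -> Y) (mF : measurable_fun setT F) t (g : Y -> \bar R) :
  measurable_fun setT g -> (forall y, (0 <= g y)%E) ->
  (\int[ksample P mF t]_y g y = \int[P t]_w g (F (t, w)))%E.
Proof.
move=> mg g0; rewrite [LHS](@integral_kcomp _ _ _ _ _ _ _ P (kdirac mF) t)//.
by apply: eq_integral => w _; rewrite integral_dirac// diracT mul1e.
Qed.

Lemma integral_cst_kernel d d' (T : measurableType d) (Y : measurableType d')
    (R : realType) (K : R.-pker T ~> Y) t (c : \bar R) :
  (\int[K t]_y c = c)%E.
Proof. by rewrite (integral_cst (K t) measurableT c) prob_kernel mule1. Qed.

Section set_function.
Local Open Scope ereal_scope.
Import HBNNSimple.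

(** The integral only evaluates the set function on measurable sets. *)
Lemma eq_integral_set_function d (T : measurableType d) (R : realType)
    (m1 : set T -> \bar R) (m2 : {measure set T -> \bar R}) (f : T -> \bar R) :
  (forall A, measurable A -> m1 A = m2 A) ->
  \int[m1]_x f x = \int[m2]_x f x.
Proof.
move=> m12; rewrite /integral.
have eq_sup g : [set sintegral m1 h | h in
    [set h : {nnsfun T >-> R} | forall x, (h x)%:E <= g x]] =
  [set sintegral m2 h | h in
    [set h : {nnsfun T >-> R} | forall x, (h x)%:E <= g x]].
  by apply: eq_imagel => h _; apply: eq_fsbigr => r _; rewrite m12.
by rewrite !eq_sup.
Qed.

End set_function.

Section observations.
Local Open Scope ereal_scope.
Context {R : realType}.
Local Notation mu := (@lebesgue_measure R).

Section data_law.
Variables (X : set R) (f : R -> R).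
Hypotheses (mX : measurable X) (df : density X f).

Definition data_prob (mX : measurable X) (df : density X f) (A : set R) : \bar R :=
  \int[mu]_(x in X `&` A) (f x)%:E.

Local Notation data := (data_prob mX df).

Let mf : measurable_fun X f. Proof. by case: df. Qed.
Let f0 x : X x -> (0 <= f x)%R. Proof. by case: df => _ + _; apply. Qed.

Let data0 : data set0 = 0.
Proof. by rewrite /data_prob setI0 integral_set0. Qed.

Let data_ge0 A : 0 <= data A.
Proof. by apply: integral_ge0 => x [Xx _]; rewrite lee_fin f0. Qed.

Let data_sigma_additive : semi_sigma_additive data.
Proof.
move=> F mF tF mUF; rewrite /data_prob; apply: cvg_toP.
  apply: ereal_nondecreasing_is_cvgn => m n mn.
  apply: lee_sum_nneg_natr => // k _ _; apply: integral_ge0 => /= x [Xx _].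
  by rewrite lee_fin f0.
have mXF k : measurable (X `&` F k) by exact: measurableI.
have mfF : measurable_fun (\bigcup_k (X `&` F k)) (EFin \o f).
  apply/measurable_EFinP; apply: measurable_funS mf => //.
  by rewrite -setI_bigcupr; exact: subIsetl.
rewrite setI_bigcupr ge0_integral_bigcup//=.
- by move=> x [k _ [Xx _]]; rewrite lee_fin f0.
- move=> i j _ _ [x [[_ Fi] [_ Fj]]]; apply: tF => //; by exists x.
Qed.

HB.instance Definition _ := isMeasure.Build _ _ _ data
  data0 data_ge0 data_sigma_additive.

Let data_setT : data setT = 1.
Proof. by rewrite /data_prob setIT; case: df. Qed.

HB.instance Definition _ := @Measure_isProbability.Build _ _ R data data_setT.

Lemma integral_data (g : R -> \bar R) :
  measurable_fun setT g -> (forall x, 0 <= g x) ->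
  \int[data]_x g x = \int[mu]_(x in X) ((f x)%:E * g x).
Proof. by move=> mg g0; apply: ge0_integral_lebesgue_density. Qed.

End data_law.

Section output_law.
Variables (X : set R) (f : R -> R) (mX : measurable X) (df : density X f)
  (Q : mechanism R).
Local Notation data := (data_prob mX df).
Local Notation H k := (hist (out Q) k).

Let append k (u : (R * H k) * out Q k) : H k.+1 := (u.1.2, u.2).

Let measurable_append k : measurable_fun setT (@append k).
Proof.
apply: measurable_fun_pair => //.
exact: (measurableT_comp measurable_snd measurable_fst).
Qed.

(** The recursion of [law], with a probability measure at each step so that the
    theory of the integral applies. *)
Fixpoint out_prob k : probability (H k) R :=
  match k return probability (H k) R with
  | 0 => \d_tt
  | k'.+1 => bind (data \x out_prob k') (ksample (ker Q k') (@measurable_append k'))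
  end.

(** One step of the protocol: the observation is drawn independently of the
    past, then the output given both. *)
Lemma integral_out_probS k (g : H k.+1 -> \bar R) :
  measurable_fun setT g -> (forall h, 0 <= g h) ->
  \int[out_prob k.+1]_h g h =
  \int[out_prob k]_h \int[data]_x \int[ker Q k (x, h)]_z g (h, z).
Proof.
move=> mg g0 /=; rewrite integral_bind//.
have mi : measurable_fun setT (fun u : R * H k => \int[ker Q k u]_z g (u.2, z)).
  under eq_fun => u.
    rewrite -(integral_ksample (ker Q k) (@measurable_append k) u mg g0); over.
  exact: (measurable_fun_integral_kernel (l := ksample (ker Q k) (@measurable_append k))
    (measurable_kernel _)).
under eq_integral => u _ do rewrite integral_ksample//.
rewrite (fubini_tonelli2 (fun u : R * H k => \int[ker Q k u]_z g (u.2, z)))//.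
by move=> u; exact: integral_ge0.
Qed.

Let measurable_integral_ker2 k (g : H k.+1 -> \bar R) :
  measurable_fun setT g -> (forall h, 0 <= g h) ->
  measurable_fun setT (fun u : H k * R => \int[ker Q k (u.2, u.1)]_z g (u.1, z)).
Proof.
move=> mg g0.
have mi : measurable_fun setT (fun u : R * H k => \int[ker Q k u]_z g (u.2, z)).
  under eq_fun => u.
    rewrite -(integral_ksample (ker Q k) (@measurable_append k) u mg g0); over.
  exact: (measurable_fun_integral_kernel (l := ksample (ker Q k) (@measurable_append k))
    (measurable_kernel _)).
exact: (measurableT_comp mi (@measurable_swap _ _ _ _)).
Qed.

Let measurable_integral_ker k (h : H k) (g : H k.+1 -> \bar R) :
  measurable_fun setT g -> (forall h, 0 <= g h) ->
  measurable_fun setT (fun x : R => \int[ker Q k (x, h)]_z g (h, z)).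
Proof.
move=> mg g0.
exact: (measurableT_comp (measurable_integral_ker2 mg g0) (pair1_measurable h)).
Qed.

Lemma measurable_step k (g : H k.+1 -> \bar R) :
  measurable_fun setT g -> (forall h, 0 <= g h) ->
  measurable_fun setT
    (fun h : H k => \int[data]_x \int[ker Q k (x, h)]_z g (h, z)).
Proof.
move=> mg g0.
apply: (@measurable_fun_integral_snd _ _ _ _ _ data
  (fun h x => \int[ker Q k (x, h)]_z g (h, z))); last first.
  by move=> h x; exact: integral_ge0.
exact: measurable_integral_ker2.
Qed.

(** [law] is only a set function; on measurable sets it agrees with a probability
    measure, against which one can integrate. *)
Lemma law_out_prob k A : measurable A -> law X f A = out_prob k A.
Proof.
elim: k A => [//|k IH] A mA.
have mA1 : measurable_fun setT (fun h : H k.+1 => (\1_A h)%:E : \bar R).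
  by apply/measurable_EFinP; exact: measurable_indic.
transitivity (\int[out_prob k.+1]_h (\1_A h)%:E); last first.
  by rewrite integral_indic// setIT.
rewrite integral_out_probS// [LHS](@eq_integral_set_function _ _ _ _ (out_prob k))//.
apply: eq_integral => h _; rewrite integral_data; last 2 first.
- exact: (measurable_integral_ker h mA1).
- by move=> x; exact: integral_ge0.
apply: eq_integral => x _; congr (_ * _).
have mAh : measurable (xsection A h) by exact: measurable_xsection.
rewrite -[xsection A h]setIT -integral_indic//.
by apply: eq_integral => z _; rewrite !indicE mem_xsection.
Qed.

End output_law.
End observations.

(** * The three stages and local differential privacy *)

Section kernels.
Local Open Scope ereal_scope.
Context {R : realType}.

Lemma integral_two_point d (T : measurableType d) (a : R) (q : T -> R)
    (mq : measurable_fun setT q) t (g : R -> \bar R) :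
  (0 <= q t <= 1)%R -> measurable_fun setT g -> (forall x, 0 <= g x) ->
  \int[two_point a mq t]_z g z = (q t)%:E * g a + (1 - q t)%:E * g (- a)%R.
Proof.
move=> q01 mg g0; rewrite /two_point integral_ksample//.
by rewrite [LHS](integral_bernoulli_prob q01 (f := fun b : bool => g (if b then a else - a)%R)).
Qed.

Section three_stage_kernels.
Variables (f0 : R -> R) (alpha : R) (n N : nat) (J : 'I_N -> interval R).
Hypotheses (alpha_gt0 : (0 < alpha)%R) (n_gt0 : (0 < n)%N)
  (tJ : trivIset setT (cell J)).

Local Notation Q := (mechanism3 f0 alpha n J).
Local Notation H k := (hist (out Q) k).
Local Notation ca := (c_alpha alpha).
Local Notation ta := (tau alpha n).
Local Notation clp := (clip alpha n).

(** The cells are disjoint, so a sum over the cells of a point has one term or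
    none. *)
Lemma cell_case (x : R) :
  (exists2 j0, cell J j0 x &
     forall c : 'I_N -> R, (\sum_(j < N) \1_(cell J j) x * c j = c j0)%R) \/
  (~ cells J x /\ forall c : 'I_N -> R, (\sum_(j < N) \1_(cell J j) x * c j = 0)%R).
Proof.
have [[j0 _ xj0]|xn] := pselect (cells J x); [left|right].
  exists j0 => // c; rewrite (bigD1 j0)//= indicE mem_set// mul1r big1 ?addr0//.
  move=> j jj0; rewrite indicE memNset ?mul0r// => xj.
  by move/eqP : jj0; apply; apply: (tJ (i := j) (j := j0)) => //; exists x.
split => // c; rewrite big1// => j _; rewrite indicE memNset ?mul0r// => xj.
by apply: xn; exists j.
Qed.

Lemma tau_gt0 : (0 < ta)%R.
Proof. by rewrite invr_gt0 sqrtr_gt0 mulr_gt0 ?ltr0n ?exprn_gt0. Qed.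

Lemma c_alpha_gt1 : (1 < ca)%R.
Proof.
have e1 : (1 < expR alpha)%R by rewrite expR_gt1.
by rewrite /c_alpha ltr_pdivlMr; lra.
Qed.

Lemma norm_clip (x : R) : (`|clp x| <= ta)%R.
Proof.
have t0 := tau_gt0; rewrite /clip ler_norml.
by rewrite le_max lexx/= ge_max ge_min lexx orbT; apply/andP; split => //; lra.
Qed.

(** The probability of answering [a] rather than [- a] that gives the answer the
    mean [s]. In stage two the amplitude is c_alpha * tau for a signal of size at
    most tau, in stage three c_alpha for a signal of size at most 1. *)
Definition response (a s : R) : R := (2^-1 * (1 + s / a))%R.

Lemma response_01 (a s : R) : (0 < a)%R -> (`|s| <= a)%R -> (0 <= response a s <= 1)%R.
Proof.
move=> a0; rewrite ler_norml => /andP[h1 h2]; rewrite /response.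
have : (-1 <= s / a <= 1)%R.
  by rewrite ler_pdivlMr// ler_pdivrMr// mul1r mulN1r h1 h2.
by move=> /andP[? ?]; apply/andP; split; lra.
Qed.

(** The worst ratio is between the signals t and - t, where it is
    (1 + 1 / c_alpha) / (1 - 1 / c_alpha) = exp alpha: the choice of c_alpha. *)
Lemma response_ratio (t s s' : R) : (0 < t)%R -> (`|s| <= t)%R -> (`|s'| <= t)%R ->
  (response (ca * t) s <= expR alpha * response (ca * t) s')%R.
Proof.
move=> t0; rewrite !ler_norml => /andP[h1 h2] /andP[h1' h2'].
have e1 : (1 < expR alpha)%R by rewrite expR_gt1.
have c1 := c_alpha_gt1.
pose u : R := (s / t)%R; pose u' : R := (s' / t)%R.
have hu : (u <= 1)%R by rewrite ler_pdivrMr// mul1r.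
have hu' : (-1 <= u')%R by rewrite ler_pdivlMr// mulN1r.
have E w : (w / (ca * t) = (w / t) * (expR alpha - 1) / (expR alpha + 1))%R.
  rewrite /c_alpha; field.
  by rewrite !gt_eqF//; lra.
rewrite /response !E -/u -/u' mulrCA ler_pM2l ?invr_gt0//.
set e := expR alpha in e1 *.
have e10 : (0 < e + 1)%R by lra.
apply: (@le_trans _ _ (1 + (e - 1) / (e + 1))%R).
  by rewrite lerD2l ler_pM2r ?invr_gt0// ler_piMl//; lra.
apply: (@le_trans _ _ (e * (1 - (e - 1) / (e + 1)))%R).
  rewrite le_eqVlt; apply/orP; left; apply/eqP; field.
  by rewrite gt_eqF.
rewrite ler_pM2l; last by lra.
rewrite lerD2l -mulNr ler_pM2r ?invr_gt0// -mulN1r ler_pM2r//; lra.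
Qed.

Let measurable_integral_indic d (T : measurableType d) (P : {measure set T -> \bar R}) A :
  measurable A -> P A = \int[P]_x (\1_A x)%:E.
Proof. by move=> mA; rewrite integral_indic// setIT. Qed.

(** Only the cells of the two points, at most two in number, contribute. *)
Let indic_cells_l1 (x x' : R) :
  (\sum_(j < N) `|\1_(cell J j) x - \1_(cell J j) x'| <= 2 :> R)%R.
Proof.
have sum1 y : (\sum_(j < N) \1_(cell J j) y <= 1 :> R)%R.
  rewrite (eq_bigr (fun j => \1_(cell J j) y * 1)%R) => [|j _]; last by rewrite mulr1.
  by have [[j0 _ ->]|[_ ->]] := cell_case y.
apply: (@le_trans _ _ (\sum_(j < N) (\1_(cell J j) x + \1_(cell J j) x'))%R).
  apply: ler_sum => j _; apply: le_trans (ler_normB _ _) _.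
  by rewrite !ger0_norm.
by rewrite big_split /=; have := sum1 x; have := sum1 x'; lra.
Qed.

Lemma stage1_integral k (u : R * H k) (g : N.-tuple R -> \bar R) :
  measurable_fun setT g -> (forall x, 0 <= g x) ->
  \int[stage1 alpha n J k u]_z g z =
  \int[iid_prob laplace_prob N]_w
    g [tuple (\1_(cell J j) u.1 + 2 / alpha * tnth w j)%R | j < N].
Proof. by move=> mg g0; rewrite /stage1 integral_ksample. Qed.

(** By disjointness, the clipped discrepancy of the cell of the observation, or 0
    outside the cells. *)
Definition signal2 k (u : R * H k) : R :=
  (\sum_(j < N) \1_(cell J j) u.1 * clp (phat u.2 j - p0 f0 J j))%R.

Lemma norm_signal2 k (u : R * H k) : (`|signal2 u| <= ta)%R.
Proof.
rewrite /signal2; have [[j0 _ ->]|[_ ->]] := cell_case u.1; first exact: norm_clip.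
by rewrite normr0 ltW// tau_gt0.
Qed.

Lemma stage2_integral k (u : R * H k) (g : R -> \bar R) :
  measurable_fun setT g -> (forall x, 0 <= g x) ->
  \int[stage2 f0 alpha n J k u]_z g z =
  (response (ca * ta) (signal2 u))%:E * g (ca * ta)%R +
  (1 - response (ca * ta) (signal2 u))%:E * g (- (ca * ta))%R.
Proof.
move=> mg g0; have c1 := c_alpha_gt1; have t0 := tau_gt0.
apply: integral_two_point => //; apply: response_01.
  by rewrite mulr_gt0//; lra.
by rewrite (le_trans (norm_signal2 u))// ler_peMl//; lra.
Qed.

Definition signal3 k (u : R * H k) : R := \1_(~` cells J) u.1.

Lemma norm_signal3 k (u : R * H k) : (`|signal3 u| <= 1)%R.
Proof. by rewrite /signal3 indicE; case: (_ \in _); rewrite ?normr1 ?normr0. Qed.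

Lemma stage3_integral k (u : R * H k) (g : R -> \bar R) :
  measurable_fun setT g -> (forall x, 0 <= g x) ->
  \int[stage3 alpha n J k u]_z g z =
  (response ca (signal3 u))%:E * g ca + (1 - response ca (signal3 u))%:E * g (- ca)%R.
Proof.
move=> mg g0; have c1 := c_alpha_gt1.
apply: integral_two_point => //; apply: response_01; first by lra.
by rewrite (le_trans (norm_signal3 u))// ltW.
Qed.

Let responseN a s : (1 - response a s = response a (- s))%R.
Proof. by rewrite /response mulNr; lra. Qed.

Let two_responses_ldp (t s s' : R) (A : set R) : (0 < t)%R ->
  (`|s| <= t)%R -> (`|s'| <= t)%R ->
  (response (ca * t) s)%:E * (\1_A (ca * t)%R)%:E +
    (1 - response (ca * t) s)%:E * (\1_A (- (ca * t))%R)%:E <=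
  (expR alpha)%:E * ((response (ca * t) s')%:E * (\1_A (ca * t)%R)%:E +
    (1 - response (ca * t) s')%:E * (\1_A (- (ca * t))%R)%:E).
Proof.
move=> t0 hs hs'; rewrite -!(EFinM, EFinD) lee_fin mulrDr !responseN.
by apply: lerD; rewrite [leRHS]mulrA; apply: ler_wpM2r => //;
  apply: response_ratio; rewrite ?normrN.
Qed.

(** Laplace noise of scale 2 / alpha masks a change of l1 norm at most 2, and the
    two-point responses have likelihood ratio at most exp alpha. *)
Lemma mechanism3_ldp X m : ldp X m alpha Q.
Proof.
move=> i _ A mA x x' h _ _; move: A mA; rewrite /=.
have t0 := tau_gt0.
have mI (B : set R) : measurable B -> measurable_fun setT (fun z => (\1_B z)%:E : \bar R).
  by move=> mB; apply/measurable_EFinP; exact: measurable_indic.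
case: (i < n)%N => A mA.
  have mIA : measurable_fun setT (fun z => (\1_A z)%:E : \bar R).
    by apply/measurable_EFinP; exact: measurable_indic.
  rewrite !measurable_integral_indic// !stage1_integral//.
  have b0 : (0 < 2 / alpha)%R by rewrite divr_gt0.
  have := laplace_vector_translate (fun j => \1_(cell J j) x) (fun j => \1_(cell J j) x') b0 mIA.
  move=> /(_ (fun t => _)) le1; apply: le_trans (le1 _) _ => //.
  apply: lee_wpmul2r; first by apply: integral_ge0.
  rewrite lee_fin ler_expR -mulr_suml ler_pdivrMr// mulrCA divff ?gt_eqF// mulr1.
  exact: indic_cells_l1.
case: (i < 2 * n)%N; rewrite !measurable_integral_indic//.
  rewrite !stage2_integral//; try exact: mI.
  by apply: two_responses_ldp => //; exact: norm_signal2.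
rewrite !stage3_integral//; try exact: mI.
have := @two_responses_ldp 1%R (signal3 (x, h)) (signal3 (x', h)) A ltr01 (norm_signal3 _) (norm_signal3 _).
by rewrite mulr1.
Qed.

End three_stage_kernels.
End kernels.

(** * Conditional moments of the second and third stages *)

Section drift.
Local Open Scope ereal_scope.
Context {R : realType}.
Variables (X : set R) (f : R -> R) (mX : measurable X) (df : density X f)
  (Q : mechanism R).
Local Notation data := (data_prob mX df).
Local Notation H k := (hist (out Q) k).

(** The tower property, one step at a time, for a process that is a
    supermartingale up to the deterministic drift [v]. *)
Lemma drift_le (a b : nat) (W : forall k, H k -> \bar R) (v : nat -> R) :
  (forall k, measurable_fun setT (W k)) -> (forall k h, 0 <= W k h) ->
  (forall k h, (a <= k < b)%N ->
     \int[data]_x \int[ker Q k (x, h)]_z W k.+1 (h, z) <= W k h + (v k)%:E) ->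
  (a <= b)%N ->
  \int[out_prob mX df Q b]_h W b h <=
  \int[out_prob mX df Q a]_h W a h + (\sum_(a <= k < b) v k)%:E.
Proof.
move=> mW W0 step.
elim: b step => [|b IH] step ab.
  by move: ab; rewrite leqn0 => /eqP ->; rewrite big_geq// adde0.
move: ab; rewrite leq_eqVlt => /predU1P[->|]; first by rewrite big_geq// adde0.
rewrite ltnS => ab; rewrite integral_out_probS// big_nat_recr//= EFinD addeA.
apply: (@le_trans _ _ (\int[out_prob mX df Q b]_h (W b h) + (v b)%:E)); last first.
  rewrite leeD2r//; apply: IH => // k h /andP[ak kb]; apply: step.
  by rewrite ak ltnW.
have vb h : \int[data]_x \int[ker Q b (x, h)]_z W b.+1 (h, z) <= W b h + (v b)%:E.
  by apply: step; rewrite ab ltnSn.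
have m1 : measurable_fun setT
    (fun h : H b => \int[data]_x \int[ker Q b (x, h)]_z W b.+1 (h, z)).
  exact: measurable_step.
have [v0|v0] := leP 0%R (v b).
  rewrite -[X in _ + X](integral_cst_prob (out_prob mX df Q b)).
  rewrite -ge0_integralD//; apply: ge0_le_integral => //.
  - by move=> h _; apply: integral_ge0 => x _; apply: integral_ge0.
  - exact: emeasurable_funD.
rewrite -leeBlDr// -EFinN -[X in _ + X](integral_cst_prob (out_prob mX df Q b)).
have nv0 : 0 <= (- v b)%:E by rewrite lee_fin oppr_ge0 ltW.
rewrite -ge0_integralD//; last first.
  by move=> h _; apply: integral_ge0 => x _; apply: integral_ge0.
apply: ge0_le_integral => //.
- by move=> h _; apply: adde_ge0 => //; apply: integral_ge0 => x _; apply: integral_ge0.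
- exact: emeasurable_funD.
- by move=> h _; rewrite EFinN leeBlDr.
Qed.

End drift.

Section stages_two_three.
Local Open Scope ereal_scope.
Context {R : realType}.

(** A variable with values in {a, - a} has second moment a^2 about 0, hence at
    most a^2 about its mean m. *)
Let response_second_moment d (T : measurableType d) (P : probability T R)
    (s : T -> R) (a M : R) (m := (\int[P]_x s x)%R) :
  measurable_fun setT s -> (0 < a)%R -> (forall x, (`|s x| <= a)%R) ->
  \int[P]_x ((response a (s x))%:E * ((M + (a - m)) ^+ 2)%:E +
             (1 - response a (s x))%:E * ((M + (- a - m)) ^+ 2)%:E)
  <= (M ^+ 2 + a ^+ 2)%:E.
Proof.
move=> ms a0 sa.
have is' := bounded_integrable_prob P ms sa.
have ic c : P.-integrable setT (fun=> c%:E).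
  exact: finite_measure_integrable_cst.
pose c0 := ((M - m) ^+ 2 + a ^+ 2)%R; pose c1 := (2 * (M - m))%R.
rewrite [leLHS](_ : _ = \int[P]_x (c0%:E + c1%:E * (s x)%:E)); last first.
  apply: eq_integral => x _; rewrite -!(EFinM, EFinD); congr EFin.
  by rewrite /response /c0 /c1; field; rewrite gt_eqF.
rewrite integralD//; last exact: integrableZl.
rewrite integralZl// integral_cst_prob.
have -> : \int[P]_x (s x)%:E = m%:E.
  by rewrite /m /Rintegral fineK//; exact: integrable_fin_num.
rewrite -EFinM -EFinD lee_fin /c0 /c1.
by have := sqr_ge0 m; rewrite !expr2; nra.
Qed.

Variables (f0 : R -> R) (alpha : R) (n N : nat) (J : 'I_N -> interval R).
Hypotheses (alpha_gt0 : (0 < alpha)%R) (n_gt0 : (0 < n)%N)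
  (tJ : trivIset setT (cell J)).
Variables (X : set R) (f : R -> R) (mX : measurable X) (df : density X f).

Local Notation Q := (mechanism3 f0 alpha n J).
Local Notation H k := (hist (out Q) k).
Local Notation ca := (c_alpha alpha).
Local Notation ta := (tau alpha n).
Local Notation clp := (clip alpha n).
Local Notation data := (data_prob mX df).

Lemma ker_stage2 k (u : R * H k) (g : R -> \bar R) : (n <= k < 2 * n)%N ->
  measurable_fun setT g -> (forall x, 0 <= g x) ->
  \int[ker Q k u]_z g (real_coord z) =
  (response (ca * ta) (signal2 u))%:E * g (ca * ta)%R +
  (1 - response (ca * ta) (signal2 u))%:E * g (- (ca * ta))%R.
Proof.
move=> /andP[nk k2] mg g0 /=; move: nk; rewrite leqNgt.
case: (k < n)%N => // _; rewrite k2; exact: stage2_integral.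
Qed.

Lemma ker_stage3 k (u : R * H k) (g : R -> \bar R) : (2 * n <= k)%N ->
  measurable_fun setT g -> (forall x, 0 <= g x) ->
  \int[ker Q k u]_z g (real_coord z) =
  (response ca (signal3 u))%:E * g ca + (1 - response ca (signal3 u))%:E * g (- ca)%R.
Proof.
move=> nk mg g0 /=.
have : (n <= k)%N by apply: leq_trans nk; rewrite leq_pmull.
rewrite leqNgt; case: (k < n)%N => // _.
by rewrite ltnNge nk /=; exact: stage3_integral.
Qed.

Lemma ker_stage1 k (u : R * H k) (g : N.-tuple R -> \bar R) : (k < n)%N ->
  measurable_fun setT g -> (forall x, 0 <= g x) ->
  \int[ker Q k u]_z g [tuple vec_coord j z | j < N] =
  \int[iid_prob laplace_prob N]_w
    g [tuple (\1_(cell J j) u.1 + 2 / alpha * tnth w j)%R | j < N].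
Proof.
move=> kn mg g0 /=; move: kn; case: (k < n)%N => // _.
rewrite -stage1_integral//; apply: eq_integral => z _.
by congr g; apply: eq_from_tnth => j; rewrite tnth_mktuple.
Qed.

Lemma ZrealS k (h : H k) (z : out Q k) i :
  Zreal (k := k.+1) (h, z) i = if i == k then real_coord z else Zreal h i.
Proof. by []. Qed.

Lemma ZvecS k (h : H k) (z : out Q k) i j :
  Zvec (k := k.+1) (h, z) i j = if i == k then vec_coord j z else Zvec h i j.
Proof. by []. Qed.

Lemma phatS k (h : H k) (z : out Q k) : (n <= k)%N ->
  phat (k := k.+1) (h, z) = phat h.
Proof.
move=> nk; apply/funext => j; rewrite /phat; congr (_ * _)%R.
apply: eq_big_nat => i /andP[_ i_n]; rewrite ZvecS.
by rewrite ltn_eqF// (leq_trans i_n nk).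
Qed.

Lemma measurable_sum_Zreal k a b :
  measurable_fun setT (fun h : H k => \sum_(a <= i < b) Zreal h i)%R.
Proof.
apply: measurable_sum => i.
by apply: measurable_coord => l; exact: measurable_real_coord.
Qed.

(** [drift_le] for the square of the centred partial sum of the outputs of one
    stage: each of its answers adds at most the squared amplitude, and the steps
    outside the stage leave the square unchanged. *)
Let stage_second_moment (a b : nat) (amp : R) (s : forall k, R * H k -> R)
    (mm : forall k, H k -> R) c :
  (0 < amp)%R -> (a <= b <= c)%N ->
  (forall k (h : H k), measurable_fun setT (fun x => s k (x, h))) ->
  (forall k u, (`|s k u| <= amp)%R) ->
  (forall k (u : R * H k) (g : R -> \bar R), (a <= k < b)%N ->
     measurable_fun setT g -> (forall x, 0 <= g x) ->
     \int[ker Q k u]_z g (real_coord z) =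
     (response amp (s k u))%:E * g amp + (1 - response amp (s k u))%:E * g (- amp)%R) ->
  (forall k, measurable_fun setT (mm k)) ->
  (forall k h, (a <= k)%N -> mm k h = \int[data]_x s k (x, h))%R ->
  (forall k h z, (a <= k)%N -> mm k.+1 (h, z) = mm k h) ->
  \int[out_prob mX df Q c]_h
     ((\sum_(a <= i < b) Zreal h i - (b - a)%:R * mm c h) ^+ 2)%:E
  <= ((b - a)%:R * amp ^+ 2)%:E.
Proof.
move=> amp0 /andP[ab bc] ms sb kerE mmm mmE mmS.
pose W k (h : H k) : \bar R :=
  ((\sum_(a <= i < minn k b) Zreal h i - (minn k b - a)%:R * mm k h) ^+ 2)%:E.
pose v k : R := if (k < b)%N then (amp ^+ 2)%R else 0%R.
have := @drift_le R X f mX df Q a c W v.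
have -> : \int[out_prob mX df Q a]_h W a h = 0.
  apply: integral0_eq => h _; rewrite /W (minn_idPl ab) big_geq// subnn.
  by rewrite mul0r subr0 expr0n.
rewrite add0e.
have -> : (\sum_(a <= k < c) v k = (b - a)%:R * amp ^+ 2)%R.
  have late : (\sum_(b <= k < c) v k = 0)%R.
    rewrite big_nat; apply: big1 => i /andP[bi _].
    by rewrite /v ltnNge bi.
  rewrite (big_cat_nat ab bc)/= late addr0.
  rewrite (eq_big_nat _ _ (F2 := fun=> amp ^+ 2)%R); last first.
    by move=> i /andP[_ ib]; rewrite /v ib.
  by rewrite sumr_const_nat mulr_natl.
rewrite /W (minn_idPr bc); apply.
- move=> k; apply/measurable_EFinP; apply: measurable_funX.
  apply: measurable_funB; first exact: measurable_sum_Zreal.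
  exact: measurable_funM.
- by move=> k h; rewrite lee_fin sqr_ge0.
- move=> k h /andP[ak kc].
  have [kb|bk] := ltnP k b; last first.
    have -> : v k = 0%R by rewrite /v ltnNge bk.
    rewrite adde0 (minn_idPr (leqW bk)) ?(minn_idPr bk).
    rewrite (_ : (fun x => _) = (fun=> ((\sum_(a <= i < b) Zreal h i - (b - a)%:R * mm k h) ^+ 2)%:E)).
      by rewrite integral_cst_prob.
    apply/funext => x; rewrite -[RHS](integral_cst_kernel (ker Q k) (x, h)).
    apply: eq_integral => z _; rewrite mmS//; congr (((_ - _) ^+ 2)%:E).
    apply: eq_big_nat => i /andP[_ ib]; rewrite ZrealS ltn_eqF//.
    exact: leq_trans bk.
  rewrite /v kb (minn_idPl kb) ?(minn_idPl (ltnW kb)).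
  set M := (\sum_(a <= i < k) Zreal h i - (k - a)%:R * mm k h)%R.
  rewrite -EFinD.
  apply: le_trans (response_second_moment data M (ms k h) amp0 (fun x => sb k (x, h))).
  rewrite le_eqVlt; apply/orP; left; apply/eqP/eq_integral => x _.
  pose g (y : R) := ((M + (y - mm k h)) ^+ 2)%:E.
  rewrite -mmE//.
  have mg : measurable_fun setT g.
    apply/measurable_EFinP; apply: measurable_funX; apply: measurable_funD => //.
    exact: measurable_funB.
  have g0 y : 0 <= g y by rewrite lee_fin sqr_ge0.
  have akb : (a <= k < b)%N by rewrite ak kb.
  rewrite -(kerE k (x, h) g akb mg g0).
  apply: eq_integral => z _; rewrite /g; congr ((_ ^+ 2)%:E).
  rewrite mmS// big_nat_recr//= ZrealS eqxx subSn// -natr1 /M.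
  rewrite (eq_big_nat _ _ (F2 := fun i => Zreal h i)); first by ring.
  by move=> i /andP[_ ik]; rewrite ZrealS ltn_eqF.
- exact: leq_trans bc.
Qed.

Definition cell_prob j : R := \int[data]_x \1_(cell J j) x.

(** The mean of an output of stage two given the first stage. *)
Definition mean2 k (h : H k) : R :=
  (\sum_(j < N) cell_prob j * clp (phat h j - p0 f0 J j))%R.

Definition outside_prob : R := \int[data]_x \1_(~` cells J) x.

Let measurable_indic_cell j : measurable_fun setT (\1_(cell J j) : R -> R).
Proof. by apply: measurable_indic; exact: measurable_cell. Qed.

Let norm_indic (A : set R) x : (`|\1_A x| <= 1 :> R)%R.
Proof. by rewrite indicE; case: (_ \in _); rewrite ?normr1 ?normr0. Qed.

Lemma mean2E k (h : H k) : mean2 h = (\int[data]_x signal2 (x, h))%R.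
Proof.
rewrite /signal2 /=; apply: EFin_inj.
have ii j : data.-integrable setT (EFin \o (\1_(cell J j) : R -> R)).
  exact: (bounded_integrable_prob _ _ (norm_indic _)).
rewrite [RHS]fineK; last first.
  apply: integrable_fin_num => //.
  apply: (@bounded_integrable_prob R _ _ data _ ta).
    apply: measurable_sum => j; exact: measurable_funM.
  by move=> x; exact: (norm_signal2 alpha_gt0 n_gt0 tJ (x, h)).
under eq_integral do rewrite -sumEFin.
rewrite integral_sum//; last first.
  move=> j; under eq_fun do rewrite EFinM muleC.
  by apply: integrableZl => //; exact: ii.
rewrite /mean2 -sumEFin; apply: eq_bigr => j _.
under eq_integral do rewrite EFinM muleC.
rewrite integralZl//; last exact: ii.
rewrite EFinM muleC; congr (_ * _).
by rewrite /cell_prob /Rintegral fineK//; apply: integrable_fin_num => //; exact: ii.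
Qed.

Lemma stage2_second_moment :
  \int[out_prob mX df Q (3 * n)]_h
     ((\sum_(n <= i < 2 * n) Zreal h i - n%:R * mean2 h) ^+ 2)%:E
  <= (n%:R * (ca * ta) ^+ 2)%:E.
Proof.
have c1 := c_alpha_gt1 alpha_gt0; have t0 := tau_gt0 alpha_gt0 n_gt0.
have -> : n%:R = (2 * n - n)%:R :> R by rewrite mul2n -addnn addnK.
apply: (@stage_second_moment n (2 * n) (ca * ta)%R
  (fun k u => signal2 u) (fun k h => mean2 h) (3 * n)).
- by rewrite mulr_gt0//; lra.
- by rewrite leq_pmull//= leq_pmul2r.
- move=> k h; apply: measurable_sum => j; apply: measurable_funM => //.
  exact: (measurable_cst (clp (phat h j - p0 f0 J j))%R).
- move=> k u; apply: (le_trans (norm_signal2 alpha_gt0 n_gt0 tJ u)).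
  by rewrite ler_peMl//; lra.
- by move=> k u g *; exact: ker_stage2.
- move=> k; apply: measurable_sum => j; apply: measurable_funM => //.
  apply: (measurableT_comp (measurable_clip alpha n)); apply: measurable_funB => //.
  exact: measurable_phat.
- by move=> k h _; exact: mean2E.
- by move=> k h z nk; rewrite /mean2 phatS.
Qed.

Lemma stage3_second_moment :
  \int[out_prob mX df Q (3 * n)]_h
     ((\sum_(2 * n <= i < 3 * n) Zreal h i - n%:R * outside_prob) ^+ 2)%:E
  <= (n%:R * ca ^+ 2)%:E.
Proof.
have c1 := c_alpha_gt1 alpha_gt0.
have -> : n%:R = (3 * n - 2 * n)%:R :> R by rewrite -mulnBl mul1n.
apply: (@stage_second_moment (2 * n) (3 * n) ca
  (fun k u => signal3 u) (fun k h => outside_prob) (3 * n)) => //.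
- by lra.
- by rewrite leq_pmul2r//= leqnn.
- move=> k h; apply: measurable_indic; apply: measurableC; exact: measurable_cells.
- by move=> k u; apply: (le_trans (norm_signal3 u)); exact: ltW.
- by move=> k u g /andP[? ?] *; exact: ker_stage3.
Qed.

End stages_two_three.

(** * Error probabilities from second moments *)

Section concentration.
Local Open Scope ereal_scope.
Context {R : realType}.

Lemma expR_ge_cubic (x : R) : (0 <= x)%R ->
  (1 + x + x ^+ 2 / 2 + x ^+ 3 / 6 <= expR x)%R.
Proof.
move=> x0.
have nd : nondecreasing_seq (series (exp_coeff x)).
  by apply: nondecreasing_series => k _ _; exact: exp_coeff_ge0.
have := nondecreasing_cvgn_le nd (is_cvg_series_exp_coeff x) 4.
rewrite -/(expR x); apply: le_trans.
rewrite /series /exp_coeff /= big_mkord !big_ord_recr big_ord0 /= !factS fact0.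
rewrite le_eqVlt; apply/orP; left; apply/eqP.
by rewrite !muln1 /= expr0 expr1; field.
Qed.

(** [c_alpha alpha] is coth (alpha / 2), and alpha * coth (alpha / 2) is at most
    11/5 on the unit interval; (11/5)^2 < 5. *)
Lemma sqr_c_alpha_le (alpha : R) : (0 < alpha < 1)%R ->
  (c_alpha alpha ^+ 2 <= 5 / alpha ^+ 2)%R.
Proof.
move=> /andP[a0 a1].
have c1 := c_alpha_gt1 a0.
have e1 : (1 < expR alpha)%R by rewrite expR_gt1.
suff h : (c_alpha alpha * alpha <= 11 / 5)%R.
  rewrite ler_pdivlMr ?exprn_gt0// -exprMn.
  apply: (@le_trans _ _ ((11 / 5) ^+ 2)%R); last by lra.
  have ca0 : (0 <= c_alpha alpha)%R by lra.
  by rewrite lerXn2r// nnegrE mulr_ge0// ltW.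
rewrite /c_alpha mulrAC ler_pdivrMr; last by lra.
have := expR_ge_cubic (ltW a0); set e := expR alpha in e1 *.
move=> he.
have h2 : (0 <= 11 / 5 - alpha)%R by lra.
have := ler_wpM2l h2 he.
rewrite !exprS expr0 => h3.
have : (0 <= alpha * (1 - alpha))%R by rewrite mulr_ge0//; lra.
have : (0 <= alpha * alpha * (1 - alpha))%R by rewrite !mulr_ge0//; lra.
have : (0 <= alpha * alpha * alpha * (1 - alpha))%R by rewrite !mulr_ge0//; lra.
lra.
Qed.

Variables (f0 : R -> R) (alpha : R) (n N : nat) (J : 'I_N -> interval R).
Hypotheses (alpha01 : (0 < alpha < 1)%R) (n_gt0 : (0 < n)%N)
  (tJ : trivIset setT (cell J)).
Variables (X : set R) (f : R -> R) (mX : measurable X) (df : density X f).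

Local Notation Q := (mechanism3 f0 alpha n J).
Local Notation H k := (hist (out Q) k).
Local Notation ca := (c_alpha alpha).
Local Notation ta := (tau alpha n).
Local Notation clp := (clip alpha n).
Local Notation data := (data_prob mX df).
Local Notation na2 := (n%:R * alpha ^+ 2)%R.

Let alpha_gt0 : (0 < alpha)%R. Proof. by case/andP: alpha01. Qed.

(** The conditional mean of [D_B] given the first stage. *)
Definition mean_D k (h : H k) : R :=
  (\sum_(j < N) (cell_prob J mX df j - p0 f0 J j) * clp (phat h j - p0 f0 J j))%R.

(** The mean of [T_B]. *)
Definition mean_T : R :=
  (outside_prob J mX df - \int[lebesgue_measure]_(x in X `\` cells J) f0 x)%R.

Lemma na2_gt0 : (0 < na2)%R.
Proof. by rewrite mulr_gt0 ?ltr0n ?exprn_gt0. Qed.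

Lemma sqr_tau : (ta ^+ 2 = na2^-1)%R.
Proof. by rewrite /tau exprVn sqr_sqrtr// ltW// na2_gt0. Qed.

Let ge0_scale_second_moment d (T : measurableType d) (P : probability T R)
    (c : R) (u : T -> R) v : measurable_fun setT u ->
  \int[P]_x (u x ^+ 2)%:E <= v%:E ->
  \int[P]_x ((c * u x) ^+ 2)%:E <= (c ^+ 2 * v)%:E.
Proof.
move=> mu uv; under eq_integral do rewrite exprMn EFinM.
have mu2 : measurable_fun setT (fun x => (u x ^+ 2)%:E).
  by apply/measurable_EFinP; exact: measurable_funX.
have c20 : 0 <= (c ^+ 2)%:E by rewrite lee_fin sqr_ge0.
rewrite ge0_integralZl//; last by move=> x _; rewrite lee_fin sqr_ge0.
by rewrite [leRHS]EFinM; apply: lee_wpmul2l.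
Qed.

Let measurable_clip_phat k j :
  measurable_fun setT (fun h : H k => clp (phat h j - p0 f0 J j)).
Proof.
apply: (measurableT_comp (measurable_clip alpha n)); apply: measurable_funB => //.
exact: measurable_phat.
Qed.

Lemma measurable_D_B : measurable_fun setT (@D_B R f0 alpha n N J).
Proof.
apply: measurable_funB.
  by apply: measurable_funM => //; exact: measurable_sum_Zreal.
by apply: measurable_sum => j; exact: measurable_funM.
Qed.

Lemma measurable_T_B : measurable_fun setT (@T_B R X f0 alpha n N J).
Proof.
apply: measurable_funB => //.
by apply: measurable_funM => //; exact: measurable_sum_Zreal.
Qed.

Lemma measurable_mean_D k : measurable_fun setT (@mean_D k).
Proof. by apply: measurable_sum => j; exact: measurable_funM. Qed.

(** The variance is that of n answers of amplitude c_alpha tau divided by n^2,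
    with tau^2 = 1 / (n alpha^2). *)
Lemma D_B_second_moment :
  \int[out_prob mX df Q (3 * n)]_h ((D_B h - mean_D h) ^+ 2)%:E <=
  (5 / na2 ^+ 2)%:E.
Proof.
have n0 : (n%:R != 0 :> R)%R by rewrite pnatr_eq0 -lt0n.
have -> : \int[out_prob mX df Q (3 * n)]_h ((D_B h - mean_D h) ^+ 2)%:E =
    \int[out_prob mX df Q (3 * n)]_h
     ((n%:R^-1 * (\sum_(n <= i < 2 * n) Zreal h i - n%:R * mean2 mX df h)) ^+ 2)%:E.
  apply: eq_integral => h _; congr ((_ ^+ 2)%:E).
  rewrite /D_B /mean_D mulrBr mulKf// -addrA -opprD; congr (_ - _)%R.
  by rewrite /mean2 -big_split; apply: eq_bigr => j _ /=; ring.
apply: le_trans (ge0_scale_second_moment _ _ (stage2_second_moment f0 alpha_gt0 n_gt0 tJ mX df)) _.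
  apply: measurable_funB; first exact: measurable_sum_Zreal.
  apply: measurable_funM => //; apply: measurable_sum => j.
  exact: measurable_funM.
rewrite lee_fin exprMn sqr_tau.
have na0 := na2_gt0; have a0 := alpha_gt0.
apply: (@le_trans _ _ (n%:R^-1 ^+ 2 * (n%:R * (5 / alpha ^+ 2 / na2)))%R).
  rewrite !ler_wpM2l ?sqr_ge0 ?ler0n// ler_wpM2r ?invr_ge0 ?(ltW na0)//.
  exact: sqr_c_alpha_le.
rewrite le_eqVlt; apply/orP; left; apply/eqP; field.
by rewrite n0 gt_eqF.
Qed.

Lemma T_B_second_moment :
  \int[out_prob mX df Q (3 * n)]_h ((T_B X h - mean_T) ^+ 2)%:E <= (5 / na2)%:E.
Proof.
have n0 : (n%:R != 0 :> R)%R by rewrite pnatr_eq0 -lt0n.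
have -> : \int[out_prob mX df Q (3 * n)]_h ((T_B X h - mean_T) ^+ 2)%:E =
    \int[out_prob mX df Q (3 * n)]_h
     ((n%:R^-1 * (\sum_(2 * n <= i < 3 * n) Zreal h i - n%:R * outside_prob J mX df)) ^+ 2)%:E.
  apply: eq_integral => h _; congr ((_ ^+ 2)%:E).
  by rewrite /T_B /mean_T mulrBr mulKf//; ring.
apply: le_trans (ge0_scale_second_moment _ _ (stage3_second_moment f0 J alpha_gt0 n_gt0 mX df)) _.
  by apply: measurable_funB => //; exact: measurable_sum_Zreal.
rewrite lee_fin; have a0 := alpha_gt0.
apply: (@le_trans _ _ (n%:R^-1 ^+ 2 * (n%:R * (5 / alpha ^+ 2)))%R).
  by rewrite !ler_wpM2l ?sqr_ge0 ?ler0n//; exact: sqr_c_alpha_le.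
rewrite le_eqVlt; apply/orP; left; apply/eqP; field.
by rewrite n0 gt_eqF.
Qed.

(** Moves an event about the first stage, such as a small centre of [D_B], between
    the full sample and the first stage. *)
Lemma integral_first_stage (G : forall k, H k -> \bar R) k : (n <= k)%N ->
  (forall k, measurable_fun setT (G k)) -> (forall k h, 0 <= G k h) ->
  (forall k h z, (n <= k)%N -> G k.+1 (h, z) = G k h) ->
  \int[out_prob mX df Q k]_h G k h = \int[out_prob mX df Q n]_h G n h.
Proof.
move=> nk mG G0 GS; elim: k nk => [|k IH]; first by rewrite leqn0 => /eqP <-.
rewrite leq_eqVlt => /predU1P[<-//|]; rewrite ltnS => nk.
rewrite integral_out_probS// -IH//; apply: eq_integral => h _.
rewrite -[RHS](integral_cst_prob data); apply: eq_integral => x _.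
rewrite -[RHS](integral_cst_kernel (ker Q k) (x, h)); apply: eq_integral => z _.
exact: GS.
Qed.

Section errors.
Variable gamma : R.
Hypothesis gamma_gt0 : (0 < gamma)%R.
Let t1 : R := (2 * Num.sqrt 5 / (na2 * Num.sqrt gamma))%R.
Let t2 : R := Num.sqrt (20 / (na2 * gamma)).

Let sqr_t1 : (t1 ^+ 2 = 20 / (na2 ^+ 2 * gamma))%R.
Proof. by rewrite /t1 !exprMn exprVn exprMn !sqr_sqrtr ?ltW//; congr (_ / _)%R; ring. Qed.

Let sqr_t2 : (t2 ^+ 2 = 20 / (na2 * gamma))%R.
Proof.
by rewrite /t2 sqr_sqrtr// divr_ge0// mulr_ge0 ?ltW// na2_gt0.
Qed.

Let t1_gt0 : (0 < t1)%R.
Proof.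
by apply: divr_gt0; apply: mulr_gt0; rewrite ?sqrtr_gt0 ?na2_gt0.
Qed.

Let t2_gt0 : (0 < t2)%R.
Proof. by rewrite sqrtr_gt0 divr_gt0// mulr_gt0// na2_gt0. Qed.

(** The squared deviations in units of the thresholds: at least 1 when a
    statistic is off by its threshold, and of mean at most gamma / 4. *)
Let dev_D (h : H (3 * n)) : \bar R := ((t1^-1 * (D_B h - mean_D h)) ^+ 2)%:E.
Let dev_T (h : H (3 * n)) : \bar R := ((t2^-1 * (T_B X h - mean_T)) ^+ 2)%:E.

Let dev_D_ge0 h : 0 <= dev_D h. Proof. by rewrite lee_fin sqr_ge0. Qed.
Let dev_T_ge0 h : 0 <= dev_T h. Proof. by rewrite lee_fin sqr_ge0. Qed.

Let mdev_D : measurable_fun setT dev_D.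
Proof.
apply/measurable_EFinP; apply: measurable_funX; apply: measurable_funM => //.
apply: measurable_funB; first exact: measurable_D_B.
exact: measurable_mean_D.
Qed.

Let mdev_T : measurable_fun setT dev_T.
Proof.
apply/measurable_EFinP; apply: measurable_funX; apply: measurable_funM => //.
by apply: measurable_funB => //; exact: measurable_T_B.
Qed.

Let int_dev_D : \int[out_prob mX df Q (3 * n)]_h dev_D h <= (gamma / 4)%:E.
Proof.
apply: le_trans (ge0_scale_second_moment _ _ D_B_second_moment) _.
  apply: measurable_funB; first exact: measurable_D_B.
  exact: measurable_mean_D.
rewrite lee_fin exprVn sqr_t1 le_eqVlt; apply/orP; left; apply/eqP; field.
by rewrite (gt_eqF gamma_gt0) (gt_eqF alpha_gt0) gt_eqF ?ltr0n.
Qed.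

Let int_dev_T : \int[out_prob mX df Q (3 * n)]_h dev_T h <= (gamma / 4)%:E.
Proof.
apply: le_trans (ge0_scale_second_moment _ _ T_B_second_moment) _.
  by apply: measurable_funB => //; exact: measurable_T_B.
rewrite lee_fin exprVn sqr_t2 le_eqVlt; apply/orP; left; apply/eqP; field.
by rewrite (gt_eqF gamma_gt0) (gt_eqF alpha_gt0) gt_eqF ?ltr0n.
Qed.

Let dev_ge1 (t u : R) : (0 < t)%R -> (t <= `|u|)%R -> 1 <= ((t^-1 * u) ^+ 2)%:E.
Proof.
move=> t0 tu; rewrite lee_fin -real_normK ?num_real// expr_ge1// normrM.
by rewrite normfV (gtr0_norm t0) mulrC ler_pdivlMr// mul1r.
Qed.

Let mPhi : measurable_fun setT (fun h => Phi X f0 alpha n J h t1 t2).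
Proof.
by apply: measurable_or; apply: measurable_fun_ler => //;
  [exact: measurable_D_B|exact: measurable_T_B].
Qed.

Lemma measurable_Phi : tests (fun z : H (3 * n) => Phi X f0 alpha n J z t1 t2).
Proof. exact: mPhi. Qed.

Let mPhi_set b : measurable [set h | Phi X f0 alpha n J h t1 t2 = b].
Proof.
rewrite -[X in measurable X]setTI.
exact: (mPhi measurableT (Y := [set b]) I).
Qed.

Lemma type1_le : (forall k (h : H k), mean_D h = 0)%R -> mean_T = 0%R ->
  out_prob mX df Q (3 * n) [set h | Phi X f0 alpha n J h t1 t2 = true]
  <= (gamma / 2)%:E.
Proof.
move=> D0 T0.
have := prob_le_integral (out_prob mX df Q (3 * n)) (mPhi_set true)
  (emeasurable_funD mdev_D mdev_T) (fun h => adde_ge0 (dev_D_ge0 h) (dev_T_ge0 h)).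
move=> le_dev; apply: le_trans (le_dev _) _.
  move=> h /orP[th|th].
    rewrite -[leLHS]adde0 leeD//; apply: dev_ge1 => //.
    by rewrite D0 subr0 (le_trans th)// ler_norm.
  rewrite -[leLHS]add0e leeD//; apply: dev_ge1 => //.
  by rewrite T0 subr0 (le_trans th)// ler_norm.
rewrite ge0_integralD//.
apply: le_trans (leeD int_dev_D int_dev_T) _.
by rewrite -EFinD lee_fin; lra.
Qed.

(** A centre at 2 t2 leaves room t2 for the deviation. *)
Lemma type2_le_T : (2 * t2 <= mean_T)%R ->
  out_prob mX df Q (3 * n) [set h | Phi X f0 alpha n J h t1 t2 = false]
  <= (gamma / 4)%:E.
Proof.
move=> bT.
have := prob_le_integral (out_prob mX df Q (3 * n)) (mPhi_set false) mdev_T dev_T_ge0.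
move=> le_dev; apply: le_trans (le_dev _) int_dev_T.
move=> h /negbT; rewrite negb_or -!ltNge => /andP[_ th].
apply: dev_ge1 => //; rewrite ler_normr; apply/orP; right.
by move: th t2_gt0 bT; lra.
Qed.

(** The centre of [D_B] is itself random, known after the first stage; the event
    that it is below 2 t1 is paid for separately. *)
Lemma type2_le_D (eps : R) :
  out_prob mX df Q n [set h | (mean_D h < 2 * t1)%R] <= eps%:E ->
  out_prob mX df Q (3 * n) [set h | Phi X f0 alpha n J h t1 t2 = false]
  <= (gamma / 4 + eps)%:E.
Proof.
move=> small.
pose L k : set (H k) := [set h | (mean_D h < 2 * t1)%R].
have mL k : measurable (L k).
  rewrite -[X in measurable X]setTI.
  exact: (measurable_fun_ltr (@measurable_mean_D k) (@measurable_cst _ _ _ _ setT (2 * t1)%R)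
    measurableT (Y := [set true]) I).
have mindL k : measurable_fun setT (fun h : H k => (\1_(L k) h)%:E : \bar R).
  by apply/measurable_EFinP; exact: measurable_indic.
have := prob_le_integral (out_prob mX df Q (3 * n)) (mPhi_set false)
  (emeasurable_funD mdev_D (mindL (3 * n)%N)).
move=> le_dev; apply: le_trans (le_dev _ _) _.
- by move=> h; rewrite adde_ge0.
- move=> h /negbT; rewrite negb_or -!ltNge => /andP[dh _].
  have [hL|hL] := boolP (h \in L (3 * n)%N).
    by rewrite -[leLHS]add0e leeD// indicE hL.
  rewrite -[leLHS]adde0 leeD//; apply: dev_ge1 => //.
  rewrite ler_normr; apply/orP; right.
  have : (2 * t1 <= mean_D h)%R.
    by rewrite leNgt; apply: contraNN hL => ?; rewrite inE.
  by move: dh; lra.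
rewrite ge0_integralD//.
have -> : \int[out_prob mX df Q (3 * n)]_h (\1_(L (3 * n)%N) h)%:E =
    \int[out_prob mX df Q n]_h (\1_(L n) h)%:E.
  apply: (integral_first_stage (G := fun k h => (\1_(L k) h)%:E)) => //.
    by rewrite leq_pmull.
  move=> k h z nk; rewrite !indicE; congr ((_ : bool)%:R%:E).
  by apply/idP/idP; rewrite !inE /L /mean_D /= phatS.
rewrite EFinD; apply: leeD => //.
by rewrite integral_indic// setIT.
Qed.

End errors.
End concentration.

(** * The first stage as cell counts plus Laplace sums *)

Section first_stage.
Local Open Scope ereal_scope.
Context {R : realType}.
Variables (N : nat) (J : 'I_N -> interval R).

Definition cell_vector (x : R) : N.-tuple R := [tuple \1_(cell J j) x | j < N].

Let measurable_cell_vector : measurable_fun setT cell_vector.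
Proof.
apply/measurable_fun_tnthP => j.
apply: (eq_measurable_fun (\1_(cell J j) : R -> R)).
  by move=> u _; rewrite /= tnth_mktuple.
by apply: measurable_indic; exact: measurable_cell.
Qed.

HB.instance Definition _ :=
  @isMeasurableFun.Build _ _ _ _ cell_vector measurable_cell_vector.

Variables (f0 : R -> R) (alpha : R) (n : nat).
Variables (X : set R) (f : R -> R) (mX : measurable X) (df : density X f).

Local Notation Q := (mechanism3 f0 alpha n J).
Local Notation H k := (hist (out Q) k).
Local Notation data := (data_prob mX df).
Local Notation Lap := (@laplace_prob R).

Definition cell_law : probability (N.-tuple R) R := distribution data cell_vector.

Definition sum_Zvec k (h : H k) : N.-tuple R :=
  [tuple \sum_(0 <= i < k) Zvec h i j | j < N]%R.

Definition add_noise (c s : N.-tuple R) : N.-tuple R :=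
  [tuple (tnth c j + 2 / alpha * tnth s j)%R | j < N].

Lemma measurable_add_noise : measurable_fun setT
  (fun u : N.-tuple R * N.-tuple R => add_noise u.1 u.2).
Proof.
apply/measurable_fun_tnthP => j.
apply: (eq_measurable_fun (fun u : N.-tuple R * N.-tuple R =>
  tnth u.1 j + 2 / alpha * tnth u.2 j)%R).
  by move=> u _; rewrite /= tnth_mktuple.
apply: measurable_funD.
- exact: (measurableT_comp (measurable_tnth j) measurable_fst).
- apply: measurable_funM => //.
  exact: (measurableT_comp (measurable_tnth j) measurable_snd).
Qed.

Let add_noise_tadd c c' s s' :
  add_noise (tadd (c, c')) (tadd (s, s')) = tadd (add_noise c s, add_noise c' s').
Proof.
apply: eq_from_tnth => j; rewrite /add_noise /tadd !tnth_mktuple /= ?tnth_mktuple.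
by ring.
Qed.

Let measurable_taddr' (t : N.-tuple R) : measurable_fun setT (fun s => tadd (t, s)).
Proof. exact: measurable_taddr. Qed.

Let measurable_add_noise2 c : measurable_fun setT (add_noise c).
Proof. exact: (measurableT_comp measurable_add_noise (pair1_measurable c)). Qed.

Let measurable_inner (G : N.-tuple R -> \bar R) (P : probability (N.-tuple R) R) :
  measurable_fun setT G -> (forall t, 0 <= G t) ->
  measurable_fun setT (fun c => \int[P]_s G (add_noise c s)).
Proof.
move=> mG G0.
apply: (@measurable_fun_integral_snd _ _ _ _ _ P (fun c s => G (add_noise c s))) => //.
exact: (measurableT_comp mG measurable_add_noise).
Qed.

Let measurable_noise_step (G : N.-tuple R -> \bar R) :
  measurable_fun setT G -> (forall t, 0 <= G t) ->
  measurable_fun setT (fun t =>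
    \int[cell_law]_c \int[iid_prob Lap N]_w G (tadd (t, add_noise c w))).
Proof.
move=> mG G0.
apply: (@measurable_fun_integral_snd _ _ _ _ _ cell_law (fun t c =>
  \int[iid_prob Lap N]_w G (tadd (t, add_noise c w)))); last first.
  by move=> t c; exact: integral_ge0.
apply: (@measurable_fun_integral_snd _ _ _ _ _ (iid_prob Lap N)
  (fun u w => G (tadd (u.1, add_noise u.2 w)))) => //.
apply: (measurableT_comp mG).
apply: (@measurableT_comp _ _ _ _ _ _ (@tadd R N)) => //.
apply: measurable_fun_pair.
  exact: (measurableT_comp measurable_fst measurable_fst).
apply: (@measurableT_comp _ _ _ _ _ _ _ _
  (fun v : (N.-tuple R * N.-tuple R) * N.-tuple R => (v.1.2, v.2)) measurable_add_noise).
apply: measurable_fun_pair => //.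
exact: (measurableT_comp measurable_snd measurable_fst).
Qed.

(** The sum of the outputs of the first stage is the vector of cell counts plus
    scaled Laplace sums independent of it: the walks of the counts and of the
    noise are drawn jointly step by step, and Fubini's theorem separates them. *)
Let integral_sum_Zvec k (G : N.-tuple R -> \bar R) : (k <= n)%N ->
  measurable_fun setT G -> (forall t, 0 <= G t) ->
  \int[out_prob mX df Q k]_h G (sum_Zvec h) =
  \int[vector_sum_law cell_law k]_c \int[vector_sum_law (iid_prob Lap N) k]_s G (add_noise c s).
Proof.
elim: k G => [|k IH] G kn mG G0.
  rewrite [RHS]integral_walk0; last exact: measurable_inner.
  rewrite [RHS]integral_walk0; last exact: (measurableT_comp mG (measurable_add_noise2 _)).
  rewrite (_ : (fun h => _) = (fun=> G (add_noise (tzero N) (tzero N)))).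
    by rewrite integral_cst_prob.
  apply/funext => h; congr G; apply: eq_from_tnth => j.
  by rewrite !tnth_mktuple big_geq// mulr0 addr0.
have mS : measurable_fun setT (@sum_Zvec k.+1).
  apply/measurable_fun_tnthP => j.
  apply: (eq_measurable_fun (fun h : H k.+1 => \sum_(0 <= i < k.+1) Zvec h i j)%R).
    by move=> h _; rewrite /= tnth_mktuple.
  apply: measurable_sum => i; apply: measurable_coord => l.
  exact: measurable_vec_coord.
rewrite integral_out_probS//; last exact: (measurableT_comp mG mS).
pose G1 t := \int[cell_law]_c \int[iid_prob Lap N]_w G (tadd (t, add_noise c w)).
have mG1 : measurable_fun setT G1 by exact: measurable_noise_step.
have G10 t : 0 <= G1 t.
  by apply: integral_ge0 => c _; exact: integral_ge0.
transitivity (\int[out_prob mX df Q k]_h G1 (sum_Zvec h)).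
  apply: eq_integral => h _; rewrite /G1 ge0_integral_distribution//; last 2 first.
  - apply: (@measurable_inner (fun t => G (tadd (sum_Zvec h, t)))) => //.
    exact: (measurableT_comp mG (measurable_taddr' _)).
  - by move=> c; exact: integral_ge0.
  apply: eq_integral => x _ /=.
  transitivity (\int[ker Q k (x, h)]_z G (tadd (sum_Zvec h, [tuple vec_coord j z | j < N]))).
    apply: eq_integral => z _; congr G; apply: eq_from_tnth => j.
    rewrite /sum_Zvec /tadd !tnth_mktuple /= ?tnth_mktuple big_nat_recr//= ZvecS eqxx; congr (_ + _)%R.
    by apply: eq_big_nat => i /andP[_ ik]; rewrite ZvecS ltn_eqF.
  rewrite (@ker_stage1 _ _ _ _ _ _ _ _ (fun t => G (tadd (sum_Zvec h, t))))//; last first.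
    exact: (measurableT_comp mG).
  apply: eq_integral => w _; congr (G (tadd (_, _))); apply: eq_from_tnth => j.
  by rewrite !tnth_mktuple.
rewrite IH//; last exact: ltnW.
rewrite [RHS]integral_walkS; last 2 first.
- exact: measurable_inner.
- by move=> c; exact: integral_ge0.
apply: eq_integral => c _.
pose F (u : N.-tuple R * N.-tuple R) :=
  \int[iid_prob Lap N]_w G (add_noise (tadd (c, u.2)) (tadd (u.1, w))).
have mF : measurable_fun setT F.
  apply: (@measurable_fun_integral_snd _ _ _ _ _ (iid_prob Lap N)
    (fun u w => G (add_noise (tadd (c, u.2)) (tadd (u.1, w))))) => //.
  apply: (measurableT_comp mG).
  apply: (@measurableT_comp _ _ _ _ _ _ _ _
    (fun v : (N.-tuple R * N.-tuple R) * N.-tuple R =>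
       (tadd (c, v.1.2), tadd (v.1.1, v.2))) measurable_add_noise).
  apply: measurable_fun_pair.
    apply: (measurableT_comp (measurable_taddr' c)).
    exact: (measurableT_comp measurable_snd measurable_fst).
  apply: (@measurableT_comp _ _ _ _ _ _ (@tadd R N)) => //.
  apply: measurable_fun_pair => //.
  exact: (measurableT_comp measurable_fst measurable_fst).
have F0 u : 0 <= F u by exact: integral_ge0.
transitivity (\int[vector_sum_law (iid_prob Lap N) k]_s \int[cell_law]_c' F (s, c')).
  apply: eq_integral => s _; apply: eq_integral => c' _; apply: eq_integral => w _.
  by rewrite add_noise_tadd.
rewrite (fubini_tonelli F)//; apply: eq_integral => c' _.
rewrite [RHS]integral_walkS//.
exact: (measurableT_comp mG (measurable_add_noise2 _)).
Qed.

(** Regrouping by cells: the Laplace sums of different cells are independent. *)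
Lemma integral_first_stage_sum (G : N.-tuple R -> \bar R) :
  measurable_fun setT G -> (forall t, 0 <= G t) ->
  \int[out_prob mX df Q n]_h G (sum_Zvec h) =
  \int[vector_sum_law cell_law n]_c \int[iid_prob (sum_law Lap n) N]_s G (add_noise c s).
Proof.
move=> mG G0; rewrite integral_sum_Zvec//; apply: eq_integral => c _.
by rewrite integral_vector_sum_law_iid//; exact: (measurableT_comp mG (measurable_add_noise2 _)).
Qed.

Lemma phat_sum_Zvec (h : H n) j : phat h j = (n%:R^-1 * tnth (sum_Zvec h) j)%R.
Proof. by rewrite tnth_mktuple. Qed.

Lemma integral_cell_law_tnth (g : R -> \bar R) j :
  measurable_fun setT g -> (forall x, 0 <= g x) ->
  \int[cell_law]_c g (tnth c j) = \int[data]_x g (\1_(cell J j) x).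
Proof.
move=> mg g0; rewrite ge0_integral_distribution//; last first.
  exact: (measurableT_comp mg (measurable_tnth j)).
by apply: eq_integral => x _ /=; rewrite tnth_mktuple.
Qed.

(** The indicator of a cell equals its square, so its variance is at most its
    mean. *)
Lemma count_second_moment j :
  \int[vector_sum_law cell_law n]_c ((tnth c j - n%:R * cell_prob J mX df j) ^+ 2)%:E <=
  (n%:R * cell_prob J mX df j)%:E.
Proof.
have mi : measurable_fun setT (\1_(cell J j) : R -> R).
  by apply: measurable_indic; exact: measurable_cell.
have ii : data.-integrable setT (EFin \o (\1_(cell J j) : R -> R)).
  apply: (@bounded_integrable_prob R _ _ data _ 1%R) => // x.
  by rewrite indicE; case: (_ \in _); rewrite ?normr1 ?normr0.
have sq : \int[cell_law]_c (tnth c j ^+ 2)%:E <= (cell_prob J mX df j)%:E.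
  rewrite (integral_cell_law_tnth (g := fun x => (x ^+ 2)%:E)); last 2 first.
  - by apply/measurable_EFinP; exact: measurable_funX.
  - by move=> x; rewrite lee_fin sqr_ge0.
  rewrite /cell_prob /Rintegral fineK; last exact: integrable_fin_num.
  rewrite le_eqVlt; apply/orP; left; apply/eqP/eq_integral => x _.
  by rewrite indicE; case: (_ \in _); rewrite ?expr1n ?expr0n.
have := @walk_second_moment R _ _ (@tadd R N) (tzero N) cell_law
  (fun c => tnth c j) _ n (measurable_tnth j) _ _ sq.
have -> : (\int[cell_law]_y tnth y j)%R = cell_prob J mX df j.
  rewrite /Rintegral; congr fine.
  rewrite integral_distribution//.
  - by apply: eq_integral => x _ /=; rewrite tnth_mktuple.
  - by apply/measurable_EFinP; exact: measurable_tnth.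
  - apply: eq_integrable ii => // x _ /=; by rewrite tnth_mktuple.
apply; first by rewrite tnth_mktuple.
by move=> x y; rewrite /tadd tnth_mktuple.
Qed.

End first_stage.

(** * Clipping a noisy signal *)

Section clipping.
Context {R : realType}.
Variables (alpha : R) (n : nat).
Hypotheses (alpha_gt0 : 0 < alpha) (n_gt0 : (0 < n)%N).
Local Notation ta := (tau alpha n).
Local Notation clp := (clip alpha n).

Let t0 : 0 < ta. Proof. exact: tau_gt0. Qed.

Lemma clip_cases x :
  [\/ clp x = ta /\ ta <= x, clp x = - ta /\ x <= - ta |
      clp x = x /\ - ta <= x <= ta].
Proof.
have t0' := t0; rewrite /clip /Num.max /Num.min.
case: (ltP x ta) => xt.
  case: (ltP (- ta) x) => xt'; last by apply: Or32; split.
  by apply: Or33; split => //; rewrite (ltW xt) (ltW xt').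
by rewrite gtrN//; apply: Or31; split.
Qed.

Lemma clipN x : clp (- x) = - clp x.
Proof.
have t0' := t0.
have [[-> ?]|[-> ?]|[-> /andP[? ?]]] := clip_cases x;
have [[-> ?]|[-> ?]|[-> /andP[? ?]]] := clip_cases (- x); lra.
Qed.

Lemma clip_lipschitz x y : `|clp x - clp y| <= `|x - y|.
Proof.
have t0' := t0.
have [[-> ?]|[-> ?]|[-> /andP[? ?]]] := clip_cases x;
have [[-> ?]|[-> ?]|[-> /andP[? ?]]] := clip_cases y;
have := ler_norm (x - y); have := ler_norm (- (x - y)); rewrite normrN => *;
by rewrite ler_norml; apply/andP; split; lra.
Qed.

(** A signal well above the clipping level survives unless the noise is of the
    order of the signal, an event weighed by the squared noise. *)
Lemma clip_large (K d x : R) : 1 < K -> K * ta < `|d| ->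
  ta * `|d| * (1 - 2 * x ^+ 2 / ((K - 1) * ta) ^+ 2) <= d * clp (d + x).
Proof.
move=> K1; have t0' := t0.
wlog d0 : d x / 0 <= d.
  move=> wl; have [|d0] := leP 0 d; first exact: wl.
  rewrite -normrN => hK; have := wl (- d) (- x) _ hK.
  by rewrite sqrrN -opprD clipN mulrNN; apply; lra.
rewrite ger0_norm// => hK.
have a0 : 0 < (K - 1) * ta by rewrite mulr_gt0//; lra.
have [xs|xl] := ltP `|x| ((K - 1) * ta).
  have -> : clp (d + x) = ta.
    move: xs; rewrite ltr_norml => /andP[x1 x2].
    have [[-> _]|[_ ?]|[_ /andP[_ ?]]] := clip_cases (d + x) => //; lra.
  rewrite [leRHS]mulrC ler_piMr// ?mulr_ge0// ?(ltW t0')//.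
  by rewrite gerBl divr_ge0// ?sqr_ge0// mulr_ge0// sqr_ge0.
apply: (@le_trans _ _ (ta * d * (-1))).
  rewrite ler_wpM2l ?mulr_ge0 ?(ltW t0')//.
  suff : 2 <= 2 * x ^+ 2 / ((K - 1) * ta) ^+ 2 by lra.
  rewrite ler_pdivlMr ?exprn_gt0// ler_pM2l//.
  rewrite -[in leRHS](real_normK (num_real x)) lerXn2r// nnegrE.
  exact: ltW.
rewrite mulrN1 -mulNr mulrC ler_wpM2l//.
by have := norm_clip alpha_gt0 n_gt0 (d + x); rewrite ler_norml => /andP[].
Qed.

(** Clipping is 1-Lipschitz, and Young's inequality splits the resulting error
    |d x| into a small multiple of d^2 and the squared noise. *)
Lemma clip_small (e d x y : R) : 0 < e ->
  d * clp (d + y) - (e * d ^+ 2 + x ^+ 2 / (4 * e)) <= d * clp (d + (x + y)).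
Proof.
move=> e0.
have h : `|d * (clp (d + y) - clp (d + (x + y)))| <= `|d| * `|x|.
  rewrite normrM ler_wpM2l// (le_trans (clip_lipschitz _ _))//.
  by rewrite (_ : d + y - _ = - x) ?normrN//; ring.
have : `|d| * `|x| <= e * d ^+ 2 + x ^+ 2 / (4 * e).
  rewrite -(real_normK (num_real d)) -(real_normK (num_real x)).
  set u := `|d|; set v := `|x|.
  rewrite -subr_ge0 (_ : _ - _ = (2 * e * u - v) ^+ 2 / (4 * e)).
    by rewrite divr_ge0 ?sqr_ge0 ?mulr_ge0// ltW.
  by field; rewrite gt_eqF.
have := ler_norm (d * (clp (d + y) - clp (d + (x + y)))).
move: h; rewrite mulrBr; lra.
Qed.

(** Adding symmetric noise to a nonnegative signal: the two signs of the noise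
    together never hurt, and they transmit the signal when the noise is at most
    half the clipping level. *)
Lemma clip_two_signs (d x : R) : 0 <= d ->
  (if `|x| <= ta / 2 then Num.min d ta else 0) <= clp (d + x) + clp (d - x).
Proof.
move=> d0; have t0' := t0.
have mmin : Num.min d ta <= d /\ Num.min d ta <= ta.
  by rewrite !ge_min !lexx orbT.
case: mmin => ? ?.
case: ifPn => [|_]; last first.
  by have [[-> ?]|[-> ?]|[-> /andP[? ?]]] := clip_cases (d + x);
  have [[-> ?]|[-> ?]|[-> /andP[? ?]]] := clip_cases (d - x); lra.
rewrite ler_norml => /andP[? ?].
by have [[-> ?]|[-> ?]|[-> /andP[? ?]]] := clip_cases (d + x);
  have [[-> ?]|[-> ?]|[-> /andP[? ?]]] := clip_cases (d - x); lra.
Qed.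

End clipping.

Section clip_mean.
Local Open Scope ereal_scope.
Context {R : realType}.
Variables (alpha : R) (n : nat).
Hypotheses (alpha_gt0 : (0 < alpha)%R) (n_gt0 : (0 < n)%N).
Local Notation ta := (tau alpha n).
Local Notation clp := (clip alpha n).
Variables (S : probability R R) (b q : R).
Hypotheses (S_sym : symmetric_law S)
  (q_le : q%:E <= S [set s | (`|b * s| <= ta / 2)%R]).

Lemma measurable_clip_affine d :
  measurable_fun setT (fun s : R => clp (d + b * s)).
Proof.
apply: (measurableT_comp (measurable_clip alpha n)).
by apply: measurable_funD => //; exact: measurable_funM.
Qed.

Let mclipB d : measurable_fun setT (fun s : R => clp (d - b * s)).
Proof.
apply: (measurableT_comp (measurable_clip alpha n)).
by apply: measurable_funB => //; exact: measurable_funM.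
Qed.

Let clip_mean_ge0 d : (0 <= d)%R ->
  (q / 2 * Num.min d ta <= \int[S]_s clp (d + b * s))%R.
Proof.
move=> d0; have t0 := tau_gt0 alpha_gt0 n_gt0.
pose A := [set s | (`|b * s| <= ta / 2)%R].
have mA : measurable A.
  rewrite -[X in measurable X]setTI.
  apply: (measurable_fun_ler (f := fun s : R => `|b * s|%R) (g := cst (ta / 2)%R) _ _ measurableT (Y := [set true]) I) => //.
  by apply: measurableT_comp => //; exact: measurable_funM.
have bnd x : (`|clp x| <= ta)%R by exact: norm_clip.
have i1 := bounded_integrable_prob S (measurable_clip_affine d) (fun s => bnd _).
have i2 := bounded_integrable_prob S (mclipB d) (fun s => bnd _).
have E2 : (\int[S]_s clp (d - b * s) = \int[S]_s clp (d + b * s))%R.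
  rewrite -(Rintegral_symmetric S_sym (measurable_clip_affine d)).
  by apply: eq_Rintegral => s _; rewrite mulrN.
have m0 : (0 <= Num.min d ta)%R by rewrite le_min d0 ltW.
have : (\int[S]_s (Num.min d ta * \1_A s) <= \int[S]_s (clp (d + b * s) + clp (d - b * s)))%R.
  apply: le_Rintegral => //.
  - apply: (@bounded_integrable_prob R _ _ S _ (Num.min d ta)).
      by apply: measurable_funM => //; exact: measurable_indic.
    move=> s; rewrite normrM ger0_norm// ler_piMr// indicE.
    by case: (_ \in _); rewrite ?normr1 ?normr0.
  - exact: (integrableD measurableT i1 i2).
  - move=> s _; have := clip_two_signs alpha_gt0 n_gt0 (b * s) d0; apply: le_trans.
    rewrite indicE; case: ifPn => [sA|sA].
      by rewrite mem_set ?mulr1.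
    by rewrite memNset ?mulr0//; apply/negP.
rewrite RintegralD// E2.
have -> : (\int[S]_s (Num.min d ta * \1_A s) = Num.min d ta * fine (S A))%R.
  rewrite RintegralZl//; last exact: integrable_indic.
  by congr (_ * _)%R; rewrite /Rintegral integral_indic// setIT.
have : (q <= fine (S A))%R.
  rewrite -lee_fin fineK//; exact: fin_num_measure.
move=> /(ler_wpM2l m0); lra.
Qed.

(** Symmetrisation: averaging the two signs of the noise gives at least half of
    min (|d|, tau) when the noise is at most tau / 2, and never the wrong sign. *)
Lemma clip_mean d :
  (q / 2 * (`|d| * Num.min `|d| ta) <= \int[S]_s (d * clp (d + b * s)))%R.
Proof.
have bnd x : (`|clp x| <= ta)%R by exact: norm_clip.
have i1 d' := bounded_integrable_prob S (measurable_clip_affine d') (fun s => bnd _).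
rewrite RintegralZl//.
have [d0|d0] := leP 0%R d.
  by rewrite ger0_norm// mulrCA ler_wpM2l// clip_mean_ge0.
rewrite ltr0_norm//.
have -> : (\int[S]_s clp (d + b * s) = - \int[S]_s clp (- d + b * s))%R.
  rewrite -(Rintegral_symmetric S_sym (measurable_clip_affine d)).
  rewrite -mulN1r -RintegralZl//; apply: eq_Rintegral => s _.
  by rewrite mulN1r -clipN//; congr (clip _ _ _); ring.
by rewrite mulrN -mulNr mulrCA ler_wpM2l ?clip_mean_ge0 ?oppr_ge0 ?ltW.
Qed.

End clip_mean.

(** * A strong signal survives the noise of the first stage *)

Section lower_deviation.
Local Open Scope ereal_scope.
Context {R : realType}.

Section constants.
Variables (q gamma y : R).
(** A cell is large when its discrepancy exceeds [large_ratio] * tau. The number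
    80 makes the failure probability on large cells at most gamma / 12. *)
Definition large_ratio : R := (1 + 80 / gamma)%R.
(** The weight for which the Young penalty costs at most a quarter of
    q / 2 * |delta| min (|delta|, tau), the mean guaranteed by a cell that is not
    large. *)
Definition young_weight : R := (q / 2 / (4 * large_ratio))%R.
(** The allowance, in units of tau^2, for the noise on the cells that are not
    large: it makes each of its two failure probabilities at most gamma / 12. *)
Definition noise_level : R := (6 * large_ratio / (q / 2 * gamma))%R.
(** In units of tau^2: 1 for the loss on the large cells, one noise level for the
    deviation of the Laplace part, two for the frequency noise, and y for the level
    to be reached; a part q / 8 of the signal is left to pay for them. *)
Definition signal_threshold : R :=
  (8 / q * (1 + noise_level + 2 * noise_level + y))%R.
End constants.

Variables (alpha : R) (n N : nat).
Hypotheses (alpha_gt0 : (0 < alpha)%R) (n_gt0 : (0 < n)%N).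
Local Notation ta := (tau alpha n).
Local Notation clp := (clip alpha n).

Variables (C : probability (N.-tuple R) R) (S : probability R R).
Variables (b q gamma y : R) (p delta : 'I_N -> R) (B : 'I_N -> N.-tuple R -> R).
Hypotheses (q01 : (0 < q <= 1)%R) (gamma01 : (0 < gamma < 1)%R)
  (p_ge0 : forall j, (0 <= p j)%R) (p_le1 : (\sum_j p j <= 1)%R)
  (mB : forall j, measurable_fun setT (B j))
  (B2 : forall j, \int[C]_c (B j c ^+ 2)%:E <= (p j * ta ^+ 2)%:E)
  (S_sym : symmetric_law S)
  (S2 : \int[S]_s ((b * s) ^+ 2)%:E <= (64 * ta ^+ 2)%:E)
  (S_near0 : q%:E <= S [set s | (`|b * s| <= ta / 2)%R]).

Let K := large_ratio gamma.
Let e := young_weight q gamma.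
Let sl := noise_level q gamma.
Let c0 := (q / 2)%R.

Let t0 : (0 < ta)%R. Proof. exact: tau_gt0. Qed.
Let q0 : (0 < q)%R. Proof. by case/andP: q01. Qed.
Let q1 : (q <= 1)%R. Proof. by case/andP: q01. Qed.
Let g0 : (0 < gamma)%R. Proof. by case/andP: gamma01. Qed.
Let g1 : (gamma < 1)%R. Proof. by case/andP: gamma01. Qed.
Let c00 : (0 < c0)%R. Proof. by rewrite divr_gt0. Qed.
Let K1 : (80 < K - 1)%R.
Proof. by rewrite /K /large_ratio addrC addKr ltr_pdivlMr// gtr_pMr. Qed.
Let K0 : (0 < K)%R. Proof. by have := K1; lra. Qed.
Let e0 : (0 < e)%R. Proof. by rewrite divr_gt0// mulr_gt0. Qed.
Let sl0 : (0 < sl)%R. Proof. by rewrite divr_gt0 ?mulr_gt0. Qed.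

(** [sig j] is the strength of the signal of a cell, [D] the total strength,
    divided into [Dl] from the large cells and [Ds] from the others. *)
Let sig j : R := (`|delta j| * Num.min `|delta j| ta)%R.
Let big j : bool := (K * ta < `|delta j|)%R.
Let D := (\sum_j sig j)%R.
Let Dl := (\sum_(j | big j) sig j)%R.
Let Ds := (\sum_(j | ~~ big j) sig j)%R.

Let sig_ge0 j : (0 <= sig j)%R.
Proof. by rewrite mulr_ge0// le_min normr_ge0 ltW. Qed.

Let sig_big j : big j -> sig j = (ta * `|delta j|)%R.
Proof.
move=> bj; rewrite /sig mulrC; congr (_ * _)%R; apply/min_idPr.
apply: le_trans (ltW bj); rewrite ler_peMl ?(ltW t0)//.
by have := K1; lra.
Qed.

Let sqr_small j : ~~ big j -> (delta j ^+ 2 <= K * sig j)%R.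
Proof.
rewrite -leNgt => dK; rewrite -(real_normK (num_real (delta j))) /sig.
rewrite expr2 mulrCA ler_wpM2l//.
have [dt|dt] := leP `|delta j|%R ta; last by [].
by rewrite ler_peMl//; have := K1; lra.
Qed.

Let DE : D = (Dl + Ds)%R.
Proof. by rewrite /D (bigID big). Qed.

Let Dl0 : (0 <= Dl)%R. Proof. exact: sumr_ge0. Qed.
Let Ds0 : (0 <= Ds)%R. Proof. exact: sumr_ge0. Qed.

(** [u j] is the clipped signal of a cell that is not large under Laplace noise
    alone, and [V] the centred sum of these independent terms. *)
Let u j (s : R) : R := (if big j then 0 else delta j * clp (delta j + b * s))%R.
Let V (s : N.-tuple R) : R := (\sum_j (u j (tnth s j) - \int[S]_x u j x))%R.

Let mu j : measurable_fun setT (u j).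
Proof.
rewrite /u; case: (big j) => //; apply: measurable_funM => //.
exact: measurable_clip_affine.
Qed.

Let u_mean j : ~~ big j -> (c0 * sig j <= \int[S]_x u j x)%R.
Proof. by move=> /negbTE bj; rewrite /u bj; apply: clip_mean. Qed.

Let u2 j : \int[S]_x (u j x ^+ 2)%:E <=
  (if big j then 0 else K * sig j * ta ^+ 2)%:E.
Proof.
rewrite -[leRHS](integral_cst_prob S); apply: ge0_le_integral => //.
- by move=> x _; rewrite lee_fin sqr_ge0.
- by apply/measurable_EFinP; exact: measurable_funX.
- move=> x _; rewrite lee_fin /u; case: ifPn => [_|bj]; first by rewrite expr0n.
  rewrite exprMn; apply: ler_pM; rewrite ?sqr_ge0 ?sqr_small//.
  rewrite -(real_normK (num_real (clp _))) lerXn2r ?nnegrE ?(ltW t0)//.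
  exact: norm_clip.
Qed.

Let V2 : \int[iid_prob S N]_s (V s ^+ 2)%:E <= (K * ta ^+ 2 * Ds)%:E.
Proof.
have := iid_second_moment (P := S) (u := u) 0%R mu u2.
under eq_integral do rewrite add0r.
move=> /le_trans; apply; rewrite lee_fin expr0n add0r /Ds [leRHS]mulr_sumr [leRHS]big_mkcond.
by apply: ler_sum => j _; case: (big j) => //=; rewrite mulrAC.
Qed.

(** Three things can make the statistic small: noise of the size of the signal on
    the large cells (weights [a j]), frequency noise on the other cells (the
    weight added in [A j]), and a deviation of [V] below - [dv]. [PsiC] and [PsiS]
    gather the corresponding squares, divided by what each may cost. *)
Let a j : R := (if big j then 4 * sig j / ((K - 1) * ta) ^+ 2 / (Dl / 2 + ta ^+ 2) else 0)%R.
Let A j : R := (a j + (4 * e * (2 * sl * ta ^+ 2))^-1)%R.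
Let dv := (c0 * Ds / 2 + sl * ta ^+ 2)%R.

Let t20 : (0 < ta ^+ 2)%R. Proof. exact: exprn_gt0. Qed.
Let dl0 : (0 < Dl / 2 + ta ^+ 2)%R. Proof. by have := Dl0; have := t20; lra. Qed.
Let dv0 : (0 < dv)%R.
Proof.
rewrite /dv; apply: ltr_wpDl; last exact: mulr_gt0.
by apply: divr_ge0 => //; apply: mulr_ge0 => //; exact: ltW.
Qed.
Let a_ge0 j : (0 <= a j)%R.
Proof.
rewrite /a; case: ifP => // _.
apply: divr_ge0; last exact: ltW.
by apply: divr_ge0; rewrite ?sqr_ge0// mulr_ge0.
Qed.
Let w0 : (0 < 4 * e * (2 * sl * ta ^+ 2))%R. Proof. by apply: mulr_gt0; apply: mulr_gt0 => //; exact: mulr_gt0. Qed.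
Let A_ge0 j : (0 <= A j)%R.
Proof. by rewrite addr_ge0// invr_ge0 ltW. Qed.

Let PsiC (c : N.-tuple R) : R := (\sum_j A j * B j c ^+ 2)%R.
Let PsiS (s : N.-tuple R) : R :=
  (\sum_j a j * (b * tnth s j) ^+ 2 + (V s / dv) ^+ 2)%R.

Let F c s : R := (\sum_j delta j * clp (delta j + (B j c + b * tnth s j)))%R.

(** If the weights sum to less than 1 then none of the three losses exceeds its
    allowance, and what remains of the signal is above the level. *)
Let F_bad c s : (signal_threshold q gamma y * ta ^+ 2 <= D)%R ->
  (F c s < y * ta ^+ 2)%R -> (1 <= PsiC c + PsiS s)%R.
Proof.
move=> DM Fy; rewrite leNgt; apply/negP => Psi1.
pose Rl := (\sum_(j | big j) sig j * (4 * (B j c ^+ 2 + (b * tnth s j) ^+ 2) / ((K - 1) * ta) ^+ 2))%R.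
pose Rb := (\sum_(j | ~~ big j) B j c ^+ 2 / (4 * e))%R.
have PsiE : (Rl / (Dl / 2 + ta ^+ 2) + Rb / (2 * sl * ta ^+ 2) + (V s / dv) ^+ 2
    <= PsiC c + PsiS s)%R.
  rewrite /PsiC /PsiS addrA lerD2r -big_split /= [leRHS](bigID big)/=.
  rewrite /Rl /Rb; apply: lerD; rewrite [leLHS]mulr_suml; apply: ler_sum => j bj; rewrite /A /a.
    rewrite bj (mulrDl (4 * sig j / ((K - 1) * ta) ^+ 2 / (Dl / 2 + ta ^+ 2)))%R.
    have wx : (0 <= (4 * e * (2 * sl * ta ^+ 2))^-1 * B j c ^+ 2)%R.
      by rewrite mulr_ge0 ?sqr_ge0// invr_ge0 ltW.
    have -> : (sig j * (4 * (B j c ^+ 2 + (b * tnth s j) ^+ 2) / ((K - 1) * ta) ^+ 2) /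
      (Dl / 2 + ta ^+ 2) = 4 * sig j / ((K - 1) * ta) ^+ 2 / (Dl / 2 + ta ^+ 2) * B j c ^+ 2 +
      4 * sig j / ((K - 1) * ta) ^+ 2 / (Dl / 2 + ta ^+ 2) * (b * tnth s j) ^+ 2)%R by ring.
    by rewrite lerD2r lerDl.
  rewrite (negbTE bj) add0r mul0r addr0 le_eqVlt.
  by apply/orP; left; apply/eqP; field; rewrite !gt_eqF.
have Rl0 : (0 <= Rl)%R.
  apply: sumr_ge0 => j _; rewrite mulr_ge0// divr_ge0 ?sqr_ge0//.
  by rewrite mulr_ge0// addr_ge0 ?sqr_ge0.
have Rb0 : (0 <= Rb)%R.
  by apply: sumr_ge0 => j _; rewrite divr_ge0 ?sqr_ge0// mulr_ge0// ltW.
have st0 : (0 < 2 * sl * ta ^+ 2)%R by apply: mulr_gt0 => //; exact: mulr_gt0.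
have x1 : (0 <= Rl / (Dl / 2 + ta ^+ 2))%R by rewrite divr_ge0// ltW.
have x2 : (0 <= Rb / (2 * sl * ta ^+ 2))%R by rewrite divr_ge0// ltW.
have x3 : (0 <= (V s / dv) ^+ 2)%R by exact: sqr_ge0.
have Rl1 : (Rl < Dl / 2 + ta ^+ 2)%R.
  by rewrite -[ltRHS]mul1r -ltr_pdivrMr//; lra.
have Rb1 : (Rb < 2 * sl * ta ^+ 2)%R.
  by rewrite -[ltRHS]mul1r -ltr_pdivrMr//; lra.
have V1 : (- dv < V s)%R.
  have : (`|V s / dv| < 1)%R.
    rewrite -(@ltr_pXn2r _ 2)// ?nnegrE// expr1n real_normK ?num_real//; lra.
  rewrite normrM normfV (gtr0_norm dv0) ltr_pdivrMr// mul1r ltr_norml.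
  by case/andP.
have Fbig : (Dl - Rl <= \sum_(j | big j) delta j * clp (delta j + (B j c + b * tnth s j)))%R.
  rewrite /Dl /Rl -sumrB; apply: ler_sum => j bj.
  have h1 : (1 < K)%R by have := K1; lra.
  have := clip_large alpha_gt0 n_gt0 (B j c + b * tnth s j) h1 bj.
  apply: le_trans; rewrite (sig_big bj) mulrBr mulr1 lerD2l lerN2 ler_wpM2l ?mulr_ge0 ?(ltW t0)//.
  rewrite ler_wpM2r ?invr_ge0 ?sqr_ge0//.
  by have := sqr_ge0 (B j c - b * tnth s j); rewrite !expr2; nra.
have Fsmall : (\sum_(j | ~~ big j) (u j (tnth s j) - e * K * sig j) - Rb <=
    \sum_(j | ~~ big j) delta j * clp (delta j + (B j c + b * tnth s j)))%R.
  rewrite /Rb -sumrB; apply: ler_sum => j bj.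
  have := clip_small alpha_gt0 n_gt0 (delta j) (B j c) (b * tnth s j) e0.
  apply: le_trans; rewrite /u (negbTE bj).
  have := ler_wpM2l (ltW e0) (sqr_small bj); rewrite mulrA; lra.
have VE : (V s = \sum_(j | ~~ big j) (u j (tnth s j) - \int[S]_x u j x))%R.
  rewrite /V (bigID big)/= big1 ?add0r// => j bj.
  by rewrite /u bj sub0r /Rintegral integral0 oppr0.
have Vle : (V s + c0 * Ds - e * K * Ds <=
    \sum_(j | ~~ big j) (u j (tnth s j) - e * K * sig j))%R.
  rewrite VE /Ds !mulr_sumr -big_split -sumrB /=; apply: ler_sum => j bj.
  by have := u_mean bj; lra.
have eK : (e * K = c0 / 4)%R.
  rewrite /e /young_weight -/K -/c0; field.
  by rewrite gt_eqF.
have : (c0 / 4 * D >= (1 + sl + 2 * sl + y) * ta ^+ 2)%R.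
  apply: le_trans (ler_wpM2l _ DM); last by rewrite divr_ge0// ltW.
  rewrite /signal_threshold -/sl /c0 le_eqVlt; apply/orP; left; apply/eqP; field.
  by rewrite gt_eqF.
have c04 : (c0 / 4 * Dl <= Dl / 2)%R.
  by rewrite [leRHS]mulrC ler_wpM2r// /c0; have := q1; lra.
rewrite DE.
have FE : F c s = (\sum_(j | big j) delta j * clp (delta j + (B j c + b * tnth s j)) +
   \sum_(j | ~~ big j) delta j * clp (delta j + (B j c + b * tnth s j)))%R.
  by rewrite /F (bigID big).
move: Fy Fbig Fsmall Vle V1 Rb1 Rl1; rewrite FE eK /dv => *; lra.
Qed.

Let mPsiC : measurable_fun setT PsiC.
Proof.
apply: measurable_sum => j; apply: measurable_funM => //.
exact: measurable_funX.
Qed.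

Let mb j : measurable_fun setT (fun s : N.-tuple R => (b * tnth s j) ^+ 2)%R.
Proof.
by apply: measurable_funX; apply: measurable_funM => //; exact: measurable_tnth.
Qed.

Let mV : measurable_fun setT V.
Proof.
apply: measurable_sum => j; apply: measurable_funB => //.
exact: (measurableT_comp (mu j) (measurable_tnth j)).
Qed.

Let PsiC_le : \int[C]_c (PsiC c)%:E <= (\sum_j A j * (p j * ta ^+ 2))%:E.
Proof.
under eq_integral do rewrite /PsiC -sumEFin.
have mB2 j : measurable_fun setT (fun c => (B j c ^+ 2)%:E).
  by apply/measurable_EFinP; exact: measurable_funX.
rewrite ge0_integral_sum//; last 2 first.
- by move=> j; apply/measurable_EFinP; apply: measurable_funM => //; exact: measurable_funX.
- by move=> j c _; rewrite lee_fin mulr_ge0// sqr_ge0.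
rewrite -sumEFin; apply: lee_sum => j _.
under eq_integral do rewrite EFinM.
have A0 : 0 <= (A j)%:E by rewrite lee_fin.
rewrite ge0_integralZl//; last by move=> c _; rewrite lee_fin sqr_ge0.
by rewrite [leRHS]EFinM; apply: lee_wpmul2l.
Qed.

Let PsiS_le : \int[iid_prob S N]_s (PsiS s)%:E <=
  (\sum_j a j * (64 * ta ^+ 2) + K * ta ^+ 2 * Ds / dv ^+ 2)%:E.
Proof.
have mab j : measurable_fun setT (fun s : N.-tuple R => (a j * (b * tnth s j) ^+ 2)%:E).
  by apply/measurable_EFinP; exact: measurable_funM.
have mVd : measurable_fun setT (fun s : N.-tuple R => ((V s / dv) ^+ 2)%:E).
  by apply/measurable_EFinP; apply: measurable_funX; exact: measurable_funM.
have ab0 j s : 0 <= (a j * (b * tnth s j) ^+ 2)%:E.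
  by rewrite lee_fin mulr_ge0// sqr_ge0.
under eq_integral do rewrite /PsiS EFinD -sumEFin.
rewrite ge0_integralD//; last 3 first.
- by move=> s _; apply: sume_ge0.
- exact: emeasurable_sum.
- by move=> s _; rewrite lee_fin sqr_ge0.
rewrite [leRHS]EFinD; apply: leeD.
  rewrite ge0_integral_sum// -sumEFin; apply: lee_sum => j _.
  under eq_integral do rewrite EFinM.
  have mb2 : measurable_fun setT (fun s : R => ((b * s) ^+ 2)%:E).
    by apply/measurable_EFinP; apply: measurable_funX; exact: measurable_funM.
  have a0 : 0 <= (a j)%:E by rewrite lee_fin.
  rewrite ge0_integralZl//; last 2 first.
  - by apply/measurable_EFinP; exact: mb.
  - by move=> s _; rewrite lee_fin sqr_ge0.
  rewrite [leRHS]EFinM; apply: lee_wpmul2l => //.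
  rewrite (integral_iid_tnth S j mb2)//.
  by move=> s; rewrite lee_fin sqr_ge0.
under eq_integral do rewrite mulrC exprMn EFinM exprVn.
have d0 : 0 <= (dv ^- 2)%:E by rewrite lee_fin invr_ge0 sqr_ge0.
have mV2 : measurable_fun setT (fun s : N.-tuple R => (V s ^+ 2)%:E).
  by apply/measurable_EFinP; exact: measurable_funX.
rewrite ge0_integralZl//; last by move=> s _; rewrite lee_fin sqr_ge0.
by rewrite mulrC EFinM; apply: lee_wpmul2l.
Qed.

Let p1 j : (p j <= 1)%R.
Proof.
apply: le_trans p_le1; rewrite (bigD1 j)//= lerDl; exact: sumr_ge0.
Qed.

(** A third of gamma / 4 for each failure. In the first, 65 = 1 + 64 adds the
    variance factors of the frequencies and of the Laplace sums; in the third,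
    dv^2 >= 2 (q / 2) Ds sl tau^2 since (x + y)^2 >= 4 x y. *)
Let total_le : (\sum_j A j * (p j * ta ^+ 2) +
  (\sum_j a j * (64 * ta ^+ 2) + K * ta ^+ 2 * Ds / dv ^+ 2) <= gamma / 4)%R.
Proof.
have h1 : (65 * ta ^+ 2 * \sum_j a j <= gamma / 12)%R.
  have -> : (\sum_j a j = 4 / ((K - 1) * ta) ^+ 2 / (Dl / 2 + ta ^+ 2) * Dl)%R.
    have -> : Dl = (\sum_j if big j then sig j else 0)%R by rewrite /Dl big_mkcond.
    rewrite [RHS]mulr_sumr; apply: eq_bigr => j _; rewrite /a /Dl big_mkcond.
    by case: (big j); rewrite ?mulr0//; ring.
  have k1 : (0 < K - 1)%R by have := K1; lra.
  rewrite (_ : 65 * ta ^+ 2 * _ = 65 * 4 / (K - 1) ^+ 2 * (Dl / (Dl / 2 + ta ^+ 2)))%R; last first.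
    by field; rewrite !gt_eqF//; have := dl0; lra.
  apply: (@le_trans _ _ (65 * 4 / (K - 1) ^+ 2 * 2)%R).
    rewrite ler_wpM2l ?divr_ge0 ?sqr_ge0 ?mulr_ge0//.
    by rewrite ler_pdivrMr//; have := t20; lra.
  rewrite mulrAC ler_pdivrMr ?exprn_gt0//.
  have -> : (gamma / 12 * (K - 1) ^+ 2 = 80 ^+ 2 / 12 / gamma)%R.
    by rewrite /K /large_ratio; field; rewrite gt_eqF.
  rewrite ler_pdivlMr//; have := g1; lra.
have h2 : (ta ^+ 2 / (4 * e * (2 * sl * ta ^+ 2)) <= gamma / 12)%R.
  rewrite le_eqVlt; apply/orP; left; apply/eqP.
  rewrite /e /sl /young_weight /noise_level -/K; field.
  by rewrite !gt_eqF.
have h3 : (K * ta ^+ 2 * Ds / dv ^+ 2 <= gamma / 12)%R.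
  have -> : (gamma / 12 = K / (2 * c0 * sl))%R.
    rewrite /sl /noise_level -/K -/c0; field.
    by rewrite !gt_eqF.
  rewrite ler_pdivrMr ?exprn_gt0// [leRHS]mulrAC ler_pdivlMr; last first.
    by apply: mulr_gt0 => //; exact: mulr_gt0.
  rewrite [leLHS](_ : _ = K * (2 * c0 * sl * Ds * ta ^+ 2))%R; last by ring.
  rewrite ler_pM2l// /dv.
  have := sqr_ge0 (c0 * Ds / 2 - sl * ta ^+ 2); rewrite !expr2; lra.
have h4 : (\sum_j A j * (p j * ta ^+ 2) <=
    ta ^+ 2 * \sum_j a j + ta ^+ 2 / (4 * e * (2 * sl * ta ^+ 2)))%R.
  under eq_bigr do rewrite /A mulrDl.
  rewrite big_split /=; apply: lerD.
    rewrite mulr_sumr; apply: ler_sum => j _; rewrite mulrCA mulrA.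
    by rewrite mulrC ler_wpM2l ?(ltW t20)// ler_piMl.
  rewrite -mulr_sumr -mulr_suml mulrC ler_wpM2r ?invr_ge0 ?(ltW w0)//.
  by rewrite ler_piMl ?(ltW t20).
have h5 : (\sum_j a j * (64 * ta ^+ 2) = 64 * ta ^+ 2 * \sum_j a j)%R.
  by rewrite -mulr_suml mulrC.
rewrite h5; lra.
Qed.

(** Markov's inequality for the sum of the weights. *)
Lemma signal_survives : (signal_threshold q gamma y * ta ^+ 2 <= D)%R ->
  \int[C]_c \int[iid_prob S N]_s ((F c s < y * ta ^+ 2)%R%:R)%:E <= (gamma / 4)%:E.
Proof.
move=> DM.
have PsiC0 c : (0 <= PsiC c)%R by apply: sumr_ge0 => j _; rewrite mulr_ge0// sqr_ge0.
have PsiS0 s : (0 <= PsiS s)%R.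
  by rewrite addr_ge0 ?sqr_ge0//; apply: sumr_ge0 => j _; rewrite mulr_ge0// sqr_ge0.
have mPsiS : measurable_fun setT PsiS.
  apply: measurable_funD; last by apply: measurable_funX; exact: measurable_funM.
  by apply: measurable_sum => j; exact: measurable_funM.
have mF2 : measurable_fun setT (fun v : N.-tuple R * N.-tuple R => F v.1 v.2).
  apply: measurable_sum => j; apply: measurable_funM => //.
  apply: (measurableT_comp (measurable_clip alpha n)).
  apply: measurable_funD => //; apply: measurable_funD.
    exact: (measurableT_comp (mB j) measurable_fst).
  apply: measurable_funM => //.
  exact: (measurableT_comp (measurable_tnth j) measurable_snd).
have mF3 : measurable_fun setT (fun v : N.-tuple R * N.-tuple R =>
    ((F v.1 v.2 < y * ta ^+ 2)%R%:R)%:E : \bar R).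
  apply/measurable_EFinP.
  apply: (@measurableT_comp _ _ _ _ _ _ (fun b : bool => b%:R : R)) => //.
  exact: measurable_fun_ltr.
apply: (@le_trans _ _ (\int[C]_c ((PsiC c)%:E + \int[iid_prob S N]_s (PsiS s)%:E))).
  apply: ge0_le_integral => //.
  - by move=> c _; apply: integral_ge0.
  - exact: (@measurable_fun_integral_snd _ _ _ _ _ (iid_prob S N)
      (fun c s => ((F c s < y * ta ^+ 2)%R%:R)%:E)).
  - by apply: emeasurable_funD => //; exact/measurable_EFinP.
  move=> c _; have PCc : 0 <= (PsiC c)%:E by rewrite lee_fin.
  rewrite -[X in X + _](integral_cst_prob (iid_prob S N)).
  rewrite -ge0_integralD//; last 2 first.
  - by move=> s _; rewrite lee_fin.
  - exact/measurable_EFinP.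
  apply: ge0_le_integral => //.
  - exact: (measurableT_comp mF3 (pair1_measurable c)).
  - by apply: emeasurable_funD => //; exact/measurable_EFinP.
  move=> s _; rewrite -EFinD lee_fin; case: ltP => [Fy|_] /=.
    exact: F_bad.
  by rewrite addr_ge0.
have PC0 c : setT c -> 0 <= (PsiC c)%:E by rewrite lee_fin.
have mPC : measurable_fun setT (fun c => (PsiC c)%:E) by exact/measurable_EFinP.
have PS0 (c : N.-tuple R) : setT c -> 0 <= \int[iid_prob S N]_s (PsiS s)%:E.
  by move=> _; apply: integral_ge0 => s _; rewrite lee_fin.
rewrite (ge0_integralD C measurableT PC0 mPC PS0 (measurable_cst _)).
rewrite integral_cst_prob.
apply: le_trans (leeD PsiC_le PsiS_le) _.
by rewrite -EFinD lee_fin total_le.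
Qed.

End lower_deviation.

(** * L1 distance and cell discrepancies *)

Section bias.
Local Open Scope ereal_scope.
Context {R : realType}.
Local Notation mu := (@lebesgue_measure R).

(** The interval contains the segment between its points. *)
Lemma itv_diameter (i : interval R) (l : R) (x y : R) :
  mu [set` i] = l%:E -> [set` i] x -> [set` i] y -> (`|x - y| <= l)%R.
Proof.
move=> il.
wlog xy : x y / (x <= y)%R.
  by move=> wl ix iy; have [xy|/ltW xy] := leP x y; [|rewrite distrC]; exact: wl.
move=> ix iy; rewrite distrC ger0_norm ?subr_ge0//.
rewrite -lee_fin -il.
have -> : (y - x)%:E = mu `[x, y]%classic.
  rewrite lebesgue_measure_itv/= lte_fin; case: ltP => // yx.
  by rewrite (le_anti (introT andP (conj xy yx))) subrr.
apply: le_measure; rewrite ?inE//.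
move=> z /=; rewrite in_itv/= => /andP[xz zy].
by apply: (@interval_is_interval _ i x y) => //; rewrite xz zy.
Qed.

Lemma measure_bigcup_ord d (T : measurableType d) (m : {measure set T -> \bar R})
    n (F : 'I_n -> set T) :
  (forall j, measurable (F j)) -> trivIset setT F ->
  m (\bigcup_j F j) = \sum_(j < n) m (F j).
Proof.
move=> mF tF; rewrite -measure_bigsetU_ord//.
by congr (m _); rewrite -bigcup_seq; apply: eq_bigcupl; split => j //= _;
  rewrite mem_index_enum.
Qed.

Section densities.
Variables (X : set R) (f : R -> R) (mX : measurable X) (df : density X f).

Lemma density_integrable (A : set R) : measurable A -> A `<=` X ->
  mu.-integrable A (EFin \o f).
Proof.
case: df => mf f0 f1 mA AX; apply: (@integrableS _ _ R mu X A (EFin \o f)) => //.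
apply/integrableP; split; first exact/measurable_EFinP.
rewrite (_ : \int[mu]_(x in X) _ = 1) ?ltry//.
rewrite -f1; apply: eq_integral => x; rewrite inE => Xx /=.
by rewrite ger0_norm// f0.
Qed.

Lemma data_probE (A : set R) : measurable A ->
  (\int[data_prob mX df]_x \1_A x = \int[mu]_(x in X `&` A) f x)%R.
Proof. by move=> mA; rewrite /Rintegral integral_indic// setIT. Qed.

End densities.

Variables (N : nat) (J : 'I_N -> interval R).
Hypotheses (tJ : trivIset setT (cell J)).

Section one_density.
Variables (X : set R) (f : R -> R) (mX : measurable X) (df : density X f).

Lemma cell_prob_ge0 j : (0 <= cell_prob J mX df j)%R.
Proof. by apply: Rintegral_ge0 => x _. Qed.

Lemma sum_cell_prob_le1 : (\sum_j cell_prob J mX df j <= 1)%R.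
Proof.
rewrite -lee_fin -sumEFin.
rewrite (eq_bigr (fun j => data_prob mX df (cell J j))) => [|j _]; last first.
  rewrite /cell_prob /Rintegral integral_indic ?setIT//; last exact: measurable_cell.
  by rewrite fineK// fin_num_measure//; exact: measurable_cell.
rewrite -measure_bigcup_ord//; last by move=> j; exact: measurable_cell.
by rewrite probability_le1//; exact: measurable_cells.
Qed.

Lemma cell_probE j : cell J j `<=` X ->
  cell_prob J mX df j = p0 f J j.
Proof.
move=> jX; rewrite /cell_prob data_probE; last exact: measurable_cell.
by rewrite setIC setIidl.
Qed.

Lemma outside_probE :
  outside_prob J mX df = (\int[mu]_(x in X `\` cells J) f x)%R.
Proof.
rewrite /outside_prob data_probE// ?setDE//.
by apply: measurableC; exact: measurable_cells.
Qed.

End one_density.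

Variables (X : set R) (f f0 : R -> R) (mX : measurable X) (df : density X f)
  (df0 : density X f0) (beta L L0 h : R).
Hypotheses (beta0 : (0 < beta)%R) (h0 : (0 < h)%R)
  (hf : holder X beta L f) (hf0 : holder X beta L0 f0) (L_ge0 : (0 <= L + L0)%R)
  (cellX : forall j, cell J j `<=` X)
  (cell_len : forall j, mu (cell J j) = (2 * h)%:E).

Local Notation delta j := (cell_prob J mX df j - p0 f0 J j)%R.
Let osc := ((L + L0) * (2 * h) `^ beta)%R.

(** On a cell, f - f0 differs from its average by at most its oscillation. *)
Let cell_pointwise j x : cell J j x ->
  (`|f x - f0 x| <= `|delta j| / (2 * h) + osc)%R.
Proof.
move=> jx.
have mj : @measurable _ (measurableTypeR R) (cell J j) := measurable_cell J j.
pose g x := (f x - f0 x)%R.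
have if1 := density_integrable mX df (measurable_cell J j) (@cellX j).
have if0 := density_integrable mX df0 (measurable_cell J j) (@cellX j).
have ig : mu.-integrable (cell J j) (EFin \o g) := integrableB mj if1 if0.
have ic c : mu.-integrable (cell J j) (EFin \o (fun=> c : R)).
  apply/integrableP; split; first exact: measurable_cst.
  rewrite (_ : \int[mu]_(x in cell J j) _ = `|c|%:E * (2 * h)%:E) ?ltry//.
  rewrite (integral_cst mu mj `|c|%:E); congr (_ * _); exact: cell_len.
have deltaE : delta j = (\int[mu]_(y in cell J j) g y)%R.
  by rewrite cell_probE// /p0 RintegralB.
have gosc y : cell J j y -> (`|g x - g y| <= osc)%R.
  move=> jy; have xy := itv_diameter (cell_len j) jx jy.
  have Xx := cellX jx; have Xy := cellX jy.
  have p1 : (`|x - y| `^ beta <= (2 * h) `^ beta)%R.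
    by apply: ge0_ler_powR; rewrite ?nnegrE ?(ltW beta0) ?mulr_ge0 ?(ltW h0).
  have := hf.2 _ _ Xx Xy; have := hf0.2 _ _ Xx Xy.
  have := ler_normB (f x - f y)%R (f0 x - f0 y)%R.
  rewrite (_ : f x - f y - (f0 x - f0 y) = g x - g y)%R; last by rewrite /g; ring.
  move=> h1 h2 h3; apply: (le_trans h1).
  apply: (@le_trans _ _ ((L + L0) * `|x - y| `^ beta)%R); first by lra.
  exact: ler_wpM2l.
have h20 : (0 < 2 * h)%R by rewrite mulr_gt0.
have len_fin : fine (mu (cell J j)) = (2 * h)%R by rewrite cell_len.
have E1 : (2 * h * g x - delta j = \int[mu]_(y in cell J j) (g x - g y))%R.
  rewrite RintegralB// -deltaE; congr (_ - _)%R.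
  by rewrite Rintegral_cst// len_fin mulrC.
have : (`|2 * h * g x - delta j| <= osc * (2 * h))%R.
  rewrite E1; have igg : mu.-integrable (cell J j) (EFin \o (fun y => g x - g y)%R).
    exact: (integrableB mj (ic _) ig).
  apply: (le_trans (le_normr_Rintegral mj igg)).
  rewrite -len_fin -Rintegral_cst//; apply: le_Rintegral => //.
  exact: integrable_norm.
move=> h1.
have : (2 * h * `|g x| <= `|delta j| + osc * (2 * h))%R.
  rewrite -[X in (X * _)%R](gtr0_norm h20) -normrM.
  have := ler_normD (2 * h * g x - delta j)%R (delta j); rewrite subrK; lra.
by rewrite -/(g x) mulrC -ler_pdivlMr// mulrDl mulfK ?gt_eqF.
Qed.

Let nn_f x : X x -> (0 <= f x)%R. Proof. by case: df => _ + _; apply. Qed.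
Let nn_f0 x : X x -> (0 <= f0 x)%R. Proof. by case: df0 => _ + _; apply. Qed.

(** Inside the cells the pointwise bound is integrated; outside them f and f0 are
    compared only through their masses. *)
Lemma L1_dist_le :
  L1_dist X f f0 <= (\sum_j `|delta j| + N%:R * (2 * h) * osc +
    mean_T f0 J mX df + 2 * \int[mu]_(x in X `\` cells J) f0 x)%:E.
Proof.
have h20 : (0 < 2 * h)%R by rewrite mulr_gt0.
have osc0 : (0 <= osc)%R by rewrite mulr_ge0// powR_ge0.
have mO : measurable (X `\` cells J).
  by apply: measurableD => //; exact: measurable_cells.
have OX : X `\` cells J `<=` X by exact: subDsetl.
have mf : measurable_fun X f by case: df.
have mf0 : measurable_fun X f0 by case: df0.
have mgO : measurable_fun (X `\` cells J) (fun x => `|f x - f0 x|%:E).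
  apply/measurable_EFinP; apply: measurableT_comp => //.
  by apply: measurable_funB; [apply: measurable_funS mf|apply: measurable_funS mf0].
have mg : measurable_fun X (fun x => `|f x - f0 x|%:E).
  by apply/measurable_EFinP; apply: measurableT_comp => //; exact: measurable_funB.
have XU : X = (X `\` cells J) `|` cells J.
  rewrite setDE setUIl setUCl setIT; apply/seteqP; split => x; first by left.
  by case=> // -[j _ jx]; exact: cellX jx.
have mC := measurable_cells J.
have mgU : measurable_fun ((X `\` cells J) `|` cells J) (fun x => `|f x - f0 x|%:E).
  by rewrite -XU.
have dj : [disjoint X `\` cells J & cells J].
  by apply/disj_setPS => x [[_ nx] cx].
rewrite /L1_dist [in leLHS]XU ge0_integral_setU//.
have outside : \int[mu]_(x in X `\` cells J) `|f x - f0 x|%:E <=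
    (mean_T f0 J mX df + 2 * \int[mu]_(x in X `\` cells J) f0 x)%:E.
  have i1 := density_integrable mX df mO OX.
  have i0 := density_integrable mX df0 mO OX.
  have E (g : R -> R) : mu.-integrable (X `\` cells J) (EFin \o g) ->
      (\int[mu]_(x in X `\` cells J) g x)%:E = \int[mu]_(x in X `\` cells J) (g x)%:E.
    by move=> ig; rewrite /Rintegral fineK//; exact: integrable_fin_num.
  rewrite /mean_T outside_probE -addrA.
  (* |f - f0| <= f + f0, and the integral of f is that of f0 plus [mean_T]. *)
  rewrite (_ : - _ + 2 * _ = \int[mu]_(x in X `\` cells J) f0 x)%R; last by ring.
  rewrite EFinD !E// -ge0_integralD//; last 4 first.
  - by move=> x [Xx _]; rewrite lee_fin nn_f.
  - by apply/measurable_EFinP; apply: measurable_funS mf.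
  - by move=> x [Xx _]; rewrite lee_fin nn_f0.
  - by apply/measurable_EFinP; apply: measurable_funS mf0.
  apply: ge0_le_integral => //.
  - by apply: emeasurable_funD; apply/measurable_EFinP;
      [apply: measurable_funS mf|apply: measurable_funS mf0].
  - move=> x [Xx _]; rewrite -EFinD lee_fin.
    have := ler_normB (f x) (f0 x).
    by rewrite (ger0_norm (nn_f Xx)) (ger0_norm (nn_f0 Xx)).
have inside : \int[mu]_(x in cells J) `|f x - f0 x|%:E <=
    (\sum_j `|delta j| + N%:R * (2 * h) * osc)%:E.
  pose c j := (`|delta j| / (2 * h) + osc)%R.
  have c0 j : (0 <= c j)%R by rewrite addr_ge0// divr_ge0// ltW.
  have mterm j : measurable_fun (cells J) (fun x => (\1_(cell J j) x * c j)%:E).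
    apply/measurable_EFinP; apply: measurable_funM => //; apply: measurable_funTS.
    by apply: measurable_indic; exact: measurable_cell.
  apply: (@le_trans _ _ (\int[mu]_(x in cells J) (\sum_(j < N) (\1_(cell J j) x * c j)%:E))).
    apply: ge0_le_integral => //.
    - apply: measurable_funS mg => //.
      by rewrite XU; exact: subsetUr.
    - exact: emeasurable_sum.
    - move=> x cx; rewrite sumEFin lee_fin.
      have [[j xj ->]|[]//] := cell_case tJ x.
      exact: cell_pointwise.
  rewrite ge0_integral_sum//; last by move=> j x _; rewrite lee_fin mulr_ge0.
  have -> : (\sum_j `|delta j| + N%:R * (2 * h) * osc = \sum_(j < N) c j * (2 * h))%R.
    rewrite [RHS](eq_bigr (fun j => `|delta j| + 2 * h * osc)%R) => [|j _].
      rewrite big_split /= sumr_const card_ord -[in RHS](mulr_natl _ N).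
      by congr (_ + _)%R; ring.
    by rewrite /c mulrDl mulfVK ?gt_eqF// [in RHS]mulrC.
  rewrite -sumEFin; apply: lee_sum => j _.
  under eq_integral do rewrite mulrC EFinM.
  have cj0 : 0 <= (c j)%:E by rewrite lee_fin.
  rewrite ge0_integralZl//; last first.
    apply/measurable_EFinP; apply: measurable_funTS.
    by apply: measurable_indic; exact: measurable_cell.
  rewrite EFinM; apply: lee_wpmul2l => //.
  rewrite -(cell_len j) integral_indic//; last exact: measurable_cell.
  apply: le_measure; rewrite ?inE//; last exact: measurable_cell.
  by apply: measurableI => //; exact: measurable_cell.
apply: (le_trans (leeD outside inside)).
by rewrite -EFinD lee_fin; lra.
Qed.

Lemma volume_cells : fine (mu (cells J)) = (N%:R * (2 * h))%R.
Proof.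
rewrite /cells measure_bigcup_ord//; last by move=> j; exact: measurable_cell.
rewrite (eq_bigr _ (fun j _ => cell_len j)) sumEFin /= sumr_const card_ord.
by rewrite [RHS]mulr_natl.
Qed.

End bias.

(** * Bandwidth and rate *)

Section rates.
Context {R : realType}.

(** With r = sqrt N: a discrepancy d above t is (d t) / t; one below t
    satisfies d <= (r / (2 t)) d^2 + t / (2 r) by the inequality between arithmetic
    and geometric means, and the constants t / (2 r) sum to r t / 2 over the N
    cells. *)
Lemma l1_le_signal (N : nat) (delta : 'I_N -> R) (t M : R) : (0 < N)%N -> 0 < t ->
  \sum_j (`|delta j| * Num.min `|delta j| t) <= M * t ^+ 2 ->
  \sum_j `|delta j| <= M * t + (M + 1) / 2 * (Num.sqrt N%:R * t).
Proof.
move=> N0 t0; set r := Num.sqrt N%:R.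
have r0 : 0 < r by rewrite sqrtr_gt0 ltr0n.
have r2 : r ^+ 2 = N%:R by rewrite sqr_sqrtr.
set s := \sum_j _ => sM.
have term j : `|delta j| <=
    (t^-1 + r / (2 * t)) * (`|delta j| * Num.min `|delta j| t) + t / (2 * r).
  set d := `|delta j|; have d0 : 0 <= d by exact: normr_ge0.
  have tr0 : 0 <= t / (2 * r) by rewrite divr_ge0 ?mulr_ge0 ?ltW.
  have rt0 : 0 <= r / (2 * t) by rewrite divr_ge0 ?mulr_ge0 ?ltW.
  have [dt|td] := leP d t.
    have -> : (t^-1 + r / (2 * t)) * (d * d) + t / (2 * r) =
        d + t^-1 * (d * d) + (r * d - t) ^+ 2 / (2 * r * t).
      by field; rewrite !gt_eqF.
    have q0 : 0 <= (r * d - t) ^+ 2 / (2 * r * t).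
      apply: divr_ge0; first exact: sqr_ge0.
      by apply: mulr_ge0; [apply: mulr_ge0|]; rewrite ?ltW.
    have p0 : 0 <= t^-1 * (d * d).
      by apply: mulr_ge0; [rewrite invr_ge0 ltW|exact: mulr_ge0].
    by rewrite -addrA lerDl addr_ge0.
  rewrite mulrDl mulrCA mulVf ?gt_eqF// mulr1 -addrA lerDl.
  by apply: addr_ge0 => //; apply: mulr_ge0 => //; apply: mulr_ge0 => //; exact: ltW.
apply: (le_trans (ler_sum _ (fun j _ => term j))).
rewrite big_split /= -mulr_sumr -/s sumr_const card_ord.
have c0 : 0 <= t^-1 + r / (2 * t).
  by rewrite addr_ge0 ?invr_ge0 ?divr_ge0 ?mulr_ge0 ?ltW.
apply: (@le_trans _ _ ((t^-1 + r / (2 * t)) * (M * t ^+ 2) + N%:R * (t / (2 * r)))).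
  by rewrite -[X in _ + X <= _]mulr_natl lerD2r ler_wpM2l.
rewrite -r2 le_eqVlt; apply/orP; left; apply/eqP; field.
by rewrite !gt_eqF.
Qed.

Lemma powR_expR (x r : R) : 0 < x -> x `^ r = expR (r * ln x).
Proof. by move=> x0; rewrite /powR gt_eqF. Qed.

Section bandwidth.
Variables (v a beta : R).
Hypotheses (v0 : 0 < v) (a0 : 0 < a) (beta01 : 0 < beta < 1).
Definition bandwidth_of : R :=
  v `^ (- (1 / (2 * beta + 1))) * a `^ (- (1 / (2 * beta + 1))).
Definition rate_of : R :=
  v `^ ((beta + 1) / (2 * beta + 1)) * a `^ (- (beta / (2 * beta + 1))).

Let b1 : 2 * beta + 1 != 0.
Proof. by case/andP: beta01 => b0 _; rewrite gt_eqF// addr_gt0// mulr_gt0. Qed.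

Lemma bandwidth_gt0 : 0 < bandwidth_of.
Proof. by rewrite mulr_gt0 ?powR_gt0. Qed.

Lemma rate_gt0 : 0 < rate_of.
Proof. by rewrite mulr_gt0 ?powR_gt0. Qed.

(** Up to constants, the smoothness bias: the volume times the oscillation on a
    cell. *)
Lemma bias_rate : v * bandwidth_of `^ beta = rate_of.
Proof.
rewrite [bandwidth_of `^ _]powR_expR ?bandwidth_gt0//.
rewrite /bandwidth_of /rate_of !powR_expR// -!expRD expRK -[v in v * _]lnK//.
by rewrite -expRD; congr expR; field.
Qed.

(** With v / bandwidth the number of cells up to constants and 1 / a = tau^2,
    this is the squared order of sqrt N tau. *)
Lemma cells_rate : v / (bandwidth_of * a) = rate_of ^+ 2.
Proof.
transitivity (expR (ln v) / (bandwidth_of * expR (ln a))).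
  by rewrite !lnK ?posrE.
rewrite /bandwidth_of /rate_of !powR_expR// -!expRD -expRN -expRD.
by rewrite -expRM_natl; congr expR; field.
Qed.

End bandwidth.
End rates.

(** * Lower deviation of the centre of the second stage *)

Section first_stage_signal.
Local Open Scope ereal_scope.
Context {R : realType}.
Variables (f0 : R -> R) (alpha : R) (n N : nat) (J : 'I_N -> interval R).
Hypotheses (alpha01 : (0 < alpha < 1)%R) (n_gt0 : (0 < n)%N)
  (tJ : trivIset setT (cell J)).
Variables (X : set R) (f : R -> R) (mX : measurable X) (df : density X f).
Local Notation Q := (mechanism3 f0 alpha n J).
Local Notation H k := (hist (out Q) k).
Local Notation ta := (tau alpha n).
Local Notation Lap := (@laplace_prob R).
Local Notation delta j := (cell_prob J mX df j - p0 f0 J j)%R.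

(** The lower bound of [sum_law_near0] for Laplace variables, whose [w0] is 1/16. *)
Definition central_prob : R := (16^-1 * (256^-1) ^+ 2)%R.

Lemma central_prob01 : (0 < central_prob <= 1)%R.
Proof.
rewrite /central_prob; set v := (16^-1 : R)%R; set w := (256^-1 : R)%R.
have v01 : (0 < v <= 1)%R by rewrite invr_gt0 invf_le1// ler1n ltr0n.
have w01 : (0 < w <= 1)%R by rewrite invr_gt0 invf_le1// ler1n ltr0n.
clearbody v w; case/andP: v01 => v0 v1; case/andP: w01 => w0 w1.
rewrite mulr_gt0 ?exprn_gt0//=; apply: mulr_ile1; rewrite ?sqr_ge0 ?(ltW v0)//.
exact: exprn_ile1 (ltW w0) w1.
Qed.

Let alpha_gt0 : (0 < alpha)%R. Proof. by case/andP: alpha01. Qed.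
Let alpha_lt1 : (alpha < 1)%R. Proof. by case/andP: alpha01. Qed.
Let n0 : (0 < n%:R :> R)%R. Proof. by rewrite ltr0n. Qed.

Let b : R := (n%:R^-1 * (2 / alpha))%R.
(** The noise on the frequencies; the Laplace noise of a cell is [b] times a sum
    of n variables. *)
Let B j (c : N.-tuple R) : R := (n%:R^-1 * tnth c j - cell_prob J mX df j)%R.

Let mB j : measurable_fun setT (B j).
Proof.
apply: measurable_funB => //; apply: measurable_funM => //.
exact: measurable_tnth.
Qed.

Let B2 j : \int[vector_sum_law (cell_law J mX df) n]_c (B j c ^+ 2)%:E <=
  (cell_prob J mX df j * ta ^+ 2)%:E.
Proof.
have -> : \int[vector_sum_law (cell_law J mX df) n]_c (B j c ^+ 2)%:E =
    \int[vector_sum_law (cell_law J mX df) n]_c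
      ((n%:R ^- 2)%:E * ((tnth c j - n%:R * cell_prob J mX df j) ^+ 2)%:E).
  apply: eq_integral => c _; rewrite -EFinM /B; congr EFin.
  by field; rewrite gt_eqF.
have n20 : 0 <= (n%:R ^- 2 : R)%:E by rewrite lee_fin invr_ge0 sqr_ge0.
rewrite ge0_integralZl//; last 2 first.
- apply/measurable_EFinP; apply: measurable_funX; apply: measurable_funB => //.
  exact: measurable_tnth.
- by move=> c _; rewrite lee_fin sqr_ge0.
apply: (@le_trans _ _ ((n%:R ^- 2)%:E * (n%:R * cell_prob J mX df j)%:E)).
  by apply: lee_wpmul2l => //; exact: count_second_moment.
rewrite -EFinM lee_fin sqr_tau//.
have -> : (n%:R ^- 2 * (n%:R * cell_prob J mX df j) = cell_prob J mX df j * n%:R^-1)%R.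
  by field; rewrite gt_eqF.
rewrite ler_wpM2l ?cell_prob_ge0// lef_pV2 ?posrE ?mulr_gt0 ?exprn_gt0//.
by rewrite ler_piMr ?(ltW n0)// exprn_ile1// ltW.
Qed.

Let S2 : \int[sum_law Lap n]_s ((b * s) ^+ 2)%:E <= (64 * ta ^+ 2)%:E.
Proof.
under eq_integral do rewrite exprMn EFinM.
have b20 : 0 <= (b ^+ 2)%:E by rewrite lee_fin sqr_ge0.
rewrite ge0_integralZl//; last 2 first.
- by apply/measurable_EFinP; exact: measurable_funX.
- by move=> s _; rewrite lee_fin sqr_ge0.
apply: (@le_trans _ _ ((b ^+ 2)%:E * (n%:R * 16)%:E)).
  apply: lee_wpmul2l => //.
  exact: (sum_law_second_moment laplace_symmetric laplace_second_moment).
rewrite -EFinM lee_fin sqr_tau// le_eqVlt; apply/orP; left; apply/eqP.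
by rewrite /b; field; rewrite !gt_eqF.
Qed.

Let S_near0 : central_prob%:E <= sum_law Lap n [set s | (`|b * s| <= ta / 2)%R].
Proof.
have -> : [set s | (`|b * s| <= ta / 2)%R] = near0 (Num.sqrt n%:R / 4).
  have b0 : (0 < b)%R by rewrite mulr_gt0 ?invr_gt0// divr_gt0.
  have E : (ta / 2 = b * (Num.sqrt n%:R / 4))%R.
    rewrite /tau /b sqrtrM ?ler0n// sqrtr_sqr ger0_norm ?(ltW alpha_gt0)//.
    have r0 : (0 < Num.sqrt n%:R :> R)%R by rewrite sqrtr_gt0.
    have -> : (n%:R^-1 = (Num.sqrt n%:R ^+ 2)^-1 :> R)%R by rewrite sqr_sqrtr// ltW.
    by field; rewrite !gt_eqF.
  by apply/seteqP; split => s; rewrite /near0 /= E normrM (gtr0_norm b0) ler_pM2l.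
apply: sum_law_near0 => //.
- exact: laplace_symmetric.
- exact: laplace_second_moment.
- exact: laplace_near0.
- by rewrite invr_ge0 ler0n invf_le1// ler1n.
Qed.

(** [signal_survives] applies to the counts, of variance at most p_j / n, and to
    the Laplace sums, in the representation of the first stage by independent
    counts and noise. *)
Lemma mean_D_large (gamma y : R) : (0 < gamma < 1)%R ->
  (signal_threshold central_prob gamma y * ta ^+ 2 <=
    \sum_j `|delta j| * Num.min `|delta j| ta)%R ->
  out_prob mX df Q n [set h : H n | (mean_D mX df h < y * ta ^+ 2)%R] <= (gamma / 4)%:E.
Proof.
move=> gamma01 strong.
pose G (t : N.-tuple R) : \bar R :=
  ((\sum_j delta j * clip alpha n (n%:R^-1 * tnth t j - p0 f0 J j) < y * ta ^+ 2)%R%:R)%:E.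
have mG : measurable_fun setT G.
  apply/measurable_EFinP.
  apply: (@measurableT_comp _ _ _ _ _ _ (fun b : bool => b%:R : R)) => //.
  apply: measurable_fun_ltr => //; apply: measurable_sum => j.
  apply: measurable_funM => //; apply: (measurableT_comp (measurable_clip alpha n)).
  apply: measurable_funB => //; apply: measurable_funM => //.
  exact: measurable_tnth.
have G0 t : 0 <= G t by rewrite lee_fin.
have mL : measurable [set h : H n | (mean_D mX df h < y * ta ^+ 2)%R].
  rewrite -[X in measurable X]setTI.
  exact: (measurable_fun_ltr (@measurable_mean_D R f0 alpha n N J X f mX df n)
    (@measurable_cst _ _ _ _ setT (y * ta ^+ 2)%R) measurableT (Y := [set true]) I).
rewrite -[X in out_prob _ _ _ _ X]setIT -integral_indic//.
rewrite (_ : (fun h => _) = (fun h : H n => G (sum_Zvec h))); last first.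
  apply/funext => h; rewrite indicE /G; congr ((_ : bool)%:R%:E).
  rewrite (_ : (h \in _) = (mean_D mX df h < y * ta ^+ 2)%R); last first.
    by apply/idP/idP; rewrite inE.
  by congr (_ < _)%R; apply: eq_bigr => j _; rewrite phat_sum_Zvec.
rewrite integral_first_stage_sum//.
have S_sym : symmetric_law (sum_law Lap n).
  exact: sum_law_symmetric laplace_symmetric.
have := signal_survives alpha_gt0 n_gt0 central_prob01 gamma01
  (cell_prob_ge0 J mX df) (sum_cell_prob_le1 tJ mX df) mB B2
  S_sym S2 S_near0 strong.
apply: le_trans; rewrite le_eqVlt; apply/orP; left; apply/eqP.
apply: eq_integral => c _; apply: eq_integral => s _; rewrite /G.
congr (((_ < _)%R)%:R%:E); apply: eq_bigr => j _; congr (_ * clip _ _ _)%R.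
by rewrite tnth_mktuple /B /b; ring.
Qed.

End first_stage_signal.

(** * The separation rate *)

Section separation.
Context {R : realType}.

(** The bound [L1_dist_le] when the signal strength is at most M t^2 and the
    excess mass outside the cells is below c t. The condition h >= k1 * bandwidth
    limits the number of cells, h <= k2 * bandwidth the bias; since beta < 1,
    (2 k2)^beta <= 1 + 2 k2 whatever beta. *)
Lemma l1_budget (N : nat) (delta : 'I_N -> R)
    (v a beta h k1 k2 M c L' I0 m : R) :
  (0 < N)%N -> 0 < v -> 0 < a -> 0 < beta < 1 -> 0 < h -> v = N%:R * (2 * h) ->
  0 < k1 -> k1 * bandwidth_of v a beta <= h <= k2 * bandwidth_of v a beta ->
  0 <= M -> 0 <= c -> 0 <= L' -> 0 <= I0 ->
  let t := (Num.sqrt a)^-1 in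
  m < c * t ->
  \sum_j (`|delta j| * Num.min `|delta j| t) <= M * t ^+ 2 ->
  \sum_j `|delta j| + N%:R * (2 * h) * (L' * (2 * h) `^ beta) + m + 2 * I0 <
  (M + (M + 1) / 2 * Num.sqrt (2 * k1)^-1 + L' * (1 + 2 * k2) + c + 3) *
    (rate_of v a beta + I0 + t).
Proof.
move=> N0 v0 a0 beta01 h0 vE k10 /andP[k1h hk2] M0 c0 L0 I00 t mt sM.
have t0 : 0 < t by rewrite invr_gt0 sqrtr_gt0.
have bw0 := bandwidth_gt0 beta v0 a0.
have r0 := rate_gt0 beta v0 a0.
have biasE := bias_rate v0 a0 beta01.
have cellsE := cells_rate v0 a0 beta01.
move: k1h hk2 bw0 r0 biasE cellsE.
set bw := bandwidth_of v a beta; set r := rate_of v a beta; clearbody bw r.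
move=> k1h hk2 bw0 r0 biasE cellsE.
have k20 : 0 < k2.
  by rewrite -(pmulr_lgt0 _ bw0) (lt_le_trans h0).
have sqrtN : Num.sqrt N%:R * t <= Num.sqrt (2 * k1)^-1 * r.
  have -> : Num.sqrt N%:R * t = Num.sqrt (N%:R / a).
    by rewrite sqrtrM ?ler0n// /t sqrtrV ?ltW.
  have rE : r = Num.sqrt (r ^+ 2) by rewrite sqrtr_sqr gtr0_norm.
  rewrite [in leRHS]rE -sqrtrM ?invr_ge0 ?mulr_ge0 ?(ltW k10)//.
  rewrite ler_sqrt; last first.
    by rewrite mulr_ge0 ?sqr_ge0// invr_ge0 mulr_ge0// ltW.
  rewrite -cellsE.
  have -> : N%:R / a = v / (2 * h * a) by rewrite vE; field; rewrite !gt_eqF.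
  have -> : (2 * k1)^-1 * (v / (bw * a)) = v / (2 * (k1 * bw) * a).
    by field; rewrite !gt_eqF.
  rewrite ler_wpM2l ?(ltW v0)// lef_pV2 ?posrE ?mulr_gt0//.
  by rewrite ler_wpM2r ?(ltW a0)// ler_wpM2l.
have := l1_le_signal N0 t0 sM.
set S := \sum_j _ => SM.
have bias : N%:R * (2 * h) * (L' * (2 * h) `^ beta) <= L' * (1 + 2 * k2) * r.
  rewrite -vE mulrCA -[leRHS]mulrA ler_wpM2l// -biasE mulrCA ler_wpM2l ?(ltW v0)//.
  case/andP: beta01 => b0 b1.
  apply: (@le_trans _ _ ((2 * k2 * bw) `^ beta)).
    apply: ge0_ler_powR; rewrite ?nnegrE ?mulr_ge0 ?(ltW h0) ?(ltW k20) ?(ltW bw0)//.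
      exact: ltW.
    by rewrite -mulrA ler_wpM2l.
  rewrite powRM ?mulr_ge0 ?(ltW k20) ?(ltW bw0)// ler_wpM2r ?powR_ge0//.
  apply: (@le_trans _ _ ((1 + 2 * k2) `^ beta)).
    apply: ge0_ler_powR; rewrite ?nnegrE ?addr_ge0 ?mulr_ge0 ?(ltW k20) ?(ltW b0)//.
    by rewrite lerDr.
  rewrite -[leRHS]powRr1 ?addr_ge0 ?mulr_ge0 ?(ltW k20)//.
  by apply: ler_powR; rewrite ?(ltW b1)// lerDl mulr_ge0// ltW.
have {SM} : S <= M * t + (M + 1) / 2 * Num.sqrt (2 * k1)^-1 * r.
  apply: le_trans SM _; rewrite lerD2l -[leRHS]mulrA ler_wpM2l// divr_ge0// addr_ge0//.
move: bias; set P := _ * Num.sqrt _; set V := L' * (1 + 2 * k2).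
have P0 : 0 <= P.
  by rewrite /P mulr_ge0 ?sqrtr_ge0// divr_ge0// addr_ge0.
have V0 : 0 <= V by rewrite /V mulr_ge0// addr_ge0// mulr_ge0// ltW.
move: (_ * (_ * _ `^ _)) => b; move: P V P0 V0 => P V P0 V0 bV SP.
have := mulr_ge0 M0 (addr_ge0 (ltW r0) I00).
have := mulr_ge0 P0 (addr_ge0 I00 (ltW t0)).
have := mulr_ge0 V0 (addr_ge0 I00 (ltW t0)).
have := mulr_ge0 c0 (addr_ge0 (ltW r0) I00).
lra.
Qed.

(** The terms pay for the signal that escapes detection, the number of cells, the
    bias and the excess mass that escapes T_B; the final 3 pays for the mass of
    f0 outside the cells and makes the comparison strict. *)
Definition rate_constant (L0 L gamma k1 k2 : R) : R :=
  let M := signal_threshold central_prob gamma (4 * Num.sqrt 5 / Num.sqrt gamma) in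
  M + (M + 1) / 2 * Num.sqrt (2 * k1)^-1 + (L + L0) * (1 + 2 * k2)
  + 2 * Num.sqrt (20 / gamma) + 3.

Lemma signal_threshold_ge0 (q gamma y : R) : 0 < q -> 0 < gamma -> 0 <= y ->
  0 <= signal_threshold q gamma y.
Proof.
move=> /ltW q0 /ltW g0 y0.
have l0 : 0 <= large_ratio gamma by rewrite addr_ge0// divr_ge0.
have nl0 : 0 <= noise_level q gamma.
  by apply: divr_ge0; apply: mulr_ge0 => //; rewrite divr_ge0.
apply: mulr_ge0; first by rewrite divr_ge0.
by rewrite !addr_ge0// mulr_ge0.
Qed.

End separation.

Theorem theorem4p3 (R : realType) (L0 L gamma k1 k2 : R)
  (L0_gt0 : 0 < L0) (L0_lt_L : L0 < L) (gamma01 : 0 < gamma < 1)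
  (k1_gt0 : 0 < k1) (k1_le_k2 : k1 <= k2) :
  exists2 C : R, 0 < C &
  forall (alpha beta : R) (n : nat) (X : set R) (f0 : R -> R)
    (B : set R) (N : nat) (J : 'I_N -> interval R) (h : R),
  0 < alpha < 1 -> 0 < beta < 1 -> (0 < n)%N ->
  measurable X -> holder X beta L0 f0 -> density X f0 ->
  B `<=` X -> B !=set0 -> compact B ->
  0 < h -> is_partition J B h ->
  let volB := fine (lebesgue_measure B) in
  let na2 := n%:R * alpha ^+ 2 in
  let bandwidth := volB `^ (- (1 / (2 * beta + 1)))
                   * na2 `^ (- (1 / (2 * beta + 1))) in
  k1 * bandwidth <= h <= k2 * bandwidth ->
  let Q := mechanism3 f0 alpha n J in
  let t1 := 2 * Num.sqrt 5 / (na2 * Num.sqrt gamma) in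
  let t2 := Num.sqrt (20 / (na2 * gamma)) in
  let phi := fun z : hist (out Q) (3 * n) => Phi X f0 alpha n J z t1 t2 in
  let rho := C * (volB `^ ((beta + 1) / (2 * beta + 1))
                    * na2 `^ (- (beta / (2 * beta + 1)))
                  + \int[lebesgue_measure]_(x in X `\` B) f0 x
                  + 1 / Num.sqrt na2) in
  [/\ ldp X (3 * n) alpha Q,
      tests phi,
      (type1 X phi f0
         + nneg_sup [set type2 X phi f | f in alternative X beta L f0 rho]
       <= gamma%:E)%E &
      (separation_rate X beta L alpha (3 * n) f0 gamma <= rho%:E)%E].
Proof.
have g0 : 0 < gamma by case/andP: gamma01.
have sg0 : 0 < Num.sqrt gamma by rewrite sqrtr_gt0.
have /andP[q0 _] := @central_prob01 R.
pose M := signal_threshold central_prob gamma (4 * Num.sqrt 5 / Num.sqrt gamma).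
have M0 : 0 <= M.
  by apply: signal_threshold_ge0 => //; rewrite divr_ge0 ?mulr_ge0 ?sqrtr_ge0.
have L'0 : 0 <= L + L0 by lra.
have k20 : 0 < k2 by apply: lt_le_trans k1_le_k2.
have C0 : 0 < rate_constant L0 L gamma k1 k2.
  rewrite /rate_constant -/M ltr_wpDl// !addr_ge0// mulr_ge0 ?sqrtr_ge0//.
    by rewrite divr_ge0// addr_ge0.
  by rewrite addr_ge0// mulr_ge0// ltW.
exists (rate_constant L0 L gamma k1 k2) => //.
move=> alpha beta n X f0 B N J h alpha01 beta01 n_gt0 mX hf0 df0 BX B_neq0 _.
move=> h0 [BE tJ cell_len] volB na2 bandwidth bw_h Q t1 t2 phi rho.
have alpha_gt0 : 0 < alpha by case/andP: alpha01.
have beta_gt0 : 0 < beta by case/andP: beta01.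
have na2_0 : 0 < na2 by exact: na2_gt0.
have N0 : (0 < N)%N.
  by case: B_neq0 => x; rewrite BE => -[j _ _]; apply: leq_ltn_trans (ltn_ord j).
have cellX j : cell J j `<=` X.
  by move=> x Jx; apply: BX; rewrite BE; exists j.
have volE : volB = N%:R * (2 * h) by rewrite /volB BE; exact: volume_cells.
have vol0 : 0 < volB by rewrite volE mulr_gt0 ?ltr0n// mulr_gt0.
have mPhi : tests phi by exact: measurable_Phi.
have mPhi_set b : measurable [set z | phi z = b].
  by rewrite -[X in measurable X]setTI; exact: (mPhi measurableT [set b] I).
have I00 : 0 <= \int[lebesgue_measure]_(x in X `\` B) f0 x.
  by apply: Rintegral_ge0 => x [Xx _]; case: df0 => _ f00 _; exact: f00.
have ta0 : 0 < tau alpha n by exact: tau_gt0.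
have t1E : 2 * t1 = 4 * Num.sqrt 5 / Num.sqrt gamma * tau alpha n ^+ 2.
  by rewrite /t1 sqr_tau// -/na2; field; rewrite !gt_eqF.
have t2E : 2 * t2 = 2 * Num.sqrt (20 / gamma) * (Num.sqrt na2)^-1.
  rewrite /t2 -mulrA; congr (_ * _).
  rewrite -sqrtrV ?(ltW na2_0)// -sqrtrM ?divr_ge0 ?(ltW g0)//.
  by congr Num.sqrt; field; rewrite !gt_eqF.
have rate0 : 0 < rate_of volB na2 beta by exact: rate_gt0.
have rho0 : 0 < rho.
  rewrite /rho mulr_gt0// ltr_wpDl ?divr_gt0 ?sqrtr_gt0// addr_ge0//.
  exact: ltW.
have risk1 : (type1 X phi f0 <= (gamma / 2)%:E)%E.
  rewrite /type1 (law_out_prob mX df0)//; apply: type1_le => //.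
  - move=> k z; rewrite /mean_D big1// => j _.
    by rewrite cell_probE// subrr mul0r.
  - by rewrite /mean_T outside_probE subrr.
have risk2 f : alternative X beta L f0 rho f -> (type2 X phi f <= (gamma / 2)%:E)%E.
  move=> [df hf far]; rewrite /type2 (law_out_prob mX df)//.
  (* A large excess of f outside the cells is seen by T_B; otherwise a strong
     signal is seen by D_B, and a weak one contradicts the distance to f0. *)
  have quarter : gamma / 4 + gamma / 4 = gamma / 2 by field.
  have [big_T|small_T] := leP (2 * t2) (mean_T f0 J mX df).
    apply: (@le_trans _ _ (gamma / 4)%:E); first exact: type2_le_T.
    by rewrite lee_fin; lra.
  rewrite -quarter; apply: type2_le_D => //.
  rewrite -/t1 t1E; apply: mean_D_large => //.
  rewrite leNgt; apply/negP => weak.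
  move: far; rewrite leNgt => /negP; apply.
  apply: le_lt_trans (L1_dist_le tJ mX df df0 beta_gt0 h0 hf hf0 L'0 cellX cell_len) _.
  rewrite lte_fin -BE /rho div1r.
  apply: (l1_budget (k1 := k1) (k2 := k2) N0 vol0 na2_0 beta01 h0 volE k1_gt0 bw_h M0) => //.
  - by rewrite -t2E.
  - exact: ltW.
have half : gamma / 2 + gamma / 2 = gamma by field.
have half0 : 0 <= gamma / 2 by rewrite divr_ge0// ltW.
split => //.
- exact: mechanism3_ldp.
- rewrite -half EFinD; apply: leeD => //.
  apply: ge_ereal_sup => _ [->|[f Hf <-]]; first by rewrite lee_fin.
  exact: risk2.
- apply: ereal_inf_lbound; exists rho => //; split => //.
  apply: (@le_trans _ _ (ereal_inf [set
          nneg_sup [set (type1 X phi f0 + type2 X phi f)%E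
                   | f in alternative X beta L f0 rho]
          | phi in @tests _ Q (3 * n)])).
    by apply: ereal_inf_lbound; exists Q => //; exact: mechanism3_ldp.
  apply: (@le_trans _ _ (nneg_sup [set (type1 X phi f0 + type2 X phi f)%E
                   | f in alternative X beta L f0 rho])).
    by apply: ereal_inf_lbound; exists phi.
  apply: ge_ereal_sup => _ [->|[f Hf <-]]; first by rewrite lee_fin ltW.
  by rewrite -half EFinD; apply: leeD => //; exact: risk2.
Qed.
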